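(* Let $\tau(p)$ denote the relaxation time (the reciprocal of the spectral gap) of the stationary East process on $\mathbb{Z}$ with parameter $p\in(0,1)$. Then: (a) $\displaystyle \log \tau(p) \leq \left(\tfrac{1}{\log 2} + o(1)\right)\log^2(1/p)$ as $p \downarrow 0$; (b) $\displaystyle \log \tau(p) \geq \left(\tfrac{1}{2\log 2} - o(1)\right)\log^2(1/p)$ as $p \downarrow 0$.
   Context: $\log$ is the natural logarithm and $\log^2 x=(\log x)^2$. East process on $\mathbb{Z}$ with parameter $p$: the continuous-time Markov process with state space $\{0,1\}^{\mathbb{Z}}$ (state $1$ = occupied, $0$ = unoccupied) in which each site $i$ flips at the following rates: if site $i-1$ is in state $0$, the state of site $i$ cannot change; if site $i-1$ is in state $1$, then site $i$ flips $0\to1$ at rate $p$ and $1\to 0$ at rate $1-p$. The product measure $\pi$ under which the coordinates are i.i.d. Bernoulli($p$) is a reversible stationary distribution; $(\mathbf{X}(t))_{t\ge 0}$ denotes the stationary process with $\mathbf{X}(0)\sim\pi$. The process is constructed from the (self-adjoint on $L^2(\pi)$) closure of the corresponding generator on functions depending on finitely many coordinates. The relaxation time is $1/(\text{spectral gap})$ of the generator on $L^2(\pi)$; equivalently $$\tau(p)=\sup_g \frac{\operatorname{var} g(\mathbf{X}(0))}{\mathcal{E}(g,g)},\qquad \mathcal{E}(g,g)=\tfrac12\lim_{t\downarrow0}t^{-1}E\big(g(\mathbf{X}(t))-g(\mathbf{X}(0))\big)^2,$$ the supremum being over non-constant $g\in L^2(\pi)$ (with $\mathcal E(g,g)\in[0,\infty]$).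 A priori $\tau(p)\in(0,\infty]$. *)

(* Defs.v *)
From HB Require Import structures.
From mathcomp Require Import all_boot all_order all_algebra.
From mathcomp Require Import all_classical all_reals all_analysis.
From mathcomp Require Import measurable_realfun.

Set Implicit Arguments.
Unset Strict Implicit.
Unset Printing Implicit Defensive.

Import Order.TTheory GRing.Theory Num.Theory numFieldNormedType.Exports.

Local Open Scope classical_set_scope.
Local Open Scope ring_scope.

Definition cylinders1 : set (set (int -> bool)) :=
  [set A | exists (i : int) (b : bool), A = [set x | x i = b]].

(* {0,1}^Z with its product sigma-algebra; [true] is the occupied state 1. *)
Definition config := g_sigma_algebraType cylinders1.
HB.instance Definition _ := Measurable.on config.

Definition flip (x : config) (i : int) : config :=
  fun j => if j == i then ~~ x j else x j.

Definition local_fun (R : realType) (f : config -> R) : Prop :=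
  exists s : seq int, forall x y : config,
    (forall i, i \in s -> x i = y i) -> f x = f y.

Definition east_rate (R : realType) (p : R) (x : config) (i : int) : R :=
  if x (i - 1) then (if x i then 1 - p else p) else 0.

(* Only meant for [local_fun f]: the sum then has finite support (a sum over an
   infinite support is 0 by convention). *)
Definition east_pregenerator (R : realType) (p : R) (f : config -> R) :
    config -> R :=
  fun x => \sum_(i \in [set: int]) east_rate p x i * (f (flip x i) - f x).

Definition product_bernoulli (R : realType) (p : R)
    (pi : probability config R) : Prop :=
  forall (s : seq int) (e : int -> bool), uniq s ->
    pi [set x : config | forall i, i \in s -> x i = e i] =
    (\prod_(i <- s) (if e i then p else 1 - p))%:E.

Definition L2norm (R : realType) (pi : probability config R)
    (f : config -> R) : \bar R :=
  ('N[pi]_(2%:E)[EFin \o f])%E.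

(* (g, h) belongs to the graph of the L^2(pi)-closure of the operator
   [east_pregenerator p] with domain the local functions. *)
Definition east_generator (R : realType) (p : R) (pi : probability config R)
    (g h : config -> R) : Prop :=
  [/\ g \in Lfun pi 2%:E, h \in Lfun pi 2%:E &
    exists f : nat -> config -> R,
    [/\ forall n, local_fun (f n),
        L2norm pi (f n \- g) @[n --> \oo] --> 0%E &
        L2norm pi (east_pregenerator p (f n) \- h) @[n --> \oo] --> 0%E]].

Definition kernel_op (R : realType) (K : R.-pker config ~> config)
    (g : config -> R) : config -> R :=
  fun x => \int[K x]_(y in [set: config]) g y.

(* (g, h) belongs to the graph of the infinitesimal generator on L^2(pi) of the
   semigroup induced by the transition kernels Q. *)
Definition semigroup_generator (R : realType)
    (Q : R -> R.-pker config ~> config) (pi : probability config R)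
    (g h : config -> R) : Prop :=
  [/\ g \in Lfun pi 2%:E, h \in Lfun pi 2%:E &
    L2norm pi (fun x => (kernel_op (Q t) g x - g x) / t - h x) @[t --> 0^'+]
      --> 0%E].

(* In what follows only the times t >= 0 of X : R -> _ and Q : R -> _ matter. *)

Definition past (R : realType) (d : measure_display)
    (Omega : measurableType d) (P : probability Omega R)
    (X : R -> {RV P >-> config}) (s : R) : set (set Omega) :=
  <<s [set A | exists (u : R) (B : set config),
         [/\ 0 <= u <= s, measurable B & A = X u @^-1` B]] >>.

Definition transition_function (R : realType)
    (Q : R -> R.-pker config ~> config) : Prop :=
  (forall x B, measurable B -> Q 0 x B = \d_x B) /\
  (forall s t x B, 0 <= s -> 0 <= t -> measurable B ->
     Q (s + t) x B = (\int[Q s x]_(y in [set: config]) Q t y B)%E).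

Definition markov_with (R : realType) (d : measure_display)
    (Omega : measurableType d) (P : probability Omega R)
    (Q : R -> R.-pker config ~> config)
    (X : R -> {RV P >-> config}) : Prop :=
  forall (s t : R) (F : set Omega) (B : set config),
    0 <= s -> 0 <= t -> past X s F -> measurable B ->
    P (F `&` X (s + t) @^-1` B) = (\int[P]_(w in F) Q t (X s w) B)%E.

Definition stationary_east_process (R : realType) (d : measure_display)
    (Omega : measurableType d) (P : probability Omega R)
    (p : R) (X : R -> {RV P >-> config}) : Prop :=
  exists Q : R -> R.-pker config ~> config,
  [/\ transition_function Q, markov_with Q X,
      product_bernoulli p (distribution P (X 0)),
      (forall t B, 0 <= t -> measurable B ->
         distribution P (X t) B = distribution P (X 0) B) &
      (forall g h : config -> R,
         semigroup_generator Q (distribution P (X 0)) g h <->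
         east_generator p (distribution P (X 0)) g h)].

Definition dirichlet_form (R : realType) (d : measure_display)
    (Omega : measurableType d) (P : probability Omega R)
    (X : R -> {RV P >-> config}) (g : config -> R) : \bar R :=
  ((2^-1)%:E *
   lim ((t^-1)%:E * 'E_P[fun w => ((g (X t w) - g (X 0 w)) ^+ 2)%R]
          @[t --> 0%R^'+]))%E.

(* Non-constant functions of L^2(pi), as classes modulo pi-null sets. *)
Definition nonconstant_L2 (R : realType)
    (pi : probability config R) : set (config -> R) :=
  [set g | g \in Lfun pi 2%:E /\
           ~ (exists c : R, {ae pi, forall x, g x = c})].

(* Extended-real division: a positive number over 0 is +oo, over +oo is 0. *)
Definition relaxation_time (R : realType) (d : measure_display)
    (Omega : measurableType d) (P : probability Omega R)
    (X : R -> {RV P >-> config}) : \bar R :=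
  ereal_sup [set ('V_P[g \o X 0%R] / dirichlet_form X g)%E
            | g in nonconstant_L2 (distribution P (X 0))].

(* Main.v *)
(* Upper bound. For a block A with an occupied left boundary, followed by a block
   B, the variance on A and B together is at most 3/p times the variance on A plus
   the variance on B restricted to the event that the last site of A is occupied.
   Hence the Poincare constant of a segment of length 2^n with an occupied left
   boundary is at most (3/p)^n. Once the blocks have length of order 1/p, each
   contains an occupied site with probability at least 7/8, and one more step, in
   which a block is resampled when its left neighbour contains an occupied site,
   passes to the whole line at the cost of a constant factor. With n close to
   log_2 (1/p) this gives tau <= 8 (3/p)^n.

   Lower bound. Take n = floor (log_2 (1/p)) and let A be the set of configurations
   on 1, ..., 2^n that can be emptied one site after the other, where a site may be
   removed when k sites are left only if some site (or the boundary 0) lies within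
   2^(n-k) on its left. A is stable under the moves that keep at most n sites
   occupied, so its boundary lies in the layer of n sites, whose weight is at most
   n! 2^(n(n-1)/2) p^n, while its complement contains the configurations occupied
   at 2^n. The indicator of A is the test function.

   The Dirichlet form is defined through the process, whereas the generator is only
   known on local functions. Symmetry of the semigroup and the Poincare inequality
   along an orbit follow from those of the generator by time discretisation, and
   they make E (g(X_t) - g(X_0))^2 / t nonincreasing in t and at least
   2 Var(g) / (C + t), first for local g and then, by density, for all g in L^2. *)
Require Import Defs.
From HB Require Import structures.
From mathcomp Require Import all_boot all_order all_algebra.
From mathcomp Require Import all_classical all_reals all_analysis.
From mathcomp Require Import measurable_realfun.
From mathcomp Require Import ring lra zify.
Import Order.TTheory GRing.Theory Num.Theory numFieldNormedType.Exports.
Local Open Scope classical_set_scope.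
Local Open Scope ring_scope.

Set Implicit Arguments.
Unset Strict Implicit.
Unset Printing Implicit Defensive.

(** * Averages over finitely many sites *)

(** A doubling step costs 3/p because the last site of the left block is occupied only with
    probability p. With n near log_2 (1/p), (3/p)^n has logarithm log^2 (1/p) / log 2 to leading
    order; the 3 adds O(log (1/p)). The constant of the lower bound is half as large because of
    entropy: for p near 2^(-n) the 2^(n(n-1)/2) positions consume half of the exponent of p^n, and
    n! is negligible. The allowed removal distance doubles with each removal so that legal removals
    commute, which keeps A stable under emptying moves.

    On the analytic side, neither reversibility nor convergence of the difference quotient is given:
    the process is tied to the generator only by an equality of graphs, and [lim] is meaningful only
    once convergence is known. Monotonicity in t provides convergence for every g and makes the
    limit a supremum, so that bounds at fixed t apply to it. Until the last density step all
    functions are bounded everywhere, so that integrals are real numbers. *)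

Definition upd (x : config) (i : int) (b : bool) : config :=
  fun j => if j == i then b else x j.

Lemma updC x i j b c : i != j -> upd (upd x i b) j c = upd (upd x j c) i b.
Proof.
move=> ij; apply/funext => k; rewrite /upd.
by case: (eqVneq k j) => // ->; rewrite eq_sym (negbTE ij).
Qed.

Lemma upd_upd x i b c : upd (upd x i b) i c = upd x i c.
Proof. by apply/funext => k; rewrite /upd; case: eqP. Qed.

Lemma upd_id x i : upd x i (x i) = x.
Proof. by apply/funext => k; rewrite /upd; case: eqP => // ->. Qed.

Section Averages.
Variables (R : realType) (p : R).
Implicit Types (f g u c : config -> R) (s t : seq int) (x y : config).

Definition avg1 (i : int) f : config -> R :=
  fun x => p * f (upd x i true) + (1 - p) * f (upd x i false).

(** Conditional expectation given the sites outside [s], defined at every configuration; repeated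
    sites are harmless since [avg1] is idempotent. *)
Definition avg s f : config -> R := foldr avg1 f s.

Definition indep f s := forall x i b, i \in s -> f (upd x i b) = f x.

Definition var s f x := avg s (fun y => f y ^+ 2) x - avg s f x ^+ 2.

Lemma avg_cat s t f : avg (s ++ t) f = avg s (avg t f).
Proof. by rewrite /avg foldr_cat. Qed.

Lemma eq_avg s f g x : f =1 g -> avg s f x = avg s g x.
Proof. by move=> /funext ->. Qed.

Lemma avgD s f g x : avg s (fun y => f y + g y) x = avg s f x + avg s g x.
Proof. by elim: s x => //= i s IH x; rewrite /avg1 !IH; ring. Qed.

Lemma avgB s f g x : avg s (fun y => f y - g y) x = avg s f x - avg s g x.
Proof. by elim: s x => //= i s IH x; rewrite /avg1 !IH; ring. Qed.

Lemma avgZ s a f x : avg s (fun y => a * f y) x = a * avg s f x.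
Proof. by elim: s x => //= i s IH x; rewrite /avg1 !IH; ring. Qed.

Lemma avg_cst s a x : avg s (fun=> a) x = a.
Proof. by elim: s x => //= i s IH x; rewrite /avg1 !IH; ring. Qed.

Lemma avg_sum (I : Type) (r : seq I) (P : pred I) s (F : I -> config -> R) x :
  avg s (fun y => \sum_(i <- r | P i) F i y) x = \sum_(i <- r | P i) avg s (F i) x.
Proof.
elim: r => [|i r IH].
  by under eq_avg do rewrite big_nil; rewrite avg_cst big_nil.
rewrite big_cons; case: ifPn => Pi.
  by under eq_avg do rewrite big_cons Pi; rewrite avgD IH.
by under eq_avg do rewrite big_cons (negbTE Pi).
Qed.

Lemma avg1C i j f : avg1 i (avg1 j f) = avg1 j (avg1 i f).
Proof.
apply/funext => x; rewrite /avg1; case: (eqVneq i j) => [->//|ij].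
by rewrite ![upd (upd x i _) j _]updC//; ring.
Qed.

Lemma avg1_avg i s f : avg1 i (avg s f) = avg s (avg1 i f).
Proof. by elim: s => //= j s IH; rewrite avg1C IH. Qed.

Lemma avgC s t f : avg s (avg t f) = avg t (avg s f).
Proof. by elim: s => //= i s ->; rewrite avg1_avg. Qed.

Lemma avg1_indep i f : indep (avg1 i f) [:: i].
Proof. by move=> x j b; rewrite inE => /eqP ->; rewrite /avg1 !upd_upd. Qed.

Lemma indep_sub f s t : {subset t <= s} -> indep f s -> indep f t.
Proof. by move=> ts fs x i b /ts; apply: fs. Qed.

Lemma avg1_indepS i f s : indep f s -> indep (avg1 i f) s.
Proof.
move=> fs x j b js; case: (eqVneq i j) => [<-|ij].
  by rewrite avg1_indep// inE.
have ji : j != i by rewrite eq_sym.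
by rewrite /avg1 !(@updC x j i)// !(fs _ j).
Qed.

Lemma avg_indep f s : indep (avg s f) s.
Proof.
elim: s => //= i s IH x j b; rewrite inE => /orP[/eqP ->|js].
  by apply: avg1_indep; rewrite inE.
exact: (@avg1_indepS i _ s).
Qed.

Lemma avg_pull s c f : indep c s -> avg s (fun y => c y * f y) = (fun y => c y * avg s f y).
Proof.
move=> cs; elim: s cs => //= i s IH cs.
rewrite IH; last by apply: indep_sub cs => j js; rewrite inE js orbT.
by apply/funext => x; rewrite /avg1 !(cs x i) ?inE ?eqxx//; ring.
Qed.

Lemma avg_id s f : indep f s -> avg s f = f.
Proof.
move=> fs; have := @avg_pull s f (fun=> 1) fs.
rewrite (_ : (fun y => f y * 1) = f); last by apply/funext => y; rewrite mulr1.
by move=> ->; apply/funext => y; rewrite avg_cst mulr1.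
Qed.

(** Tower property: [avg t f] does not read the sites of [s], so averaging over them changes
    nothing. *)
Lemma avg_absorb s t f : {subset s <= t} -> avg t (avg s f) = avg t f.
Proof.
by move=> st; rewrite avgC avg_id//; apply: indep_sub (@avg_indep f t).
Qed.

Hypothesis p01 : 0 < p < 1.

Let p0 : 0 <= p. Proof. by case/andP: p01 => /ltW. Qed.
Let p1 : 0 <= 1 - p. Proof. by rewrite subr_ge0; case/andP: p01 => _ /ltW. Qed.

(** Only configurations that agree with [x] off [s] enter [avg s f x]. This localisation is how an
    occupied left boundary is exploited. *)
Lemma ler_avg_at s f g x :
  (forall y, (forall i, i \notin s -> y i = x i) -> f y <= g y) ->
  avg s f x <= avg s g x.
Proof.
elim: s x => [|i s IH] x fg /=; first exact: fg.
rewrite /avg1 lerD// ler_wpM2l// IH// => y xy; apply: fg => j;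
  rewrite inE negb_or => /andP[ji js]; by rewrite xy// /upd (negbTE ji).
Qed.

Lemma ler_avg s f g x : (forall y, f y <= g y) -> avg s f x <= avg s g x.
Proof. by move=> fg; apply: ler_avg_at. Qed.

Lemma avg_ge0 s f x : (forall y, 0 <= f y) -> 0 <= avg s f x.
Proof. by move=> f0; rewrite -(avg_cst s 0 x); exact: ler_avg. Qed.

Lemma avg_CS s c u x : (forall y, 0 <= c y) ->
  avg s (fun y => c y * u y) x ^+ 2 <=
  avg s c x * avg s (fun y => c y * u y ^+ 2) x.
Proof.
move=> c0; set A := avg s c x; set B := avg _ _ x; set D := avg _ _ x.
have H l : 0 <= A * l ^+ 2 - 2 * l * B + D.
  have -> : A * l ^+ 2 - 2 * l * B + D =
      avg s (fun y => c y * (u y - l) ^+ 2) x.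
    rewrite /A /B /D (mulrC (avg s c x)) -!avgZ -avgB -avgD; apply: eq_avg => y.
    by ring.
  by apply: avg_ge0 => y; rewrite mulr_ge0// sqr_ge0.
have A0 : 0 <= A by apply: avg_ge0.
move: A0; rewrite le_eqVlt => /orP[/eqP A0|A0].
  rewrite -A0 mul0r; case: (eqVneq B 0) => [->|B0]; first by rewrite expr0n.
  (* With [A = 0] the quadratic is affine in [l], and this [l] would give it the value -1. *)
  have := H ((D + 1) / (2 * B)); rewrite -A0.
  have -> : 0 * ((D + 1) / (2 * B)) ^+ 2 - 2 * ((D + 1) / (2 * B)) * B + D = -1.
    by field.
  by lra.
have := H (B / A).
have -> : A * (B / A) ^+ 2 - 2 * (B / A) * B + D = (A * D - B ^+ 2) / A.
  by field; rewrite gt_eqF.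
by rewrite pmulr_lge0 ?invr_gt0// subr_ge0.
Qed.

Lemma avg_sqr s u x : avg s u x ^+ 2 <= avg s (fun y => u y ^+ 2) x.
Proof.
have := @avg_CS s (fun=> 1) u x (fun=> ler01); rewrite avg_cst mul1r.
rewrite (@eq_avg s (fun y => 1 * u y) u); last by move=> y; rewrite mul1r.
rewrite (@eq_avg s (fun y => 1 * u y ^+ 2) (fun y => u y ^+ 2)) //.
by move=> y; rewrite mul1r.
Qed.

Lemma varE s f : var s f = avg s (fun y => (f y - avg s f y) ^+ 2).
Proof.
apply/funext => x; rewrite /var.
rewrite [RHS](@eq_avg s _ (fun y =>
    f y ^+ 2 - 2 * (avg s f y * f y) + avg s f y * avg s f y)); last by move=> y; ring.
rewrite avgD avgB avgZ !(avg_pull _ (@avg_indep f s)).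
by rewrite (avg_id (@avg_indep f s)); ring.
Qed.

Lemma var_ge0 s f x : 0 <= var s f x.
Proof. by rewrite varE; apply: avg_ge0 => y; rewrite sqr_ge0. Qed.

Lemma var_indep s f : indep (var s f) s.
Proof. by rewrite varE; exact: avg_indep. Qed.

(** The conditional mean is the best approximation among functions that do not read [s]; any other
    [w] adds its squared distance to it. *)
Lemma var_min s f w x : indep w s ->
  var s f x <= avg s (fun y => (f y - w y) ^+ 2) x.
Proof.
move=> ws.
have -> : avg s (fun y => (f y - w y) ^+ 2) x =
  var s f x + (avg s f x - w x) ^+ 2.
  rewrite (@eq_avg s _ (fun y => f y ^+ 2 - 2 * (w y * f y) + w y * w y)); last by move=> y; ring.
  rewrite avgD avgB avgZ !(avg_pull _ ws) (avg_id ws) /var; ring.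
by rewrite lerDl sqr_ge0.
Qed.

End Averages.

Definition segment (a : int) (L : nat) : seq int := [seq a + k%:Z | k <- iota 0 L].

Lemma mem_segment a L i : (i \in segment a L) = (a <= i < a + L%:Z).
Proof.
apply/mapP/idP => [[k]|/andP[ai iL]].
  by rewrite mem_iota => /andP[_ kL] ->; lia.
exists `|i - a|%N; last by lia.
by rewrite mem_iota; lia.
Qed.

Lemma segment_cat a L1 L2 : segment a (L1 + L2) = segment a L1 ++ segment (a + L1%:Z) L2.
Proof.
rewrite /segment iotaD map_cat -[X in iota X L2]addn0 iotaDl -map_comp; congr (_ ++ _).
by apply: eq_map => k /=; rewrite PoszD addrA.
Qed.

Lemma uniq_segment a L : uniq (segment a L).
Proof. by rewrite map_inj_uniq ?iota_uniq// => i j; lia. Qed.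

Lemma ler_sqrD2 (R : realDomainType) (a b : R) : (a + b) ^+ 2 <= 2 * a ^+ 2 + 2 * b ^+ 2.
Proof. by have := sqr_ge0 (a - b); nra. Qed.

(** * Poincare inequality with an occupied left boundary *)

Section TwoBlocks.
Variables (R : realType) (p : R).
Hypothesis p01 : 0 < p < 1.
Local Notation avg := (avg p).
Local Notation var := (var p).

(* The average over the first block of c (f - avg B f) / q is controlled by the
   constrained variance of the second block; replacing the weight c / q by 1
   costs a variance of the first block. *)
Lemma two_block (A B : seq int) (c f : config -> R) (q : R) x :
  0 < q <= 1 -> (forall y, 0 <= c y) -> (forall y, c y <= 1) -> indep c B ->
  (forall y, avg A c y = q) ->
  var (A ++ B) f x <= 3 / q * avg (A ++ B) (fun y => var A f y + c y * var B f y) x.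
Proof.
move=> /andP[q0 q1] c0 c1 cB cq.
pose d y := f y - avg B f y; pose e y := f y - avg A f y.
have TA u : avg (A ++ B) (avg A u) x = avg (A ++ B) u x.
  by rewrite avg_absorb// => i; rewrite mem_cat => ->.
have TB u : avg (A ++ B) (avg B u) x = avg (A ++ B) u x.
  by rewrite avg_absorb// => i; rewrite mem_cat orbC => ->.
have TVA : avg (A ++ B) (var A f) x = avg (A ++ B) (fun y => e y ^+ 2) x.
  by rewrite varE// TA.
have TVB : avg (A ++ B) (fun y => c y * var B f y) x =
           avg (A ++ B) (fun y => c y * d y ^+ 2) x.
  by rewrite -[RHS]TB (avg_pull _ _ cB) varE.
rewrite avgD TVA TVB.
(* [avg A d] is compared with [H], its analogue under the density [c / q]. As [c] does not read [B],
   the difference is [F - avg B F], where [- F] is the covariance of [c / q] and [f] in [A]. *)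
pose F y := - q^-1 * avg A (fun y => c y * e y) y.
pose H y := q^-1 * avg A (fun y => c y * d y) y.
have dE y : avg A d y = H y + (F y - avg B F y).
  have FE z : F z = avg A f z - q^-1 * avg A (fun y => c y * f y) z.
    rewrite /F /e (@eq_avg _ _ _ _ (fun y => c y * f y - avg A f y * c y)).
      rewrite avgB (avg_pull _ _ (@avg_indep _ _ f A)) cq; field.
      by rewrite gt_eqF.
    by move=> w; ring.
  have -> : avg B F y = avg B (avg A f) y - q^-1 * avg B (avg A (fun y => c y * f y)) y.
    by rewrite -avgZ -avgB; apply: eq_avg => z; rewrite FE.
  rewrite FE /H /d avgB (avgC _ A B) (avgC _ B A (fun y => c y * f y)).
  rewrite (avg_pull _ _ cB).
  rewrite (@eq_avg _ _ _ (fun y => c y * (f y - avg B f y))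
     (fun y => c y * f y - c y * avg B f y)); last by move=> z; ring.
  by rewrite avgB; ring.
(* Total variance: the second term is the variance over [B] of the conditional mean [avg A f]. *)
have -> : var (A ++ B) f x =
    avg (A ++ B) (fun y => e y ^+ 2) x + avg (A ++ B) (fun y => (avg A d y) ^+ 2) x.
  rewrite -TVA /var avgB TA.
  have -> : avg (A ++ B) (fun y => avg A d y ^+ 2) x =
            avg (A ++ B) (var B (avg A f)) x.
    rewrite varE// TB; apply: eq_avg => y; congr (_ ^+ 2).
    by rewrite /d avgB (avgC _ A B).
  have mE : avg (A ++ B) (fun y => avg B (avg A f) y ^+ 2) x = avg (A ++ B) f x ^+ 2.
    rewrite avgC -avg_cat avg_id// => y i b iAB.
    by rewrite (@avg_indep _ _ f (A ++ B)).
  rewrite /var avgB TB mE.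
  by ring.
set a := avg (A ++ B) (fun y => e y ^+ 2) x.
set b := avg (A ++ B) (fun y => c y * d y ^+ 2) x.
have qV : 0 < q^-1 by rewrite invr_gt0.
have hH : avg (A ++ B) (fun y => H y ^+ 2) x <= q^-1 * b.
  rewrite /b -[in leRHS]TA -avgZ; apply: ler_avg => // y.
  rewrite /H exprMn; have := @avg_CS _ _ p01 A c d y c0; rewrite cq => /(ler_wpM2l (sqr_ge0 q^-1)).
  by move=> /le_trans; apply; rewrite mulrA expr2 -(mulrA q^-1) mulVf ?gt_eqF// mulr1.
have hF : avg (A ++ B) (fun y => F y ^+ 2) x <= q^-1 * a.
  rewrite /a -[in leRHS]TA -avgZ; apply: ler_avg => // y.
  rewrite /F exprMn sqrrN.
  have := @avg_CS _ _ p01 A c e y c0; rewrite cq => /(ler_wpM2l (sqr_ge0 q^-1)).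
  move=> /le_trans; apply; rewrite mulrA expr2 -(mulrA q^-1) mulVf ?gt_eqF// mulr1.
  rewrite ler_pM2l//; apply: ler_avg => // z.
  by rewrite -[leRHS]mul1r ler_wpM2r// sqr_ge0.
have hFB : avg (A ++ B) (fun y => (F y - avg B F y) ^+ 2) x <= q^-1 * a.
  apply: le_trans hF; rewrite -[in leLHS]TB -varE// -[in leRHS]TB.
  apply: ler_avg => // y; rewrite /var lerBlDr lerDl sqr_ge0//.
have hd : avg (A ++ B) (fun y => avg A d y ^+ 2) x <= 2 * (q^-1 * b) + 2 * (q^-1 * a).
  apply: (@le_trans _ _ (avg (A ++ B) (fun y => 2 * H y ^+ 2 + 2 * (F y - avg B F y) ^+ 2) x)).
    by apply: ler_avg => // y; rewrite dE ler_sqrD2.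
  by rewrite avgD !avgZ lerD// ler_pM2l.
have a0 : 0 <= a by apply: avg_ge0 => // y; rewrite sqr_ge0.
have b0 : 0 <= b by apply: avg_ge0 => // y; rewrite mulr_ge0// sqr_ge0.
have q1' : 1 <= q^-1 by rewrite invf_ge1.
(* The total is [a + 2 (a + b) / q], at most [3 (a + b) / q] because [q <= 1]. *)
apply: le_trans (lerD (lexx a) hd) _.
have aq : a <= q^-1 * a by rewrite ler_peMl.
have bq : 0 <= q^-1 * b by rewrite mulr_ge0// ltW.
rewrite -mulrA mulrDr; lra.
Qed.

(** Contribution of site [j] to the Dirichlet form, in heat-bath form: the constraint times the
    conditional variance at [j]. *)
Definition energy (j : int) (f : config -> R) (y : config) : R :=
  (y (j - 1))%:R * var [:: j] f y.

Lemma energy_ge0 j f y : 0 <= energy j f y.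
Proof. by rewrite mulr_ge0// var_ge0. Qed.

Lemma avg_site (A : seq int) z y : z \in A -> avg A (fun w => (w z)%:R) y = p.
Proof.
move=> zA; rewrite -(@avg_absorb _ _ [:: z]); last by move=> i; rewrite inE => /eqP ->.
rewrite (@eq_avg _ _ _ _ (fun=> p)) ?avg_cst// => w.
by rewrite /= /avg1 /upd eqxx /=; ring.
Qed.

Lemma ler_sum_energy (s t : seq int) (f : config -> R) y :
  uniq s -> {subset s <= t} ->
  \sum_(j <- s) energy j f y <= \sum_(j <- t) energy j f y.
Proof.
move=> us st.
rewrite [leRHS](bigID (mem s))/= -[leLHS]addr0 lerD//; last first.
  by apply: sumr_ge0 => j _; exact: energy_ge0.
rewrite -[leRHS]big_filter.
apply: (@le_trans _ _ (\sum_(j <- undup [seq i <- t | mem s i]) energy j f y)).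
  rewrite (perm_big (undup [seq i <- t | mem s i]))//=.
  apply: uniq_perm => //; first exact: undup_uniq.
  by move=> i; rewrite mem_undup mem_filter /=; case: (boolP (i \in s)) => // /st ->.
elim: [seq _ <- _ | _] => //= i r IH; case: ifPn => _; rewrite ?big_cons.
  by rewrite (le_trans IH)// lerDr energy_ge0.
by rewrite lerD2l.
Qed.

(** All lengths up to 2^n are needed: the leftmost occupied site of a block can be anywhere, so the
    segment to its right has no prescribed length. *)
Lemma poincare_segment n (a : int) (L : nat) (f : config -> R) (x : config) : (L <= 2 ^ n)%N -> x (a - 1) ->
  var (segment a L) f x <=
  (3 / p) ^+ n * avg (segment a L) (fun y => \sum_(j <- segment a L) energy j f y) x.
Proof.
have [p0 p1] := andP p01.
have p3 : 1 <= 3 / p by rewrite ler_pdivlMr// mul1r; lra.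
elim: n a L x => [|n IH] a L x.
  rewrite expn0 expr0 mul1r; case: L => [|[|//]] _ xa.
    by rewrite /segment /= /var /avg /= big_nil subrr.
  have -> : segment a 1 = [:: a] by rewrite /segment /= addr0.
  rewrite -(avg_id p (@var_indep _ p [:: a] f)).
  apply: ler_avg_at => // y yx; rewrite big_seq1 /energy yx ?xa ?mul1r//.
  by rewrite inE; lia.
case: (leqP L (2 ^ n)) => [Ln _ xa|nL Ln xa].
  apply: le_trans (IH _ _ _ Ln xa) _; rewrite exprS -mulrA ler_peMl//.
  apply: mulr_ge0; first by rewrite exprn_ge0// (le_trans ler01).
  by apply: avg_ge0 => // y; apply: sumr_ge0 => j _; exact: energy_ge0.
have [M Lm Mn] : exists2 M, L = (2 ^ n + M)%N & (M <= 2 ^ n)%N.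
  by exists (L - 2 ^ n)%N; move: Ln nL; rewrite expnS; lia.
subst L; set N := (2 ^ n)%N in IH Mn *.
have N0 : (0 < N)%N by rewrite expn_gt0.
rewrite segment_cat; set A := segment a N; set B := segment (a + N%:Z) M.
(* The last site of [A] is the left boundary of [B]; its occupation is the constraint [c] of
   [two_block]. *)
pose z := a + N%:Z - 1.
have zA : z \in A by rewrite mem_segment /z; lia.
pose c (y : config) : R := (y z)%:R.
have cB : indep c B.
  move=> y i b; rewrite mem_segment => iB; rewrite /c /upd.
  by case: eqP => // zi; exfalso; move: iB; rewrite -zi /z; lia.
have c0 y : 0 <= c y by rewrite ler0n.
have c1 y : c y <= 1 by rewrite /c; case: (y z).
have cp y : avg A c y = p by rewrite avg_site.
have pp : 0 < p <= 1 by rewrite p0 ltW.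
apply: (le_trans (@two_block A B c f p x pp c0 c1 cB cp)).
rewrite exprS -[leRHS]mulrA ler_pM2l; last by rewrite (lt_le_trans ltr01).
set K := (3 / p) ^+ n.
have K0 : 0 <= K by rewrite exprn_ge0// (le_trans ler01).
pose S s y := \sum_(j <- s) energy j f y.
have S0 s y : 0 <= S s y by apply: sumr_ge0 => j _; exact: energy_ge0.
apply: (@le_trans _ _ (avg (A ++ B) (fun y => K * avg A (S A) y + K * avg B (S B) y) x)).
  apply: ler_avg_at => // y yx; apply: lerD.
    by apply: IH => //; rewrite yx// mem_cat !mem_segment; lia.
  (* Either [z] is occupied in [y] and the induction hypothesis applies to [B] at [y] itself, or the
     term vanishes. *)
  rewrite /c; case: (boolP (y z)) => yz; rewrite ?mul1r ?mul0r.
    exact: IH.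
  by rewrite mulr_ge0// avg_ge0.
rewrite avgD !avgZ -mulrDr ler_wpM2l// !avg_absorb; last 2 first.
- by move=> i; rewrite mem_cat => ->; rewrite orbT.
- by move=> i; rewrite mem_cat => ->.
by rewrite -avgD; apply: ler_avg => // y; rewrite big_cat.
Qed.

End TwoBlocks.

(** * A chain of blocks with likely constraints *)

Section BlockChain.
Variables (R : realType) (p : R).
Hypothesis p01 : 0 < p < 1.
Local Notation avg := (avg p).
Local Notation var := (var p).
Local Notation energy := (energy p).

(** Law of total variance, with the variance of [avg B f] dropped. *)
Lemma avg_var_sub (B I : seq int) (f : config -> R) x : {subset B <= I} ->
  avg I (var B f) x <= var I f x.
Proof.
move=> BI; rewrite {1}/var avgB avg_absorb// /var lerB//.
by rewrite -(@avg_absorb _ _ _ _ f BI) avg_sqr.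
Qed.

Definition blocks (B : nat -> seq int) k := flatten [seq B i | i <- iota 0 k].

Lemma blocksS B k : blocks B k.+1 = blocks B k ++ B k.
Proof. by rewrite /blocks -addn1 iotaD map_cat flatten_cat /= cats0. Qed.

Lemma sub_blocks B j k : (j <= k)%N -> {subset blocks B j <= blocks B k}.
Proof.
move=> /subnK <-; elim: (k - j)%N => // m IH i /IH.
by rewrite addSn blocksS mem_cat => ->.
Qed.

Lemma block_sub B j k : (j < k)%N -> {subset B j <= blocks B k}.
Proof.
by move=> jk i iB; apply: (sub_blocks jk); rewrite blocksS mem_cat iB orbT.
Qed.

(* The martingale increments obtained by averaging out the blocks from left to
   right each split according to the constraint; on the unlikely event that the
   constraint fails, an increment is bounded by 1/4 of itself and its neighbour. *)
Lemma block_chain (B : nat -> seq int) (c : nat -> config -> R) M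
    (f : config -> R) x :
  indep f (B 0%N) -> (forall k y, 0 <= c k y <= 1) ->
  (forall k, indep (c k) (blocks B k)) -> (forall k, indep (c k) (B k.+1)) ->
  (forall k y, avg (B k) (fun z => 1 - c k z) y <= 8^-1) ->
  var (blocks B M.+1) f x <=
  4 * \sum_(k < M) avg (blocks B M.+1) (fun y => c k y * var (B k.+1) f y) x.
Proof.
move=> f0 c01 cL cR ceps.
set S := blocks B M.+1.
(* A reverse martingale: its increments are orthogonal, so their squared norms [v k] below are
   differences of the [w k] and telescope. *)
pose G k := avg (blocks B k) f.
have GG j k : (j <= k)%N -> avg (blocks B k) (G j) = G k.
  by move=> jk; rewrite avg_absorb//; exact: sub_blocks.
have TB (s : seq int) u : {subset s <= S} -> avg S (avg s u) x = avg S u x.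
  by move=> sS; rewrite avg_absorb.
have sub k : (k <= M.+1)%N -> {subset blocks B k <= S} by exact: sub_blocks.
have bsub k : (k <= M)%N -> {subset B k <= S} by move=> kM; apply: block_sub; rewrite ltnS.
have Gind k : indep (G k) (blocks B k) by apply: avg_indep.
pose w k := avg S (fun y => G k y ^+ 2) x.
have wE j k : (j <= k)%N -> (k <= M.+1)%N ->
    avg S (fun y => (G j y - G k y) ^+ 2) x = w j - w k.
  move=> jk kM.
  rewrite (@eq_avg _ _ _ _ (fun y => G j y ^+ 2 - 2 * (G k y * G j y) + G k y ^+ 2));
    last by move=> y; ring.
  rewrite avgD avgB avgZ -(TB (blocks B k) (fun y => G k y * G j y)); last exact: sub.
  rewrite (avg_pull _ _ (Gind k)) GG//.
  rewrite (@eq_avg _ _ _ (fun y => G k y * G k y) (fun y => G k y ^+ 2)) // /w.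
  by ring.
pose v k := w k - w k.+1.
(* [f] does not read block 0, the only block without a left neighbour to constrain it. *)
have v0 : v 0%N = 0.
  have -> : v 0%N = avg S (fun y => (G 0%N y - G 1%N y) ^+ 2) x by rewrite wE.
  rewrite (@eq_avg _ _ _ _ (fun=> 0)) ?avg_cst// => y.
  by rewrite /G blocksS /= (avg_id _ f0) subrr expr0n.
have vge k : (k <= M)%N -> 0 <= v k.
  by move=> kM; rewrite /v -wE// avg_ge0// => y; rewrite sqr_ge0.
have wM : w M.+1 = avg S f x ^+ 2.
  rewrite /w (_ : G M.+1 = avg S f)// (avg_id p)// => y i b iS.
  by rewrite (@avg_indep _ _ f S).
have varS : var S f x = \sum_(k < M) v k.+1.
  rewrite /var -wM.
  have -> : avg S (fun y => f y ^+ 2) x = w 0%N by [].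
  have -> : w 0%N = w 1%N by apply/eqP; rewrite -subr_eq0 -/(v 0%N) v0.
  have -> : \sum_(k < M) v k.+1 = - \sum_(0 <= k < M) (w k.+2 - w k.+1).
    by rewrite big_mkord -sumrN; apply: eq_bigr => k _; rewrite /v opprB.
  by rewrite (telescope_sumr (fun k => w k.+1))// opprB.
have step k : (k < M)%N -> v k.+1 <=
    2 * avg S (fun y => c k y * var (B k.+1) f y) x + 4^-1 * (v k + v k.+1).
  move=> kM.
  pose d y := f y - avg (B k.+1) f y.
  pose u y := G k y - avg (B k.+1) (G k) y.
  have uE y : avg (blocks B k) d y = u y by rewrite avgB avgC.
  have vE : v k.+1 = avg S (fun y => (avg (blocks B k.+1) d y) ^+ 2) x.
    rewrite /v -wE//; apply: eq_avg => y; congr (_ ^+ 2).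
    by rewrite /d avgB [G k.+2]/G blocksS avg_cat.
  (* Write 1 as [c k + (1 - c k)]. As [1 - c k] does not read the blocks before [k], these can be
     averaged out of [d] in the second part, which leaves [u]. *)
  have split y : avg (blocks B k.+1) d y =
      avg (blocks B k.+1) (fun z => c k z * d z) y +
      avg (B k) (fun z => (1 - c k z) * u z) y.
    have -> : avg (B k) (fun z => (1 - c k z) * u z) y =
              avg (blocks B k.+1) (fun z => (1 - c k z) * d z) y.
      rewrite blocksS avg_cat avgC (@avg_pull _ _ (blocks B k)); last first.
        by move=> z i b /(cL k) ->.
      by apply: eq_avg => z; rewrite uE.
    by rewrite -avgD; apply: eq_avg => z; ring.
  apply: (@le_trans _ _ (avg S (fun y =>
     2 * (avg (blocks B k.+1) (fun z => c k z * d z) y) ^+ 2 +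
     2 * (avg (B k) (fun z => (1 - c k z) * u z) y) ^+ 2) x)).
    rewrite vE; by apply: ler_avg => // y; rewrite split ler_sqrD2.
  rewrite avgD !avgZ; apply: lerD.
    rewrite ler_pM2l//.
    apply: (@le_trans _ _ (avg S (avg (blocks B k.+1) (fun z => c k z * d z ^+ 2)) x)).
      apply: ler_avg => // y; apply: le_trans (avg_sqr p01 _ _ _) _.
      apply: ler_avg => // z; rewrite exprMn ler_wpM2r ?sqr_ge0//.
      by have /andP[? ?] := c01 k z; rewrite expr2 ler_piMl.
    rewrite TB; last by apply: sub; rewrite ltnS ltnW.
    rewrite -(TB (B k.+1)); last exact: bsub.
    by rewrite (avg_pull _ _ (cR k)) -varE.
  have -> : 4^-1 * (v k + v k.+1) = 2 * (8^-1 * (v k + v k.+1)) by lra.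
  rewrite ler_pM2l//.
  have vv : v k + v k.+1 = w k - w k.+2 by rewrite /v; ring.
  rewrite vv -wE//; last by rewrite (leq_trans (leqnSn k)).
  apply: (@le_trans _ _ (8^-1 * avg S (fun y => u y ^+ 2) x)).
    rewrite -[in leRHS](TB (B k)) -?avgZ; last by apply: bsub; exact: ltnW.
    apply: ler_avg => // y.
    have c1 z : 0 <= 1 - c k z by have /andP[? ?] := c01 k z; rewrite subr_ge0.
    apply: le_trans (avg_CS p01 _ _ _ c1) _.
    apply: ler_pM => //; try exact: avg_ge0.
      by apply: avg_ge0 => // z; rewrite mulr_ge0// sqr_ge0.
    apply: ler_avg => // z; rewrite ler_piMl ?sqr_ge0//.
    by have /andP[? ?] := c01 k z; rewrite lerBlDr lerDl.
  rewrite ler_pM2l ?invr_gt0//.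
  rewrite -(TB (B k.+1)); last exact: bsub.
  rewrite -varE -(TB (B k.+1) (fun y => (G k y - G k.+2 y) ^+ 2)); last exact: bsub.
  (* [G k.+2] does not read block [k.+1], so it may replace the conditional mean of [G k]; the
     result is [v k + v k.+1]. *)
  apply: ler_avg => // y; apply: var_min => //.
  by apply: indep_sub (Gind k.+2); exact: block_sub.
clearbody v.
have : \sum_(k < M) v k.+1 <= \sum_(k < M)
   (2 * avg S (fun y => c k y * var (B k.+1) f y) x + 4^-1 * (v k + v k.+1)).
  by apply: ler_sum => k _; exact: step.
rewrite big_split /= -!mulr_sumr big_split /= -varS.
have : \sum_(k < M) v k <= \sum_(k < M) v k.+1.
  case: (M) vge => [|m] vge; first by rewrite !big_ord0.
  rewrite big_ord_recl v0 add0r [leRHS]big_ord_recr /= lerDl vge//.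
rewrite -varS.
(* Since [t <= V], the summed steps give [V <= 2 s + (t + V) / 4 <= 2 s + V / 2], hence the factor
   4. *)
set s := \sum_(k < M) avg _ _ _; set V := var S f x; set t := \sum_(k < M) v k.
by lra.
Qed.

End BlockChain.

(** * Poincare inequality for functions of finitely many sites *)

Section LocalPoincare.
Variables (R : realType) (p : R).
Hypothesis p01 : 0 < p < 1.
Local Notation avg := (avg p).
Local Notation var := (var p).
Local Notation energy := (energy p).

Definition occ (b : int) (m : nat) (y : config) : R := (has y (segment b m))%:R.

Lemma segmentS b m : segment b m.+1 = b :: segment (b + 1) m.
Proof. by rewrite -add1n segment_cat /segment /= addr0. Qed.

Lemma occS b m y : occ b m.+1 y = (y b)%:R + (1 - (y b)%:R) * occ (b + 1) m y.
Proof. by rewrite /occ segmentS /=; case: (y b); rewrite /= ?mulr1n; ring. Qed.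

(* Decomposing according to the leftmost occupied site z of an interval leaves
   the sites to the right of z unconditioned, so that the Poincare inequality of
   the interval with occupied left boundary z applies. *)
Lemma occ_var (S U B : seq int) n (f : config -> R) x m N b (w : config -> R) :
  (forall y, 0 <= w y) -> indep w (segment b N) -> (m <= N)%N -> (N <= 2 ^ n)%N ->
  {subset segment b N <= S} -> {subset segment b N <= U} ->
  {subset B <= segment (b + m%:Z) (N - m)} ->
  avg S (fun y => w y * occ b m y * var B f y) x <=
  (3 / p) ^+ n *
    avg S (fun y => w y * occ b m y * (\sum_(j <- U) energy j f y)) x.
Proof.
have [p0 p1] := andP p01.
have K0 : 0 <= (3 / p) ^+ n by rewrite exprn_ge0// divr_ge0// ltW.
elim: m N b w => [|m IH] N b w w0 wb mN Nn bS bU BN.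
  rewrite -avgZ; apply: ler_avg => // y.
  by rewrite /occ /= mulr0 !mul0r mulr0.
case: N mN Nn wb bS bU BN => // N mN Nn wb bS bU BN.
have sub1 : {subset segment (b + 1) N <= segment b N.+1}.
  by move=> i; rewrite segmentS inE => ->; rewrite orbT.
have w1 : indep w (segment (b + 1) N) by exact: indep_sub wb.
have b1 : indep (fun y : config => (y b)%:R : R) (segment (b + 1) N).
  move=> y i c; rewrite mem_segment /upd => iN; case: eqP => // bi; exfalso.
  by move: iN; rewrite -bi; lia.
pose e y := \sum_(j <- U) energy j f y.
have e0 y : 0 <= e y by apply: sumr_ge0 => j _; exact: energy_ge0.
(* The weight now records that [b] is empty; it still does not read [segment (b + 1) N], which is
   explored next. *)
have IH' : avg S (fun y => w y * (1 - (y b)%:R) * occ (b + 1) m y * var B f y) x <=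
  (3 / p) ^+ n * avg S (fun y => w y * (1 - (y b)%:R) * occ (b + 1) m y * e y) x.
  apply: (IH N) => //.
  - by move=> y; rewrite mulr_ge0//; case: (y b); rewrite /= ?subrr// subr0.
  - by move=> y i c iN; rewrite w1// (b1 y i c iN).
  - exact: ltnW.
  - by move=> i /sub1/bS.
  - by move=> i /sub1/bU.
  - move=> i /BN; rewrite !mem_segment; lia.
have main : avg S (fun y => w y * (y b)%:R * var B f y) x <=
  (3 / p) ^+ n * avg S (fun y => w y * (y b)%:R * e y) x.
  set I := segment (b + 1) N.
  have IS : {subset I <= S} by move=> i /sub1/bS.
  have BI : {subset B <= I} by move=> i /BN; rewrite !mem_segment; lia.
  have wbI : indep (fun y : config => w y * (y b)%:R) I.
    by move=> y i c iN; rewrite w1// (b1 y i c iN).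
  rewrite -(@avg_absorb _ _ I)// (avg_pull _ _ wbI).
  rewrite -(@avg_absorb _ _ I S (fun y => w y * _ * e y))// (avg_pull _ _ wbI).
  rewrite -avgZ; apply: ler_avg => // y.
  rewrite mulrCA; case: (boolP (y b)) => yb; last by rewrite !mulr0 !mul0r.
  rewrite /= mulr1; apply: ler_wpM2l => //.
  apply: le_trans (avg_var_sub p01 _ _ BI) _.
  apply: le_trans (@poincare_segment _ _ p01 n (b + 1) N f y (ltnW Nn) _) _.
    by rewrite addrK.
  rewrite ler_wpM2l//; apply: ler_avg => // z.
  apply: ler_sum_energy => //; first exact: uniq_segment.
  by move=> i /sub1/bU.
have -> : avg S (fun y => w y * occ b m.+1 y * var B f y) x =
  avg S (fun y => w y * (y b)%:R * var B f y) x +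
  avg S (fun y => w y * (1 - (y b)%:R) * occ (b + 1) m y * var B f y) x.
  by rewrite -avgD; apply: eq_avg => y; rewrite occS; ring.
have -> : avg S (fun y => w y * occ b m.+1 y * (\sum_(j <- U) energy j f y)) x =
  avg S (fun y => w y * (y b)%:R * e y) x +
  avg S (fun y => w y * (1 - (y b)%:R) * occ (b + 1) m y * e y) x.
  by rewrite -avgD; apply: eq_avg => y; rewrite occS -/(e y); ring.
by rewrite mulrDr lerD.
Qed.

Lemma avg_occ b m y : avg (segment b m) (fun z => 1 - occ b m z) y = (1 - p) ^+ m.
Proof.
elim: m b y => [|m IH] b y; first by rewrite expr0 /occ /avg /= subr0.
rewrite segmentS -cat1s avg_cat avgC.
rewrite (_ : avg [:: b] _ = fun z => (1 - p) * (1 - occ (b + 1) m z)).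
  by rewrite avgZ IH exprS.
apply/funext => z; rewrite /avg /= /avg1 !occS /upd eqxx /=.
have occE c : occ (b + 1) m (fun j : int => if j == b then c else z j) = occ (b + 1) m z.
  rewrite /occ; congr (nat_of_bool _)%:R; apply: eq_in_has => i.
  by rewrite mem_segment => iN; case: eqP => // ib; exfalso; move: iN; rewrite ib; lia.
by rewrite !occE; ring.
Qed.

Lemma blocks_segment a l M : blocks (fun k => segment (a + (k * l)%N%:Z) l) M = segment a (M * l).
Proof.
elim: M => [|M IH]; first by rewrite mul0n.
by rewrite blocksS IH mulSn addnC segment_cat.
Qed.

(** The 8 is the 4 of [block_chain] times 2, since a block is charged both as constraining and as
    resampled block. Two adjacent blocks fit into 2^n sites, so the segment to the right of the
    leftmost occupied site costs at most (3/p)^n. *)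
Lemma poincare_local n l M a (f : config -> R) x :
  (1 - p) ^+ l <= 8^-1 -> (l + l <= 2 ^ n)%N -> indep f (segment a l) ->
  var (segment a (M.+1 * l)) f x <=
  8 * (3 / p) ^+ n * avg (segment a (M.+1 * l))
    (fun y => \sum_(j <- segment a (M.+1 * l)) energy j f y) x.
Proof.
move=> hl ln fa.
have [p0 p1] := andP p01.
set K := (3 / p) ^+ n.
have K0 : 0 <= K by rewrite exprn_ge0// divr_ge0// ltW.
pose B k := segment (a + (k * l)%N%:Z) l.
pose c k := occ (a + (k * l)%N%:Z) l.
have BE m : segment a (m * l) = blocks B m by rewrite blocks_segment.
set S := segment _ _.
have SE : S = blocks B M.+1 by exact: BE.
pose e s y := \sum_(j <- s) energy j f y.
have occ_ind b m (s : seq int) : (forall i, i \in s -> i \notin segment b m) ->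
    indep (occ b m) s.
  move=> sb y i d /sb ib; rewrite /occ; congr (nat_of_bool _)%:R.
  by apply: eq_in_has => j jb; rewrite /upd; case: eqP => // ji; rewrite -ji jb in ib.
have hc := @block_chain _ _ p01 B c M f x.
rewrite -SE in hc.
have {}hc : var S f x <=
    4 * \sum_(k < M) avg S (fun y => c k y * var (B k.+1) f y) x.
  apply: hc.
  - by rewrite /B mul0n addr0.
  - by move=> k y; rewrite /c /occ ler0n /=; case: (has _ _).
  - by move=> k; apply: occ_ind => i; rewrite -BE !mem_segment; lia.
  - by move=> k; apply: occ_ind => i; rewrite !mem_segment mulSn; lia.
  - by move=> k y; rewrite avg_occ.
apply: (le_trans hc).
have hk (k : 'I_M) : avg S (fun y => c k y * var (B k.+1) f y) x <=
   K * (avg S (e (B k)) x + avg S (e (B k.+1)) x).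
  have kM := ltn_ord k.
  have kM' : ((k.+2) * l <= M.+1 * l)%N by rewrite leq_mul2r; lia.
  have h := @occ_var S (B k ++ B k.+1) (B k.+1) n f x l (l + l)%N
    (a + (k * l)%N%:Z) (fun=> 1) (fun=> ler01) (fun _ _ _ _ => erefl)
    (leq_addr _ _) ln.
  rewrite -/K in h.
  have cE : avg S (fun y => 1 * occ (a + (k * l)%N%:Z) l y * var (B k.+1) f y) x =
    avg S (fun y => c k y * var (B k.+1) f y) x.
    by apply: eq_avg => y; rewrite mul1r.
  rewrite cE in h; apply: le_trans (h _ _ _) _.
  - by move=> i; rewrite !mem_segment; move: kM'; rewrite !mulSn; lia.
  - by move=> i; rewrite mem_cat !mem_segment !mulSn; lia.
  - by move=> i; rewrite !mem_segment !mulSn; lia.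
  rewrite ler_wpM2l// -avgD; apply: ler_avg => // y.
  have -> : \sum_(j <- B k ++ B k.+1) energy j f y = e (B k) y + e (B k.+1) y.
    by rewrite big_cat.
  rewrite mul1r; apply: ler_piMl; last by rewrite /occ; case: (has _ _).
  by rewrite addr_ge0//; apply: sumr_ge0 => j _; exact: energy_ge0.
have eS : avg S (e S) x = \sum_(k < M.+1) avg S (e (B k)) x.
  rewrite -avg_sum; apply: eq_avg => y; rewrite {1}/e SE /blocks big_flatten.
  by rewrite big_map -(big_mkord xpredT (fun k => e (B k) y)) /index_iota subn0.
have e0 k : 0 <= avg S (e (B k)) x.
  by apply: avg_ge0 => // y; apply: sumr_ge0 => j _; exact: energy_ge0.
have h1 : \sum_(k < M) avg S (e (B k)) x <= avg S (e S) x.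
  by rewrite eS big_ord_recr /= lerDl.
have h2 : \sum_(k < M) avg S (e (B k.+1)) x <= avg S (e S) x.
  by rewrite eS big_ord_recl lerDr.
have : \sum_(k < M) avg S (fun y => c k y * var (B k.+1) f y) x <=
  K * (avg S (e S) x + avg S (e S) x).
  apply: (@le_trans _ _ (\sum_(k < M) K * (avg S (e (B k)) x + avg S (e (B k.+1)) x))).
    by apply: ler_sum => k _; exact: hk.
  by rewrite -mulr_sumr ler_wpM2l// big_split lerD.
rewrite -/(e S); set X := avg S (e S) x => h.
have -> : 8 * K * X = 4 * (K * (X + X)) by ring.
by rewrite ler_pM2l.
Qed.

End LocalPoincare.

(** * A bottleneck of bounded entropy *)

Section Peeling.
Variables (L n : nat).
Local Open Scope nat_scope.
Local Open Scope set_scope.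
Implicit Types (s t : {set 'I_L.+1}) (z w y : 'I_L.+1).

Definition near_left s z g := [exists y in s, (y < z) && (z <= y + g)].

(* [peel m s]: the m sites of s other than the boundary site 0 can be removed one
   after the other, each having at the time of its removal a site of s at distance
   at most 2^(n-k) on its left, where k is the current number of sites. *)
Fixpoint peel m s : bool :=
  if m is m'.+1 then
    [exists z in s, near_left s z (2 ^ (n - m)) && peel m' (s :\ z)]
  else s == [set ord0].

Lemma near_leftP s z g : reflect (exists y, [/\ y \in s, y < z & z <= y + g]) (near_left s z g).
Proof.
apply: (iffP exists_inP) => [[y ys /andP[]]|[y [ys yz zy]]]; first by exists y.
by exists y => //; apply/andP.
Qed.

(** If [z] relied on [w], the site on which [w] relied takes over, at no more than twice the
    distance. This is the origin of the doubling distances in [peel]. *)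
Lemma near_left_rm s z w g : w \in s -> near_left s w g -> near_left s z g -> near_left (s :\ w) z (g + g).
Proof.
move=> ws /near_leftP[v [vs vw wv]] /near_leftP[y [ys yz zy]].
apply/near_leftP; case: (eqVneq y w) => [yw|nyw].
  exists v; split; last first.
  - by move: zy; rewrite yw; lia.
  - by move: yz; rewrite yw; lia.
  by rewrite !inE vs andbT; apply/eqP => vw'; rewrite vw' ltnn in vw.
by exists y; split => //; rewrite ?inE ?nyw//; lia.
Qed.

Lemma exp2_half m : m.+2 <= n -> 2 ^ (n - m.+2) + 2 ^ (n - m.+2) = 2 ^ (n - m.+1).
Proof.
move=> mn; rewrite (_ : n - m.+1 = (n - m.+2).+1); last by lia.
by rewrite expnS mul2n addnn.
Qed.

(** Removals commute: if the peeling starts with another site [w], the two can be exchanged, since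
    one site fewer doubles the allowed distance. *)
Lemma peel_rm m s z : m.+1 <= n -> peel m.+1 s -> z \in s ->
  near_left s z (2 ^ (n - m.+1)) -> peel m (s :\ z).
Proof.
elim: m s z => [|m IH] s z mn /exists_inP[w ws /andP[cw pw]] zs cz.
  have [<-//|zw] := eqVneq w z.
  (* The removal of [w] leaves only the boundary, so [z] would be 0, which has nothing on its
     left. *)
  have : z \in s :\ w by rewrite !inE eq_sym zw.
  rewrite (eqP pw) inE => /eqP z0.
  by move: cz => /near_leftP[y [_]]; rewrite z0.
have [<-//|zw] := eqVneq w z.
have zw' : z != w by rewrite eq_sym.
apply/exists_inP; exists w; first by rewrite !inE zw.
apply/andP; split; first by rewrite -exp2_half// near_left_rm.
have -> : s :\ z :\ w = s :\ w :\ z by apply/finset.setP => i; rewrite !inE andbCA.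
apply: IH => //; first exact: ltnW.
  by rewrite !inE zw'.
by rewrite -exp2_half// near_left_rm.
Qed.

(** The new site can be removed first: an adjacent site is within every allowed distance. *)
Lemma peel_add m s z : m < n -> peel m s -> z \notin s -> near_left s z 1 ->
  peel m.+1 (z |: s).
Proof.
move=> mn ps zs /near_leftP[y [ys yz zy]]; apply/exists_inP; exists z.
  by rewrite !inE eqxx.
rewrite finset.setU1K//; apply/andP; split; last exact: ps.
apply/near_leftP; exists y; split=> //.
  by rewrite !inE ys orbT.
by rewrite (leq_trans zy)// leq_add2l expn_gt0.
Qed.

Lemma peel_card m s : peel m s -> #|s| = m.+1.
Proof.
elim: m s => [|m IH] s; first by move=> /eqP ->; rewrite cards1.
by case/exists_inP=> z zs /andP[_ /IH]; rewrite (cardsD1 z s) zs => ->.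
Qed.

Lemma peel0 m s : peel m s -> ord0 \in s.
Proof.
elim: m s => [|m IH] s; first by move=> /eqP ->; rewrite inE.
by case/exists_inP=> z zs /andP[_ /IH]; rewrite inE => /andP[].
Qed.

(** The gaps bridged by [m] sites add up to at most 2^(n-1) + ... + 2^(n-m) = 2^n - 2^(n-m), so site
    2^n is never reached. *)
Lemma peel_range m s z : m <= n -> peel m s -> z \in s -> z + 2 ^ (n - m) <= 2 ^ n.
Proof.
elim: m s z => [|m IH] s z mn; first by move=> /eqP ->; rewrite inE => /eqP ->; rewrite subn0.
case/exists_inP=> w ws /andP[/near_leftP[y [ys yw wy]] pw] zs.
have E : 2 ^ (n - m) = 2 ^ (n - m.+1) + 2 ^ (n - m.+1).
  by rewrite (_ : n - m = (n - m.+1).+1); [rewrite expnS mul2n addnn|lia].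
have [zw|zw] := eqVneq z w.
  have : y \in s :\ w by rewrite !inE ys andbT; apply/eqP => yw'; rewrite yw' ltnn in yw.
  by move=> /(IH _ _ (ltnW mn) pw); rewrite zw E; lia.
have : z \in s :\ w by rewrite !inE zw.
by move=> /(IH _ _ (ltnW mn) pw); rewrite E; lia.
Qed.

(** A set is encoded by what remains after its first removal, the supporting site among the
    remaining ones, and the distance to it; each removal contributes one factor. *)
Lemma peel_count m : m <= n ->
  #|[set s | peel m s]| <= \prod_(k < m) (k.+1 * 2 ^ (n - k.+1)).
Proof.
elim: m => [|m IH] mn.
  rewrite big_ord0 (_ : [set s | _] = [set [set ord0]]) ?cards1//.
  by apply/finset.setP => s; rewrite !inE.
rewrite big_ord_recr /=; set G := 2 ^ (n - m.+1).
pose F (t : {set 'I_L.+1}) :=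
  [set (inord (u.1 + u.2.+1) : 'I_L.+1) |: t | u : 'I_L.+1 * 'I_G in finset.setX t [set: 'I_G]].
have sub : [set s | peel m.+1 s] \subset \bigcup_(t in [set s | peel m s]) F t.
  apply/fintype.subsetP => s; rewrite inE => /exists_inP[z zs /andP[/near_leftP[y [ys yz zy]] pz]].
  apply/bigcupP; exists (s :\ z); first by rewrite inE.
  have dG : z - y.+1 < G by move: zy yz; rewrite -/G; lia.
  apply/imsetP; exists (y, Ordinal dG).
    by rewrite !inE /= ys !andbT; apply/eqP => yz'; rewrite yz' ltnn in yz.
  rewrite /= (_ : inord _ = z); first by rewrite finset.setD1K.
  by apply: val_inj; rewrite /= inordK; move: (ltn_ord z) yz; lia.
apply: leq_trans (subset_leq_card sub) _.
apply: (@leq_trans (\sum_(t in [set s | peel m s]) m.+1 * G)); last first.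
  by rewrite sum_nat_const leq_mul2r IH ?orbT// ltnW.
apply: (@leq_trans (\sum_(t in [set s | peel m s]) #|F t|)).
  elim/big_ind2 : _ => [|A a B b hA hB|//]; first by rewrite cards0.
  by rewrite (leq_trans (leq_card_setU _ _)) // leq_add.
apply: leq_sum => t; rewrite inE => pt.
by rewrite (leq_trans (leq_imset_card _ _))// cardsX (peel_card pt) cardsT card_ord.
Qed.

End Peeling.

(** * Energy and variance of the bottleneck indicator *)

Section TestFunction.
Variables (R : realType) (p : R) (n : nat).
Hypothesis p01 : 0 < p < 1.
Local Notation avg := (avg p).
Local Notation var := (var p).
Local Notation energy := (energy p).
Local Notation L := (2 ^ n)%N.
Local Notation sites := (segment 1 L).

(* The boundary site 0 counts as occupied whatever the value of x at 0: dropping the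
   constraint at site 1 only increases the energy. *)
Definition occupied (x : config) : {set 'I_L.+1} :=
  [set i | (i == ord0) || x (i : nat)%:Z]%SET.

Definition peelable (x : config) : bool :=
  [exists m : 'I_n.+1, peel n m (occupied x)].

Definition test_fun (x : config) : R := (peelable x)%:R.

(** The layer through which the peelable configurations are left: one more site may exceed the
    allowed number. *)
Definition barrier (x : config) : R := (peel n n (occupied x))%:R.

Definition peel_bound : nat := \prod_(k < n) (k.+1 * 2 ^ (n - k.+1)).

Lemma occupied_upd x (z : 'I_L.+1) : z != ord0 ->
  occupied (upd x (z : nat)%:Z true) = (z |: occupied (upd x (z : nat)%:Z false))%SET /\
  z \notin occupied (upd x (z : nat)%:Z false).
Proof.
move=> z0; split; last by rewrite !inE negb_or z0 /upd eqxx.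
apply/finset.setP => k; rewrite !inE /upd.
case: (eqVneq k z) => [->|kz]; first by rewrite eqxx orbT.
suff -> : ((k : nat)%:Z == (z : nat)%:Z) = false by [].
by apply/negP => /eqP[kz']; move/eqP: kz; apply; exact: val_inj.
Qed.

(** If [j - 1] is occupied, filling [j] preserves peelability unless [n] sites are occupied already
    ([peel_add]), and emptying [j] always preserves it ([peel_rm]). So [test_fun] feels [j] only
    when [y0] is in the barrier. *)
Lemma energy_test_fun j y : j \in sites ->
  energy j test_fun y <= p * avg [:: j] barrier y.
Proof.
have [p0 p1] := andP p01.
have bar0 x : 0 <= barrier x by rewrite ler0n.
move=> jS; have jS' := jS; move: jS'; rewrite mem_segment => jS'.
have zlt : (`|j| < L.+1)%N by lia.
pose z : 'I_L.+1 := Ordinal zlt.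
have jz : j = (z : nat)%:Z by rewrite /=; lia.
have z0 : z != ord0 by rewrite -val_eqE /=; lia.
set y1 := upd y j true; set y0 := upd y j false.
have [E1 E0] := occupied_upd y z0; rewrite -jz -/y1 -/y0 in E1 E0.
have vE : var [:: j] test_fun y = p * (1 - p) * (test_fun y1 - test_fun y0) ^+ 2.
  by rewrite /var /avg /= /avg1 -/y1 -/y0; ring.
(* The factor [1 - p] of the variance is the weight of [y0] in [avg [:: j] barrier], so only [p]
   remains. *)
have bE : p * ((1 - p) * barrier y0) <= p * avg [:: j] barrier y.
  rewrite ler_pM2l// /avg /= /avg1 -/y1 -/y0 lerDr.
  by rewrite mulr_ge0// ltW.
apply: le_trans bE.
rewrite /energy vE.
case: (boolP (y (j - 1))) => yj; last by rewrite mul0r !mulr_ge0 ?subr_ge0 // ltW.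
suff : test_fun y1 = test_fun y0 \/ barrier y0 = 1.
  move=> [->|->]; first by rewrite subrr expr0n /= !mulr0 !mulr_ge0 ?subr_ge0// ltW.
  rewrite mul1r mulr1 ger_pMr; last by rewrite mulr_gt0// subr_gt0.
  rewrite /test_fun; case: peelable; case: peelable;
    rewrite ?subrr ?expr0n ?sub0r ?sqrrN ?subr0 ?expr1n //=.
have clos (s : {set 'I_L.+1}) : occupied y0 \subset s -> near_left s z 1.
  move=> /fintype.subsetP s0.
  have wlt : (`|j - 1| < L.+1)%N by lia.
  apply/near_leftP; exists (Ordinal wlt); split => /=; [|lia|lia].
  apply: s0; rewrite inE /y0 /upd /=.
  have -> : (`|j - 1|%N : int) = j - 1 by lia.
  rewrite (_ : (j - 1 == j) = false) ?yj ?orbT//; last by apply/eqP; lia.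
case: (boolP (peelable y0)) => P0.
  case/existsP: (P0) => m Pm.
  case: (ltnP m n) => mn; last first.
    have mE : m = n :> nat by apply/eqP; rewrite eqn_leq mn -ltnS ltn_ord.
    by right; rewrite /barrier -[X in peel _ X]mE Pm.
  left; rewrite /test_fun P0; suff -> : peelable y1 by [].
  have mn' : (m.+1 < n.+1)%N by [].
  apply/existsP; exists (Ordinal mn'); rewrite E1; apply: peel_add => //.
  exact: clos.
left; rewrite /test_fun (negbTE P0); case: (boolP (peelable y1)) => //.
move=> /existsP[[[|m] mn]] /=.
  by rewrite E1 => /eqP /finset.setP /(_ z); rewrite !inE eqxx (negbTE z0).
move=> Pm; exfalso; move/negP: P0; apply; apply/existsP.
have mn' : (m < n.+1)%N by exact: ltnW.
exists (Ordinal mn'); rewrite /= -(finset.setU1K E0) -E1.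
apply: peel_rm => //; first by rewrite E1 !inE eqxx.
have /near_leftP[w [ws wz zw]] : near_left (occupied y1) z 1.
  by apply: clos; rewrite E1 finset.subsetUr.
by apply/near_leftP; exists w; split => //; rewrite (leq_trans zw)// leq_add2l expn_gt0.
Qed.

Lemma avg_prod_site (S r : seq int) x : uniq r -> {subset r <= S} ->
  avg S (fun y => \prod_(i <- r) (y i)%:R) x = p ^+ size r.
Proof.
elim: r => [|i r IH] /= => [_ _|/andP[ir ur] rS].
  by rewrite (@eq_avg _ _ _ _ (fun=> 1)) ?avg_cst// => y; rewrite big_nil.
have iS : {subset [:: i] <= S} by move=> j; rewrite inE => /eqP ->; rewrite rS ?inE ?eqxx.
rewrite -(avg_absorb _ _ iS) exprS -IH//; last by move=> j jr; rewrite rS// inE jr orbT.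
rewrite -avgZ; apply: eq_avg => y; rewrite /avg /= /avg1 !big_cons /upd eqxx /=.
rewrite !mul0r mulr0 addr0 mul1r; congr (_ * _); apply: eq_big_seq => j jr.
by case: eqP => // ji; rewrite -ji jr in ir.
Qed.

(** Union bound over the peelable sets, each of which requires [n] given sites to be occupied. *)
Lemma avg_barrier x : avg sites barrier x <= peel_bound%:R * p ^+ n.
Proof.
pose P := [set s | peel n n s]%SET : {set {set 'I_L.+1}}.
pose q (s : {set 'I_L.+1}) := [seq ((i : 'I_L.+1) : nat)%:Z | i <- enum (s :\ ord0)%SET].
have qle y : barrier y <= \sum_(s in P) \prod_(i <- q s) (y i)%:R.
  have pr0 (s : {set 'I_L.+1}) : 0 <= \prod_(i <- q s) (y i)%:R :> R.
    by apply: prodr_ge0 => i _; rewrite ler0n.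
  rewrite /barrier; case: (boolP (peel n n (occupied y))) => Py; last first.
    by apply: sumr_ge0 => s _.
  rewrite (bigD1 (occupied y)) /=; last by rewrite inE.
  rewrite (_ : \prod_(i <- q _) _ = 1) ?lerDl; first by apply: sumr_ge0.
  rewrite big_map big1_seq// => i; rewrite mem_enum !inE /= => /andP[i0].
  by rewrite (negbTE i0) /= => ->.
apply: le_trans (ler_avg p01 _ _ qle) _; rewrite avg_sum.
apply: (@le_trans _ _ (\sum_(s in P) p ^+ n)).
  apply: ler_sum => s; rewrite inE => Ps; rewrite avg_prod_site.
  - rewrite size_map -cardE.
    have := cardsD1 ord0 s; rewrite (peel0 Ps) (peel_card Ps) => -[nE].
    by rewrite [X in _ <= _ ^+ X]nE.
  - by rewrite map_inj_uniq ?enum_uniq// => i j [] /val_inj.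
  - move=> i /mapP[k]; rewrite mem_enum !inE => /andP[k0 _] ->; rewrite mem_segment.
    by move: k0 (ltn_ord k); rewrite -val_eqE /=; lia.
rewrite sumr_const -[X in X <= _]mulr_natl ler_wpM2r ?exprn_ge0//.
  by have /andP[/ltW] := p01.
by rewrite ler_nat; exact: peel_count.
Qed.

Lemma energy_test x : avg sites (fun y => \sum_(j <- sites) energy j test_fun y) x <=
  L%:R * p * (peel_bound%:R * p ^+ n).
Proof.
have [p0 p1] := andP p01.
rewrite avg_sum.
apply: (@le_trans _ _ (\sum_(j <- sites) p * (peel_bound%:R * p ^+ n))).
  rewrite big_seq [leRHS]big_seq; apply: ler_sum => j jS.
  apply: (@le_trans _ _ (avg sites (fun y => p * avg [:: j] barrier y) x)).
    by apply: ler_avg => // y; exact: energy_test_fun.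
  rewrite avgZ avg_absorb; last by move=> i; rewrite inE => /eqP ->.
  by rewrite ler_pM2l// avg_barrier.
rewrite big_const_seq count_predT size_map size_iota iter_addr_0.
by rewrite -[X in X <= _]mulr_natl mulrA.
Qed.

(** The variance of an indicator is a product of two probabilities: the empty configuration is
    peelable, and one occupied at the last site is not. *)
Lemma var_test x : (1 - p) ^+ L * p <= var sites test_fun x.
Proof.
have [p0 p1] := andP p01.
have L0 : (0 < L)%N by rewrite expn_gt0.
have -> : var sites test_fun x =
    avg sites test_fun x * avg sites (fun y => 1 - test_fun y) x.
  rewrite /var avgB avg_cst (@eq_avg _ _ _ _ test_fun); first by ring.
  by move=> y; rewrite /test_fun; case: peelable; rewrite ?expr1n ?expr0n.
apply: ler_pM; rewrite ?exprn_ge0 ?subr_ge0 ?(ltW p0) ?(ltW p1)//.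
  rewrite -(avg_occ p01 1 L x); apply: ler_avg => // y.
  rewrite /occ /test_fun; case: (boolP (has y (segment 1 L))) => hy.
    by rewrite subrr ler0n.
  rewrite subr0; suff -> : peelable y by [].
  apply/existsP; exists ord0; apply/eqP/finset.setP => k; rewrite !inE.
  case: eqP => //= /eqP k0; apply/negP => yk; move/negP: hy; apply.
  apply/hasP; exists (k : nat)%:Z => //; rewrite mem_segment.
  by move: k0 (ltn_ord k); rewrite -val_eqE /=; lia.
have LS : L%:Z \in sites by rewrite mem_segment; lia.
rewrite -[leLHS](avg_site p x LS); apply: ler_avg => // y.
case: (boolP (y L%:Z)) => yL; rewrite /test_fun; last first.
  by rewrite subr_ge0; case: peelable.
suff /negbTE -> : ~~ peelable y by rewrite subr0.
apply/negP => /existsP[m Pm].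
have mn : (m <= n)%N by rewrite -ltnS.
have : ord_max \in occupied y by rewrite inE /= yL orbT.
have e0 : (0 < 2 ^ (n - m))%N by rewrite expn_gt0.
by move=> /(peel_range mn Pm) /=; lia.
Qed.

End TestFunction.

(** * Local functions and the generator *)

Section BoundedMeasurable.
Context d (T : measurableType d) (R : realType).
Implicit Types f g : T -> R.

(** The algebra in which the semigroup is handled: it contains the local functions, is stable under
    kernels and has real integrals. *)
Definition bdd f := measurable_fun setT f /\ exists M, forall x, `|f x| <= M.

Lemma bdd_cst a : bdd (fun=> a).
Proof. by split; [exact: measurable_cst|exists `|a|]. Qed.

Lemma bddD f g : bdd f -> bdd g -> bdd (fun x => f x + g x).
Proof.
move=> [mf [M fM]] [mg [N gN]]; split; first exact: measurable_funD.
by exists (M + N) => x; rewrite (le_trans (ler_normD _ _))// lerD.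
Qed.

Lemma bddM f g : bdd f -> bdd g -> bdd (fun x => f x * g x).
Proof.
move=> [mf [M fM]] [mg [N gN]]; split; first exact: measurable_funM.
by exists (M * N) => x; rewrite normrM ler_pM.
Qed.

Lemma bddZ a f : bdd f -> bdd (fun x => a * f x).
Proof. by apply: bddM; exact: bdd_cst. Qed.

Lemma bddB f g : bdd f -> bdd g -> bdd (fun x => f x - g x).
Proof.
move=> bf bg; have -> : (fun x => f x - g x) = (fun x => f x + (-1) * g x).
  by apply/funext => x; rewrite mulN1r.
by apply: bddD => //; exact: bddZ.
Qed.

Lemma bddX f n : bdd f -> bdd (fun x => f x ^+ n).
Proof.
move=> bf; elim: n => [|n IH]; first exact: bdd_cst.
have -> : (fun x => f x ^+ n.+1) = (fun x => f x * f x ^+ n).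
  by apply/funext => x; rewrite exprS.
exact: bddM.
Qed.

Lemma bdd_integrable (mu : {measure set T -> \bar R}) f :
  (mu setT < +oo)%E -> bdd f -> mu.-integrable setT (EFin \o f).
Proof.
move=> muT [mf [M fM]]; apply: measurable_bounded_integrable => //.
exists M; split; first exact: num_real.
by move=> N MN x _; apply: (le_trans (fM x)); exact: ltW.
Qed.

End BoundedMeasurable.

Section Expectation.
Context d (T : measurableType d) (R : realType).
Variable mu : {measure set T -> \bar R}.
Hypothesis mu1 : mu setT = 1%E.
Implicit Types f g : T -> R.

Definition mean f : R := \int[mu]_x f x.

Let muoo : (mu setT < +oo)%E. Proof. by rewrite mu1 ltry. Qed.

Lemma eq_mean f g : f =1 g -> mean f = mean g.
Proof. by move=> /funext ->. Qed.

Lemma meanD f g : bdd f -> bdd g -> mean (fun x => f x + g x) = mean f + mean g.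
Proof. by move=> bf bg; rewrite /mean RintegralD//; apply: bdd_integrable. Qed.

Lemma meanB f g : bdd f -> bdd g -> mean (fun x => f x - g x) = mean f - mean g.
Proof. by move=> bf bg; rewrite /mean RintegralB//; apply: bdd_integrable. Qed.

Lemma meanZ a f : bdd f -> mean (fun x => a * f x) = a * mean f.
Proof. by move=> bf; rewrite /mean RintegralZl//; apply: bdd_integrable. Qed.

Lemma mean_cst a : mean (fun=> a) = a.
Proof. by rewrite /mean Rintegral_cst// mu1 /= mulr1. Qed.

Lemma mean_ge0 f : (forall x, 0 <= f x) -> 0 <= mean f.
Proof. by move=> f0; apply: Rintegral_ge0. Qed.

Lemma ler_mean f g : bdd f -> bdd g -> (forall x, f x <= g x) -> mean f <= mean g.
Proof.
by move=> bf bg fg; rewrite /mean le_Rintegral//; exact: bdd_integrable.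
Qed.

Lemma mean_EFin f : bdd f -> (mean f)%:E = (\int[mu]_x (f x)%:E)%E.
Proof.
move=> bf; rewrite /mean /Rintegral fineK//; apply: integrable_fin_num => //.
exact: bdd_integrable.
Qed.

End Expectation.

Section Disintegration.
Context d d1 d2 (X : measurableType d) (Y : measurableType d1)
  (Z : measurableType d2) (R : realType).
Variables (l : R.-pker X ~> Y) (K : R.-pker Y ~> Z).
Local Open Scope ereal_scope.

Lemma ge0_integral_disintegration (nu : {measure set Z -> \bar R}) x (f : Z -> \bar R) :
  (forall B, measurable B -> nu B = \int[l x]_y K y B) ->
  (forall z, 0 <= f z) -> measurable_fun setT f ->
  \int[nu]_z f z = \int[l x]_y \int[K y]_z f z.
Proof.
move=> nuE f0 mf.
rewrite -[RHS](@integral_kcomp _ _ _ X Y Z R l (@kernel.kernel_snd _ _ _ X Y Z R K) x f f0 mf).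
by apply: eq_measure_integral => B mB _; rewrite nuE.
Qed.
End Disintegration.

(** Presents invariance of a measure as a case of Chapman-Kolmogorov, so that [mean_disintegration]
    serves for both. *)
Definition cst_kernel d (Y : measurableType d) (R : realType)
    (mu : probability Y R) : R.-pker Y ~> Y :=
  kprobability (measurable_cst (mu : pprobability Y R)).

Section LocalFunctions.
Variable (R : realType).
Implicit Types (f g : config -> R) (s t : seq int) (x y e : config).

Definition depends (A : Type) (f : config -> A) s :=
  forall x y, (forall i, i \in s -> x i = y i) -> f x = f y.

Definition cyl s e x : R := (all (fun i => x i == e i) s)%:R.

Lemma depends_sub A (f : config -> A) s t : {subset s <= t} -> depends f s -> depends f t.
Proof. by move=> st fs x y xy; apply: fs => i /st /xy. Qed.

Lemma depends_indep f s i : depends f s -> i \notin s -> indep f [:: i].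
Proof.
move=> fs iS x j b; rewrite inE => /eqP ->; apply: fs => k ks; rewrite /upd.
by case: eqP => // ki; rewrite -ki ks in iS.
Qed.

(** Local functions are finite combinations of cylinder indicators: the values at the relevant sites
    are fixed one site at a time. *)
Lemma local_ind (P : (config -> R) -> Prop) :
  (forall s e, uniq s -> P (cyl s e)) ->
  (forall a f, P f -> P (fun x => a * f x)) ->
  (forall f g, P f -> P g -> P (fun x => f x + g x)) ->
  forall f, local_fun f -> P f.
Proof.
move=> Pcyl PZ PD f [s0 fs0].
have main s t e g : uniq t -> depends g (t ++ s) -> P (fun x => cyl t e x * g x).
  elim: s t e => [|i s IH] t e ut gs.
    have -> : (fun x => cyl t e x * g x) = (fun x => g e * cyl t e x).
      apply/funext => x; rewrite mulrC /cyl.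
      case: (boolP (all _ _)) => [/allP xe|]; last by rewrite !mulr0.
      congr (_ * _); apply: gs => j; rewrite cats0 => /xe /eqP; exact.
    exact/PZ/Pcyl.
  case: (boolP (i \in t)) => it.
    apply: IH => //; apply: depends_sub gs => j.
    by rewrite !mem_cat inE => /orP[->//|/orP[/eqP ->|->]]; rewrite ?it ?orbT.
  have -> : (fun x => cyl t e x * g x) =
      (fun x => cyl (i :: t) (upd e i true) x * g x + cyl (i :: t) (upd e i false) x * g x).
    apply/funext => x; rewrite -mulrDl; congr (_ * _); rewrite /cyl /=.
    have E b : all (fun j => x j == upd e i b j) t = all (fun j => x j == e j) t.
      apply: eq_in_all => j jt; rewrite /upd; case: (eqVneq j i) => // ji.
      by rewrite -ji jt in it.
    rewrite !E /upd !eqxx; case: (x i); case: (all _ _); rewrite /= ?addr0 ?add0r//.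
  apply: PD; apply: IH; rewrite /= ?it//; apply: depends_sub gs => j;
    by rewrite /= !(mem_cat, inE) => /orP[->|/orP[->|->]]; rewrite ?orbT.
have -> : f = (fun x => cyl [::] (fun=> true) x * f x).
  by apply/funext => x; rewrite mul1r.
exact: (main s0 [::] _ f isT fs0).
Qed.

Lemma measurable_coord i b : measurable [set x : config | x i = b].
Proof. by apply: sub_sigma_algebra; exists i, b. Qed.

Lemma measurable_cylset s e : measurable [set x : config | forall i, i \in s -> x i = e i].
Proof.
elim: s => [|i s IH].
  rewrite (_ : [set _ | _] = setT)//.
  by apply/seteqP; split.
rewrite (_ : [set _ | _] = [set x : config | x i = e i] `&`
   [set x : config | forall i, i \in s -> x i = e i]); last first.
  apply/seteqP; split => x /=.
    move=> h; split; first by apply: h; rewrite inE eqxx.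
    by move=> j js; apply: h; rewrite inE js orbT.
  by move=> [xi h] j; rewrite inE => /orP[/eqP ->|/h].
by apply: measurableI => //; exact: measurable_coord.
Qed.

Lemma cylE s e : cyl s e = \1_[set x : config | forall i, i \in s -> x i = e i].
Proof.
apply/funext => x; rewrite /cyl indicE; congr (nat_of_bool _)%:R.
apply/idP/idP => [/allP h|].
  by rewrite inE => i /h /eqP.
by rewrite inE => h; apply/allP => i /h /eqP.
Qed.

Lemma bdd_cyl s e : bdd (cyl s e).
Proof.
split; last by exists 1 => x; rewrite /cyl; case: all; rewrite ?normr1 ?normr0.
by rewrite cylE; apply: measurable_indic; exact: measurable_cylset.
Qed.

Lemma bdd_local f : local_fun f -> bdd f.
Proof.
apply: local_ind => [s e _|a g|g h]; [exact: bdd_cyl|exact: bddZ|exact: bddD].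
Qed.

Section Bernoulli.
Variables (p : R) (pi : probability config R).
Hypothesis p01 : 0 < p < 1.
Hypothesis hpi : product_bernoulli p pi.
Local Notation avg := (avg p).
Local Notation Ex := (mean pi).

Lemma avg_cyl S s e x : uniq s -> {subset s <= S} ->
  avg S (cyl s e) x = \prod_(i <- s) (if e i then p else 1 - p).
Proof.
elim: s x => [|i s IH] x /= => [_ _|/andP[iS us] sS].
  by rewrite (@eq_avg _ _ _ _ (fun=> 1)) ?avg_cst ?big_nil.
have iS1 : {subset [:: i] <= S} by move=> j; rewrite inE => /eqP ->; rewrite sS ?inE ?eqxx.
rewrite -(avg_absorb _ _ iS1) big_cons -(IH x)//; last by move=> j js; rewrite sS// inE js orbT.
rewrite -avgZ; apply: eq_avg => y; rewrite /avg /= /avg1 /cyl /= {1 3}/upd eqxx.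
have E b : all (fun j => upd y i b j == e j) s = all (fun j => y j == e j) s.
  by apply: eq_in_all => j js; rewrite /upd; case: (eqVneq j i) => // ji; rewrite -ji js in iS.
by rewrite !E; case: (e i); rewrite /= ?mulr0 ?addr0 ?add0r.
Qed.

(** [avg S f] reads neither the sites of [S] nor any others, so it is constant. *)
Lemma avg_depends S f x y : depends f S -> avg S f x = avg S f y.
Proof.
move=> fS; have : depends (avg S f) S.
  elim: (X in avg X f) => //= i t IH z w zw; rewrite /avg1.
  by congr (_ * _ + _ * _); apply: IH => j js; rewrite /upd; case: eqP => // _; exact: zw.
elim: S (avg S f) (@avg_indep _ p f S) {fS} x y => [|i S IH] g gi x y gd; first exact: gd.
rewrite -(gi x i (y i)) ?inE ?eqxx//.
have gS : indep g S by apply: indep_sub gi => j js; rewrite inE js orbT.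
apply: IH => // u v uv.
rewrite -(gi u i true) ?inE ?eqxx// -(gi v i true) ?inE ?eqxx//.
by apply: gd => j; rewrite inE /upd; case: eqP => //= _ /uv.
Qed.

Lemma mean_local f S x : depends f S -> Ex f = avg S f x.
Proof.
move=> fS.
(* The cylinder decomposition yields some unspecified [s0]; averaging over [s0] too is harmless,
   [avg S f] being constant. *)
suff [s0 h] : exists s0, forall T y, {subset s0 <= T} -> Ex f = avg T f y.
  rewrite (h (s0 ++ S) x); last by move=> i; rewrite mem_cat => ->.
  rewrite avg_cat (@eq_avg _ _ s0 (avg S f) (fun=> avg S f x)) ?avg_cst// => y.
  exact: avg_depends.
have : local_fun f by exists S.
have pT : pi setT = 1%E by exact: probability_setT.
have : forall f, local_fun f -> bdd f /\ exists s0, forall T y, {subset s0 <= T} -> Ex f = avg T f y.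
  apply: local_ind => [s e us|a g [bg [s0 h]]|g h [bg [s1 hg]] [bh [s2 hh]]].
  - split; first exact: bdd_cyl.
    exists s => T y sT; rewrite avg_cyl// cylE /mean /Rintegral integral_indic//; last first.
      exact: measurable_cylset.
    by rewrite setIT [X in fine X](hpi e us).
  - split; first exact: bddZ.
    by exists s0 => T y sT; rewrite meanZ// avgZ (h T y).
  - split; first exact: bddD.
    exists (s1 ++ s2) => T y sT; rewrite meanD// avgD (hg T y) ?(hh T y)//.
      by move=> i it; apply: sT; rewrite mem_cat it orbT.
    by move=> i it; apply: sT; rewrite mem_cat it.
by move=> /[apply] -[].
Qed.

End Bernoulli.

Lemma test_fun_depends n : depends (test_fun R n) (segment 1 (2 ^ n)).
Proof.
move=> x y xy; congr (nat_of_bool _)%:R; rewrite /peelable.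
suff -> : occupied n x = occupied n y by [].
apply/finset.setP => k; rewrite !inE; case: (eqVneq k ord0) => //= k0; apply: xy.
by rewrite mem_segment; move: k0 (ltn_ord k); rewrite -val_eqE /=; lia.
Qed.

(** * Symmetry, Dirichlet form and spectral gap of the generator on local functions *)

Section Generator.
Variables (p : R).
Hypothesis p01 : 0 < p < 1.
Local Notation avg := (avg p).

(** Flipping at rate p or 1 - p according to the state amounts to resampling the site from
    Bernoulli(p) at rate 1. *)
Lemma pregenE f s x : uniq s -> depends f s ->
  east_pregenerator p f x =
  \sum_(i <- s) (x (i - 1))%:R * (avg [:: i] f x - f x).
Proof.
move=> us fs; rewrite /east_pregenerator.
have flipE i : flip x i = upd x i (~~ x i).
  by apply/funext => j; rewrite /flip /upd; case: eqP => // ->.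
rewrite -(@fsbig_widen _ _ _ _ [set` s])//; last first.
  move=> i [_ /negP iS] /=; rewrite flipE.
  by rewrite (depends_indep fs iS) ?inE// subrr mulr0.
rewrite -fsbig_seq//; apply: eq_bigr => i _; rewrite /east_rate flipE.
rewrite /avg /= /avg1; case: (x (i - 1)); rewrite /= ?mul0r// mul1r.
have xE := upd_id x i.
by case: (x i) xE => xE; rewrite /= -[in f x]xE; ring.
Qed.

Lemma pregen_depends f s : uniq s -> depends f s ->
  depends (east_pregenerator p f) (s ++ [seq i - 1 | i <- s]).
Proof.
move=> us fs x y xy; rewrite !(pregenE _ us fs); apply: eq_big_seq => i iS.
rewrite xy; last by rewrite mem_cat; apply/orP; right; apply/mapP; exists i.
have xys j : j \in s -> x j = y j by move=> js; apply: xy; rewrite mem_cat js.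
rewrite (fs x y xys); congr (_ * (_ - _)); rewrite /avg /= /avg1.
by congr (_ * _ + _ * _); apply: fs => j js; rewrite /upd; case: eqP => // _; exact: xys.
Qed.

Lemma local_pregen f : local_fun f -> local_fun (east_pregenerator p f).
Proof.
move=> [s fs]; exists (undup s ++ [seq i - 1 | i <- undup s]).
apply: pregen_depends; first exact: undup_uniq.
by apply: depends_sub fs => i; rewrite mem_undup.
Qed.

Lemma dependsW A (f : config -> A) : (exists s, depends f s) -> exists2 s, uniq s & depends f s.
Proof.
move=> [s fs]; exists (undup s); first exact: undup_uniq.
by apply: depends_sub fs => i; rewrite mem_undup.
Qed.

Lemma dependsM f g s : depends f s -> depends g s -> depends (fun x => f x * g x) s.
Proof. by move=> fs gs x y xy; rewrite (fs _ _ xy) (gs _ _ xy). Qed.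

Variable (pi : probability config R).
Hypothesis hpi : product_bernoulli p pi.
Local Notation Ex := (mean pi).
Local Notation energy := (energy p).

(** The constraint at [i] does not read [i], so site [i] can be averaged first. The result is
    symmetric in [f] and [g], and for [g = f] it is minus the energy, whence [pregen_sym] and
    [mean_energy]. *)
Lemma mean_pregen f g s S x : uniq s -> depends f s -> depends g S ->
  {subset s ++ [seq i - 1 | i <- s] <= S} ->
  Ex (fun y => g y * east_pregenerator p f y) =
  \sum_(i <- s) avg S (fun y => (y (i - 1))%:R *
     (avg [:: i] g y * avg [:: i] f y - avg [:: i] (fun z => g z * f z) y)) x.
Proof.
move=> us fs gS sS.
rewrite (mean_local hpi (S := S) x); last first.
  by apply: dependsM => //; exact: depends_sub (pregen_depends us fs).
rewrite (@eq_avg _ _ _ _ (fun y => \sum_(i <- s)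
    ((y (i - 1))%:R * (g y * avg [:: i] f y - g y * f y)))); last first.
  move=> y; rewrite (pregenE _ us fs) mulr_sumr; apply: eq_bigr => i _; ring.
rewrite avg_sum; apply: eq_big_seq => i iS.
have ci : indep (fun y : config => (y (i - 1))%:R : R) [:: i].
  move=> y j b; rewrite inE => /eqP ->; rewrite /upd.
  by rewrite (_ : (i - 1 == i) = false)//; apply/eqP; lia.
rewrite -(@avg_absorb _ _ [:: i]); last first.
  by move=> j; rewrite inE => /eqP ->; apply: sS; rewrite mem_cat iS.
rewrite (avg_pull _ _ ci); apply: eq_avg => y; congr (_ * _).
rewrite avgB; congr (_ - _).
under eq_avg do rewrite mulrC.
by rewrite (avg_pull _ _ (@avg_indep _ p f [:: i])) mulrC.
Qed.

Lemma pregen_sym f g : local_fun f -> local_fun g ->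
  Ex (fun y => g y * east_pregenerator p f y) =
  Ex (fun y => f y * east_pregenerator p g y).
Proof.
move=> /dependsW[s us fs] /dependsW[t ut gt].
pose u := undup (s ++ t).
have uu : uniq u by exact: undup_uniq.
have fu : depends f u by apply: depends_sub fs => i; rewrite mem_undup mem_cat => ->.
have gu : depends g u by apply: depends_sub gt => i; rewrite mem_undup mem_cat orbC => ->.
pose S := u ++ [seq i - 1 | i <- u].
have uS : {subset u <= S} by move=> i; rewrite mem_cat => ->.
rewrite (@mean_pregen f g u S (fun=> true))//; last exact: depends_sub gu.
rewrite (@mean_pregen g f u S (fun=> true))//; last exact: depends_sub fu.
apply: eq_bigr => i _; apply: eq_avg => y; congr (_ * (_ - _)).
  by rewrite mulrC.
by apply: eq_avg => z; rewrite mulrC.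
Qed.

Lemma mean_energy f s S x : uniq s -> depends f s -> {subset s ++ [seq i - 1 | i <- s] <= S} ->
  - Ex (fun y => f y * east_pregenerator p f y) =
  avg S (fun y => \sum_(i <- s) energy i f y) x.
Proof.
move=> us fs sS; rewrite (@mean_pregen f f s S x)//; last first.
  by apply: depends_sub fs => i iS; apply: sS; rewrite mem_cat iS.
rewrite avg_sum -sumrN; apply: eq_bigr => i _; rewrite -[LHS]mulN1r -avgZ.
apply: eq_avg => y; rewrite /energy /var.
rewrite (@eq_avg _ _ _ (fun z => f z * f z) (fun z => f z ^+ 2)) // .
by ring.
Qed.

Lemma pregen_le0 f : local_fun f -> 0 <= - Ex (fun y => f y * east_pregenerator p f y).
Proof.
move=> /dependsW[s us fs].
rewrite (mean_energy (fun=> true) us fs (fun i iS => iS)); apply: avg_ge0 => // y.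
by apply: sumr_ge0 => i _; exact: energy_ge0.
Qed.

Lemma poincare_pregen n l f : (1 - p) ^+ l <= 8^-1 -> (l + l <= 2 ^ n)%N -> local_fun f ->
  Ex (fun y => f y ^+ 2) - Ex f ^+ 2 <=
  8 * (3 / p) ^+ n * - Ex (fun y => f y * east_pregenerator p f y).
Proof.
move=> hl ln [s fs].
have l0 : (0 < l)%N.
  by case: (l) hl => // ; rewrite expr0 => h; exfalso; lra.
pose N := (\sum_(i <- s) `|i|)%N.
have sN i : i \in s -> (`|i| <= N)%N.
  by move=> iS; rewrite /N (big_rem i)//= leq_addr.
(* [f] reads only sites of absolute value at most [N]; a block of [l] sites is put in front, because
   [poincare_local] wants a first block that [f] does not read. *)
pose M := (N + N).+1; pose a : int := - N%:Z - l%:Z.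
have sM i : i \in s -> i \in segment (a + l%:Z) (M * l).
  move=> /sN iN; rewrite mem_segment /a.
  have : (M <= M * l)%N by rewrite leq_pmulr.
  by rewrite /M; lia.
set S := segment a (M.+1 * l).
have sS : {subset s <= S}.
  by move=> i /sM; rewrite /S !mem_segment mulSn; lia.
have uS : uniq S by exact: uniq_segment.
have fS : depends f S by exact: depends_sub fs.
have fa : indep f (segment a l).
  move=> x i b ia; apply: (depends_indep fs (i := i)); last by rewrite inE.
  by apply/negP => /sM; move: ia; rewrite !mem_segment; lia.
(* The constraint at the first site reads [a - 1], which must be averaged too. *)
pose S' := (a - 1) :: S.
have sub : {subset S ++ [seq i - 1 | i <- S] <= S'}.
  move=> i; rewrite mem_cat inE => /orP[->|/mapP[j jS ->]]; first by rewrite orbT.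
  by move: jS; rewrite /S !mem_segment; case: (eqVneq (j - 1) (a - 1)) => //=; lia.
pose x0 : config := fun=> true.
rewrite (mean_energy x0 uS fS sub).
have f2S : depends (fun y => f y ^+ 2) S by move=> x y xy; rewrite (fS x y xy).
rewrite (mean_local hpi x0 f2S) (mean_local hpi x0 fS).
have vE y : var p S f y = avg S (fun y => f y ^+ 2) x0 - avg S f x0 ^+ 2.
  by rewrite /var (avg_depends p y x0 f2S) (avg_depends p y x0 fS).
rewrite -(avg_cst p [:: a - 1] (_ - _) x0) -[S']cat1s avg_cat -avgZ.
by apply: ler_avg => // y; rewrite -(vE y); exact: poincare_local.
Qed.

Lemma var_test_mean n (g := test_fun R n) :
  (1 - p) ^+ (2 ^ n) * p <= Ex (fun y => g y ^+ 2) - Ex g ^+ 2.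
Proof.
have gS := @test_fun_depends n; pose x0 : config := fun=> true.
have g2S : depends (fun y => g y ^+ 2) (segment 1 (2 ^ n)).
  by move=> x y xy; rewrite /g (gS x y xy).
rewrite (mean_local hpi x0 g2S) (mean_local hpi x0 gS).
exact: (@var_test _ _ n p01 x0).
Qed.

Lemma energy_test_mean n (g := test_fun R n) :
  - Ex (fun y => g y * east_pregenerator p g y) <=
  (2 ^ n)%:R * p * ((peel_bound n)%:R * p ^+ n).
Proof.
have gS := @test_fun_depends n; pose x0 : config := fun=> true.
rewrite (mean_energy x0 (uniq_segment 1 (2 ^ n)) gS (S := 0 :: segment 1 (2 ^ n))); last first.
  move=> i; rewrite mem_cat inE => /orP[->|/mapP[j jS ->]]; first by rewrite orbT.
  by move: jS; rewrite !mem_segment; case: (eqVneq (j - 1) 0) => //=; lia.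
rewrite -cat1s avg_cat -[leRHS](avg_cst p [:: 0] _ x0).
by apply: ler_avg => // y; exact: energy_test.
Qed.

End Generator.
End LocalFunctions.

(** * The semigroup on bounded functions *)

Section KernelOp.
Variable (R : realType).
Implicit Types (f g : config -> R) (K : R.-pker config ~> config).

Lemma kernel_opE K f : kernel_op K f = fun x => mean (K x) f.
Proof. by []. Qed.

Lemma kernel_opD K f g : bdd f -> bdd g ->
  kernel_op K (fun y => f y + g y) = fun x => kernel_op K f x + kernel_op K g x.
Proof. by move=> bf bg; apply/funext => x; rewrite !kernel_opE meanD// prob_kernel. Qed.

Lemma kernel_opZ K a f : bdd f ->
  kernel_op K (fun y => a * f y) = fun x => a * kernel_op K f x.
Proof. by move=> bf; apply/funext => x; rewrite !kernel_opE meanZ// prob_kernel. Qed.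

Lemma kernel_op_cst K a : kernel_op K (fun=> a) = fun=> a.
Proof. by apply/funext => x; rewrite !kernel_opE mean_cst// prob_kernel. Qed.

Lemma bdd_kernel_op K f : bdd f -> bdd (kernel_op K f).
Proof.
move=> bf; have [mf [M fM]] := bf.
have b1 : bdd (fun x => f x + M) by apply: bddD => //; exact: bdd_cst.
have f0 x : 0 <= f x + M.
  by have := fM x; rewrite ler_norml => /andP[]; rewrite -subr_ge0 opprK.
have k1 x : K x setT = 1%E by rewrite prob_kernel.
have kM x : `|kernel_op K f x| <= M.
  rewrite ler_norml; apply/andP; split.
    rewrite -(mean_cst (k1 x) (- M)) kernel_opE; apply: ler_mean => //; first exact: bdd_cst.
    by move=> y; have := fM y; rewrite ler_norml => /andP[].
  rewrite -(mean_cst (k1 x) M) kernel_opE; apply: ler_mean => //; first exact: bdd_cst.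
  by move=> y; have := fM y; rewrite ler_norml => /andP[].
split; last by exists M.
(* The shift by [M] makes the integrand nonnegative. *)
have -> : kernel_op K f = fun x => kernel_op K (fun y => f y + M) x - M.
  apply/funext => x; rewrite kernel_opD//; last exact: bdd_cst.
  by rewrite kernel_op_cst addrK.
apply: measurable_funB; last exact: measurable_cst.
rewrite kernel_opE /mean /Rintegral.
apply: (measurableT_comp (fine_measurable measurableT)).
apply: (measurable_fun_integral_kernel (l := K)) => [U mU|z|].
- exact: measurable_kernel.
- by rewrite lee_fin.
- by apply/measurable_EFinP; exact: b1.1.
Qed.

Lemma mean_disintegration d (Y : measurableType d) (l : R.-pker Y ~> config) K
    (nu : {measure set config -> \bar R}) y f : nu setT = 1%E ->
  (forall B, measurable B -> nu B = \int[l y]_x K x B)%E -> bdd f ->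
  mean nu f = mean (l y) (kernel_op K f).
Proof.
move=> nu1 nuE bf; have [mf [M fM]] := bf.
have l1 : l y setT = 1%E by exact: prob_kernel.
have bM := bdd_cst config M.
have b1 : bdd (fun x => f x + M) by apply: bddD.
have f0 x : 0 <= f x + M.
  by have := fM x; rewrite ler_norml => /andP[]; rewrite -subr_ge0 opprK.
suff : mean nu (fun x => f x + M) = mean (l y) (kernel_op K (fun x => f x + M)).
  rewrite meanD// kernel_opD// meanD//; try exact: bdd_kernel_op.
  by rewrite kernel_op_cst !mean_cst// => /addIr.
apply: EFin_inj; rewrite !mean_EFin//; last exact: bdd_kernel_op.
rewrite (@ge0_integral_disintegration _ _ _ _ _ _ R l K nu y)//; last first.
  by apply/measurable_EFinP; exact: b1.1.
by apply: eq_integral => x _; rewrite kernel_opE mean_EFin// prob_kernel.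
Qed.

End KernelOp.

(** * Inner product and norm of L2 on bounded functions *)

Section L2.
Variables (R : realType) (pi : probability config R).
Implicit Types f g : config -> R.
Local Notation Ex := (mean pi).

Let pi1 : pi setT = 1%E. Proof. exact: probability_setT. Qed.

Definition ip f g := Ex (fun x => f x * g x).
Definition nrm f := Num.sqrt (Ex (fun x => f x ^+ 2)).

Lemma ipC f g : ip f g = ip g f.
Proof. by apply: eq_mean => x; rewrite mulrC. Qed.

Lemma ipBl f g h : bdd f -> bdd g -> bdd h ->
  ip (fun x => f x - g x) h = ip f h - ip g h.
Proof.
move=> bf bg bh; rewrite /ip -meanB//; [|exact: bddM|exact: bddM].
by apply: eq_mean => x; rewrite mulrBl.
Qed.

Lemma ipBr f g h : bdd f -> bdd g -> bdd h ->
  ip h (fun x => f x - g x) = ip h f - ip h g.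
Proof. by move=> bf bg bh; rewrite ipC ipBl// !(ipC _ h). Qed.

Lemma ipDl f g h : bdd f -> bdd g -> bdd h ->
  ip (fun x => f x + g x) h = ip f h + ip g h.
Proof.
move=> bf bg bh; rewrite /ip -meanD//; [|exact: bddM|exact: bddM].
by apply: eq_mean => x; rewrite mulrDl.
Qed.

Lemma ipDr f g h : bdd f -> bdd g -> bdd h ->
  ip h (fun x => f x + g x) = ip h f + ip h g.
Proof. by move=> bf bg bh; rewrite ipC ipDl// !(ipC _ h). Qed.

Lemma ipZl a f h : bdd f -> bdd h -> ip (fun x => a * f x) h = a * ip f h.
Proof.
move=> bf bh; rewrite /ip -meanZ//; last exact: bddM.
by apply: eq_mean => x; rewrite mulrA.
Qed.

Lemma ipZr a f h : bdd f -> bdd h -> ip h (fun x => a * f x) = a * ip h f.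
Proof. by move=> bf bh; rewrite ipC ipZl// ipC. Qed.

Lemma ipE f : ip f f = Ex (fun x => f x ^+ 2).
Proof. by apply: eq_mean => x; rewrite expr2. Qed.

Lemma ip_ge0 f : 0 <= ip f f.
Proof. by rewrite ipE mean_ge0// => x; rewrite sqr_ge0. Qed.

Lemma nrm_ge0 f : 0 <= nrm f.
Proof. exact: sqrtr_ge0. Qed.

Lemma nrm2 f : nrm f ^+ 2 = ip f f.
Proof. by rewrite ipE sqr_sqrtr// mean_ge0// => x; rewrite sqr_ge0. Qed.

Lemma ip_CS f g : bdd f -> bdd g -> `|ip f g| <= nrm f * nrm g.
Proof.
move=> bf bg.
rewrite -(@ler_pXn2r _ 2)// ?nnegrE ?mulr_ge0 ?nrm_ge0// exprMn !nrm2 real_normK ?num_real//.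
have H l : 0 <= ip f f - l *+ 2 * ip f g + l ^+ 2 * ip g g.
  have := ip_ge0 (fun x => f x - l * g x).
  have blg := bddZ l bg.
  rewrite ipBl// ?ipBr// ?ipZl// ?ipZr// ?(ipC g f); last exact: bddB.
  by move=> h; apply: le_trans h _; rewrite le_eqVlt; apply/orP; left; apply/eqP; ring.
have := ip_ge0 g; rewrite le_eqVlt => /orP[/eqP g0|g0].
  rewrite -g0 mulr0; case: (eqVneq (ip f g) 0) => [->|fg0]; first by rewrite expr0n.
  have := H ((ip f f + 1) / (2 * ip f g)); rewrite -g0 mulr0 addr0.
  have -> : ip f f - (ip f f + 1) / (2 * ip f g) *+ 2 * ip f g = -1 by field.
  by lra.
have := H (ip f g / ip g g).
have -> : ip f f - (ip f g / ip g g) *+ 2 * ip f g + (ip f g / ip g g) ^+ 2 * ip g g =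
   (ip f f * ip g g - ip f g ^+ 2) / ip g g by field; rewrite gt_eqF.
by rewrite pmulr_lge0 ?invr_gt0// subr_ge0.
Qed.

Lemma L2norm_nrm f : bdd f -> L2norm pi f = (nrm f)%:E.
Proof.
move=> bf; rewrite /L2norm unlock.
have -> : (\int[pi]_x (`|(EFin \o f) x| `^ 2) = (Ex (fun x => f x ^+ 2))%:E)%E.
  rewrite mean_EFin//; last exact: bddX.
  by apply: eq_integral => x _ /=; rewrite powR_mulrn// real_normK ?num_real.
by rewrite poweR_EFin powR12_sqrt// mean_ge0// => x; rewrite sqr_ge0.
Qed.

Lemma bdd_Lfun f : bdd f -> f \in Lfun pi 2%:E.
Proof.
move=> bf; rewrite inE; apply/andP; split; rewrite inE /=; first exact: bf.1.
by rewrite /finite_norm -/(L2norm pi f) L2norm_nrm// ltry.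
Qed.

Lemma ip_cvg (u v : nat -> config -> R) f g :
  (forall n, bdd (u n)) -> (forall n, bdd (v n)) -> bdd f -> bdd g ->
  nrm (fun x => u n x - f x) @[n --> \oo] --> 0 ->
  nrm (fun x => v n x - g x) @[n --> \oo] --> 0 ->
  ip (u n) (v n) @[n --> \oo] --> ip f g.
Proof.
move=> bu bv bf bg uf vg.
apply/subr_cvg0.
pose a n := nrm (fun x => u n x - f x); pose b n := nrm (fun x => v n x - g x).
apply/norm_cvg0P.
apply: (@squeeze_cvgr _ _ _ _ (fun=> 0) (fun n => a n * b n + nrm f * b n + a n * nrm g)).
- apply: nearW => n; rewrite normr_ge0 /=.
  have bun := bddB (bu n) bf; have bvn := bddB (bv n) bg.
  have -> : ip (u n) (v n) - ip f g =
     ip (fun x => u n x - f x) (fun x => v n x - g x) +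
     ip f (fun x => v n x - g x) + ip (fun x => u n x - f x) g.
    by rewrite !ipBr// !ipBl//; ring.
  rewrite (le_trans (ler_normD _ _))// lerD// ?ip_CS//.
  by rewrite (le_trans (ler_normD _ _))// lerD// ip_CS.
- exact: cvg_cst.
- rewrite [X in _ --> X](_ : 0 = 0 * 0 + nrm f * 0 + 0 * nrm g); last by ring.
  apply: cvgD; last by apply: cvgM => //; exact: cvg_cst.
  by apply: cvgD; apply: cvgM => //; exact: cvg_cst.
Qed.

End L2.

(** * From the generator to orbits of the semigroup *)

Section Semigroup.
Variables (R : realType) (p : R) (pi : probability config R).
Variable Q : R -> R.-pker config ~> config.
Hypothesis p01 : 0 < p < 1.
Hypothesis hpi : product_bernoulli p pi.
Hypothesis htr : transition_function Q.
Hypothesis hinv : forall (t : R) B, 0 <= t -> measurable B ->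
  (pi B = \int[pi]_x Q t x B)%E.
Hypothesis hgen : forall g h : config -> R,
  semigroup_generator Q pi g h <-> east_generator p pi g h.

Local Notation Ex := (mean pi).
Local Notation ip := (ip pi).
Local Notation nrm := (nrm pi).
Local Notation T t := (kernel_op (Q t)).
Local Notation L := (east_pregenerator p).
Implicit Types (f g h : config -> R) (s t u r e a b C eps th : R).

Let pi1 : pi setT = 1%E. Proof. exact: probability_setT. Qed.

Lemma kernel_op0 f : bdd f -> T 0 f = f.
Proof.
move=> bf; apply/funext => x; rewrite kernel_opE /mean /Rintegral.
rewrite (@eq_measure_integral _ _ _ setT \d_x)//; last first.
  by move=> B mB _; rewrite htr.1.
rewrite integral_dirac//; last by apply/measurable_EFinP; exact: bf.1.
by rewrite diracT mul1e.
Qed.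

Lemma kernel_op_add s t f : 0 <= s -> 0 <= t -> bdd f -> T (s + t) f = T s (T t f).
Proof.
move=> s0 t0 bf; apply/funext => x; rewrite !(kernel_opE _ (kernel_op _ _)).
apply: (@mean_disintegration _ _ _ (Q s)) => //; first exact: prob_kernel.
by move=> B mB; rewrite htr.2.
Qed.

Lemma mean_kernel_op t f : 0 <= t -> bdd f -> Ex (T t f) = Ex f.
Proof.
move=> t0 bf; apply/esym.
exact: (@mean_disintegration _ _ _ (cst_kernel pi) (Q t) pi point f pi1 (fun B mB => hinv t0 mB) bf).
Qed.

Lemma kernel_op_sqr K f x : bdd f -> (kernel_op K f x) ^+ 2 <= kernel_op K (fun y => f y ^+ 2) x.
Proof.
move=> bf; have k1 : K x setT = 1%E by rewrite prob_kernel.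
set m := kernel_op K f x; have bm := bdd_cst config m.
have : 0 <= mean (K x) (fun y => f y ^+ 2 - 2 * m * f y + m ^+ 2).
  apply: mean_ge0 => y; have -> : f y ^+ 2 - 2 * m * f y + m ^+ 2 = (f y - m) ^+ 2 by ring.
  exact: sqr_ge0.
have b2 := bddX 2 bf; have bmf := bddZ (2 * m) bf.
rewrite meanD//; [|exact: bddB|exact: bdd_cst].
rewrite meanB// meanZ// mean_cst// -[mean (K x) f]/m.
rewrite -[mean (K x) (fun y => f y ^+ 2)]/(kernel_op K (fun y => f y ^+ 2) x).
by set v := kernel_op K _ x; nra.
Qed.

(** Contraction: Jensen for the kernel, then invariance of [pi]. *)
Lemma nrm_kernel_op t f : 0 <= t -> bdd f -> nrm (T t f) <= nrm f.
Proof.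
move=> t0 bf; rewrite ler_sqrt; last by apply: mean_ge0 => x; rewrite sqr_ge0.
rewrite -(mean_kernel_op t0 (bddX 2 bf)).
apply: ler_mean => //.
- exact/bddX/bdd_kernel_op.
- exact/bdd_kernel_op/bddX.
- by move=> x; exact: kernel_op_sqr.
Qed.

(** Error of the difference quotient. Keeping it explicit replaces differentiation along orbits by
    finite steps with a small remainder in L2. *)
Definition gen_err t g x := (T t g x - g x) / t - L g x.

Lemma bdd_gen_err t g : local_fun g -> bdd (gen_err t g).
Proof.
move=> lg; have bg := bdd_local lg; have bLg := bdd_local (local_pregen p lg).
apply: bddB => //; have -> : (fun x => (T t g x - g x) / t) = (fun x => t^-1 * (T t g x - g x)).
  by apply/funext => x; rewrite mulrC.
by apply/bddZ/bddB => //; exact: bdd_kernel_op.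
Qed.

(** A local function is its own approximating sequence in the closure. *)
Lemma local_generator g : local_fun g -> semigroup_generator Q pi g (L g).
Proof.
move=> lg; apply/hgen; split.
- exact/bdd_Lfun/bdd_local.
- exact/bdd_Lfun/bdd_local/local_pregen.
have zero f : bdd f -> L2norm pi (f \- f) = 0%E.
  move=> bf; have -> : f \- f = fun=> 0 by apply/funext => x; rewrite /= subrr.
  rewrite L2norm_nrm; last exact: bdd_cst.
  rewrite /nrm (@eq_mean _ _ _ _ _ (fun=> 0)) ?mean_cst ?sqrtr0// => x.
  by rewrite expr0n.
exists (fun=> g); split => //.
- by rewrite zero; [exact: cvg_cst|exact: bdd_local].
- by rewrite zero; [exact: cvg_cst|exact/bdd_local/local_pregen].
Qed.

Lemma gen_err_small g eps : local_fun g -> 0 < eps ->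
  exists2 d, 0 < d & forall t, 0 < t < d -> nrm (gen_err t g) < eps.
Proof.
move=> lg e0; have [_ _] := local_generator lg.
have -> : (fun t => L2norm pi (fun x => (T t g x - g x) / t - L g x)) =
    (fun t => (nrm (gen_err t g))%:E).
  by apply/funext => t; rewrite L2norm_nrm//; exact: bdd_gen_err.
move=> /fine_cvg /cvgr0Pnorm_lt /(_ _ e0) [d /= d0 hd].
exists d => // t /andP[t0 td]; have := hd t; rewrite /= sub0r normrN gtr0_norm//.
by move=> /(_ td t0); rewrite ger0_norm// nrm_ge0.
Qed.

Lemma kernel_op_step g d x : local_fun g -> d != 0 ->
  T d g x - g x = d * (L g x + gen_err d g x).
Proof. by move=> lg d0; rewrite /gen_err; field. Qed.

Lemma orbit_step u d g : local_fun g -> 0 <= u -> 0 < d ->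
  T (u + d) g = fun x => T u g x + d * (T u (L g) x + T u (gen_err d g) x).
Proof.
move=> lg u0 d0; have bg := bdd_local lg; have bLg := bdd_local (local_pregen p lg).
have bE := bdd_gen_err d lg.
rewrite kernel_op_add//; last exact: ltW.
have -> : T d g = fun y => g y + d * (L g y + gen_err d g y).
  apply/funext => y; rewrite -kernel_op_step//; last by rewrite gt_eqF.
  by rewrite addrC subrK.
have bs := bddD bLg bE.
by rewrite kernel_opD//; [rewrite kernel_opZ// kernel_opD|exact: bddZ].
Qed.

(** The semigroup commutes with its generator, so [T u g] is in the domain of the latter and hence
    of the closure of [L]. Thus symmetry and the Poincare inequality pass to orbits, whose members
    need not be local. *)
Lemma orbit_approx u g : local_fun g -> 0 <= u ->
  exists f : nat -> config -> R, [/\ forall n, local_fun (f n),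
    nrm (fun x => f n x - T u g x) @[n --> \oo] --> 0 &
    nrm (fun x => L (f n) x - T u (L g) x) @[n --> \oo] --> 0].
Proof.
move=> lg u0; have bg := bdd_local lg; have bLg := bdd_local (local_pregen p lg).
have bTg := bdd_kernel_op (Q u) bg; have bTL := bdd_kernel_op (Q u) bLg.
have /hgen[_ _ [f [lf f1 f2]]] : semigroup_generator Q pi (T u g) (T u (L g)).
  split; [exact: bdd_Lfun|exact: bdd_Lfun|].
  have [_ _ cvgL] := local_generator lg.
  apply: (squeeze_cvge _ (cvg_cst 0%E) cvgL).
  near=> t.
  have t0 : 0 < t by near: t; exact: nbhs_right_gt.
  have -> : (fun x => (T t (T u g) x - T u g x) / t - T u (L g) x) = T u (gen_err t g).
    rewrite -kernel_op_add ?(ltW t0)// addrC orbit_step//; apply/funext => x.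
    by field; rewrite gt_eqF.
  rewrite L2norm_nrm; last exact/bdd_kernel_op/bdd_gen_err.
  rewrite L2norm_nrm; last exact: bdd_gen_err.
  by rewrite !lee_fin nrm_ge0 /= nrm_kernel_op//; exact: bdd_gen_err.
have bf n : bdd (f n) by exact: bdd_local.
have bLf n : bdd (L (f n)) by exact/bdd_local/local_pregen.
exists f; split => //.
- have E : (fun n => L2norm pi (f n \- T u g)) =
      (fun n => (nrm (fun x => f n x - T u g x))%:E).
    by apply/funext => n; rewrite L2norm_nrm//; exact: bddB.
  by move: f1; rewrite E => /fine_cvg.
- have E : (fun n => L2norm pi (L (f n) \- T u (L g))) =
      (fun n => (nrm (fun x => L (f n) x - T u (L g) x))%:E).
    by apply/funext => n; rewrite L2norm_nrm//; exact: bddB.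
  by move: f2; rewrite E => /fine_cvg.
Unshelve. all: by end_near.
Qed.

Lemma gen_sym s t g h : local_fun g -> local_fun h -> 0 <= s -> 0 <= t ->
  ip (T s (L g)) (T t h) = ip (T s g) (T t (L h)).
Proof.
move=> lg lh s0 t0.
have [a [la a1 a2]] := orbit_approx lg s0; have [b [lb b1 b2]] := orbit_approx lh t0.
have ba n : bdd (a n) by exact: bdd_local.
have bb n : bdd (b n) by exact: bdd_local.
have bLa n : bdd (L (a n)) by exact/bdd_local/local_pregen.
have bLb n : bdd (L (b n)) by exact/bdd_local/local_pregen.
have bT u f : local_fun f -> bdd (T u f) by move=> lf; exact/bdd_kernel_op/bdd_local.
have c1 := ip_cvg bLa bb (bT s _ (local_pregen p lg)) (bT t _ lh) a2 b1.
have c2 := ip_cvg ba bLb (bT s _ lg) (bT t _ (local_pregen p lh)) a1 b2.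
apply: cvg_unique c1 _ => //.
have -> : (fun n => ip (L (a n)) (b n)) = (fun n => ip (a n) (L (b n))) => //.
by apply/funext => n; rewrite ipC; exact: (pregen_sym p01 hpi).
Qed.

Lemma poincare_orbit C u g : 0 <= C -> local_fun g -> 0 <= u ->
  (forall f, local_fun f -> Ex (fun y => f y ^+ 2) - Ex f ^+ 2 <=
      C * - Ex (fun y => f y * L f y)) ->
  ip (T u g) (T u g) - Ex g ^+ 2 <= C * - ip (T u g) (T u (L g)).
Proof.
move=> C0 lg u0 hC; have [a [la a1 a2]] := orbit_approx lg u0.
have ba n : bdd (a n) by exact: bdd_local.
have bLa n : bdd (L (a n)) by exact/bdd_local/local_pregen.
have bTg : bdd (T u g) by exact/bdd_kernel_op/bdd_local.
have bTL : bdd (T u (L g)) by exact/bdd_kernel_op/bdd_local/local_pregen.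
have c1 := ip_cvg ba ba bTg bTg a1 a1.
have c2 := ip_cvg ba bLa bTg bTL a1 a2.
have bone : bdd (fun _ : config => 1 : R) by exact: bdd_cst.
have z1 : nrm (fun x : config => (fun=> 1) x - (fun=> 1) x : R) @[n --> \oo] --> (0 : R).
  rewrite /nrm (@eq_mean _ _ _ _ _ (fun=> 0)) ?mean_cst// ?sqrtr0; first exact: cvg_cst.
  by move=> x; rewrite subrr expr0n.
have c3 := ip_cvg ba (fun=> bone) bTg bone a1 z1.
have ip1 f : ip f (fun=> 1) = Ex f by apply: eq_mean => x; rewrite mulr1.
have : ip (T u g) (T u g) - ip (T u g) (fun=> 1) ^+ 2 <= C * - ip (T u g) (T u (L g)).
  have c13 : ip (a n) (a n) - ip (a n) (fun=> 1) ^+ 2 @[n --> \oo] -->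
      ip (T u g) (T u g) - ip (T u g) (fun=> 1) ^+ 2.
    apply: cvgB => //; rewrite expr2; under eq_fun do rewrite expr2.
    exact: cvgM.
  have c24 : C * - ip (a n) (L (a n)) @[n --> \oo] --> C * - ip (T u g) (T u (L g)).
    by apply: cvgM; [exact: cvg_cst|exact: cvgN].
  apply: (ler_cvg_to c13 c24); apply: nearW => n.
  by rewrite ip1 ipE; exact: hC.
by rewrite ip1 mean_kernel_op//; exact: bdd_local.
Qed.

End Semigroup.

(** * Symmetry of the semigroup and concavity of the mean square displacement *)

Section SemigroupDecay.
Variables (R : realType) (p : R) (pi : probability config R).
Variable Q : R -> R.-pker config ~> config.
Hypothesis p01 : 0 < p < 1.
Hypothesis hpi : product_bernoulli p pi.
Hypothesis htr : transition_function Q.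
Hypothesis hinv : forall (t : R) B, 0 <= t -> measurable B ->
  (pi B = \int[pi]_x Q t x B)%E.
Hypothesis hgen : forall g h : config -> R,
  semigroup_generator Q pi g h <-> east_generator p pi g h.

Local Notation Ex := (mean pi).
Local Notation ip := (ip pi).
Local Notation nrm := (nrm pi).
Local Notation T t := (kernel_op (Q t)).
Local Notation L := (east_pregenerator p).
Implicit Types (f g h : config -> R) (s t u r e a b C eps th : R).

Let pi1 : pi setT = 1%E. Proof. exact: probability_setT. Qed.


Let bT u f : local_fun f -> bdd (T u f).
Proof. by move=> lf; exact/bdd_kernel_op/bdd_local. Qed.

Let lL f : local_fun f -> local_fun (L f).
Proof. exact: local_pregen. Qed.

Let bTe u d f : local_fun f -> bdd (T u (gen_err p Q d f)).
Proof. by move=> lf; exact/bdd_kernel_op/bdd_gen_err. Qed.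

(** The first-order terms cancel by [gen_sym]; only the two errors of the difference quotients
    remain. *)
Lemma ip_orbit_step u r d e g h : local_fun g -> local_fun h ->
  0 <= u -> 0 <= r -> 0 < d ->
  nrm (gen_err p Q d g) <= e -> nrm (gen_err p Q d h) <= e ->
  `|ip (T (u + d) g) (T r h) - ip (T u g) (T (r + d) h)| <= d * (e * (nrm g + nrm h)).
Proof.
move=> lg lh u0 r0 d0 eg eh.
rewrite (orbit_step p htr lg u0 d0) (orbit_step p htr lh r0 d0).
have bg := bT u lg; have bh := bT r lh; have bLg := bT u (lL lg); have bLh := bT r (lL lh).
have beg := bTe u d lg; have beh := bTe r d lh.
rewrite ipDl//; last by apply/bddZ/bddD.
rewrite ipZl//; last exact: bddD.
rewrite ipDl// ipDr//; last by apply/bddZ/bddD.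
rewrite ipZr//; last exact: bddD.
rewrite ipDr//.
rewrite (gen_sym p01 hpi htr hinv hgen lg lh u0 r0).
set A := ip (T u g) (T r h); set B := ip (T u g) (T r (L h)).
set X := ip _ (T r h); set Y := ip (T u g) (T r (gen_err p Q d h)).
have -> : A + d * (B + X) - (A + d * (B + Y)) = d * (X - Y) by ring.
rewrite normrM gtr0_norm// ler_pM2l// (le_trans (ler_normB _ _))//.
rewrite mulrDr addrC lerD//.
  rewrite (le_trans (ip_CS _ _ _))// mulrC ler_pM ?nrm_ge0//.
    by rewrite (le_trans _ eh)//; apply: (nrm_kernel_op hinv) => //; exact: bdd_gen_err.
  by apply: (nrm_kernel_op hinv) => //; exact: bdd_local.
rewrite (le_trans (ip_CS _ _ _))// ler_pM ?nrm_ge0//.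
  by rewrite (le_trans _ eg)//; apply: (nrm_kernel_op hinv) => //; exact: bdd_gen_err.
by apply: (nrm_kernel_op hinv) => //; exact: bdd_local.
Qed.

Lemma fine_step g h e s : local_fun g -> local_fun h -> 0 < e -> 0 < s ->
  exists2 N : nat, (0 < N)%N & nrm (gen_err p Q (s / N%:R) g) <= e /\
     nrm (gen_err p Q (s / N%:R) h) <= e.
Proof.
move=> lg lh e0 s0.
have [d1 d10 h1] := gen_err_small hgen lg e0.
have [d2 d20 h2] := gen_err_small hgen lh e0.
pose d := Num.min d1 d2.
have d0 : 0 < d by rewrite lt_min d10.
pose N := (Num.truncn (s / d)).+1.
have N0 : (0 : R) < N%:R by rewrite ltr0n.
have sN : s / N%:R < d.
  rewrite ltr_pdivrMr// mulrC -ltr_pdivrMr//.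
  by have /andP[] := truncn_itv (divr_ge0 (ltW s0) (ltW d0)).
have sN0 : 0 < s / N%:R by rewrite divr_gt0.
exists N => //; split; apply: ltW; [apply: h1|apply: h2]; rewrite sN0 (lt_le_trans sN)//.
  by rewrite /d ge_min lexx.
by rewrite /d ge_min lexx orbT.
Qed.

(* Symmetry of the semigroup, from that of the generator: moving a small amount
   of time from one factor to the other changes the inner product only by o(d). *)
Lemma ip_orbit s t g h : local_fun g -> local_fun h -> 0 <= s -> 0 <= t ->
  ip (T s g) (T t h) = ip g (T (s + t) h).
Proof.
move=> lg lh; rewrite le_eqVlt => /orP[/eqP <-|s0] t0.
  by rewrite add0r (kernel_op0 htr)//; exact: bdd_local.
apply/eqP; rewrite -subr_eq0 -normr_le0; apply/ler_addgt0Pr => eps eps0; rewrite add0r.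
pose c := s * (nrm g + nrm h) + 1.
have c0 : 0 < c by rewrite ltr_wpDl// mulr_ge0 ?addr_ge0 ?nrm_ge0// ltW.
pose e := eps / c.
have e0 : 0 < e by rewrite divr_gt0.
have [N N0 [eg eh]] := fine_step lg lh e0 s0.
set d := s / N%:R in eg eh.
have NR : (0 : R) < N%:R by rewrite ltr0n.
have d0 : 0 < d by rewrite divr_gt0.
have sE : s = N%:R * d by rewrite /d mulrC divfK// gt_eqF.
have main k : (k <= N)%N ->
    `|ip (T (k%:R * d) g) (T (t + (N - k)%:R * d) h) - ip g (T (s + t) h)| <=
    k%:R * (d * (e * (nrm g + nrm h))).
  elim: k => [|k IH] kN.
    rewrite !mul0r subn0 -sE (kernel_op0 htr)//; last exact: bdd_local.
    by rewrite (addrC t) subrr normr0.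
  have k1 : k.+1%:R * d = k%:R * d + d by rewrite -natr1 mulrDl mul1r.
  have k2 : t + (N - k)%:R * d = t + (N - k.+1)%:R * d + d.
    by rewrite -(subnSK kN) -natr1 mulrDl mul1r addrA.
  have := IH (ltnW kN); rewrite k2 => IHk.
  rewrite k1 -[k.+1%:R]natr1 [X in _ <= X]mulrDl mul1r.
  have st := @ip_orbit_step (k%:R * d) (t + (N - k.+1)%:R * d) d e g h lg lh
    (mulr_ge0 (ler0n _ _) (ltW d0)) (addr_ge0 t0 (mulr_ge0 (ler0n _ _) (ltW d0))) d0 eg eh.
  rewrite [leRHS]addrC; apply: (le_trans _ (lerD st IHk)).
  apply: (le_trans _ (ler_normD _ _)).
  by rewrite addrA subrK.
have := main N (leqnn N); rewrite subnn mul0r addr0 -sE => /le_trans; apply.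
rewrite mulrA -sE mulrCA /e mulrAC ler_pdivrMr// ler_pM2l//.
by rewrite /c lerDl.
Qed.

Section Decay.
Variable g : config -> R.
Hypothesis lg : local_fun g.

(** Half the mean square displacement of [g] along the stationary process ([incr_local]). *)
Definition psi t := ip g g - ip g (T t g).

Lemma psi0 : psi 0 = 0.
Proof. by rewrite /psi (kernel_op0 htr) ?subrr//; exact: bdd_local. Qed.

Lemma psi_split s t : 0 <= s -> 0 <= t -> psi (s + t) = ip g g - ip (T s g) (T t g).
Proof. by move=> s0 t0; rewrite /psi ip_orbit. Qed.

(** By symmetry [psi u] is [ip g g] minus the squared norm of [T (u / 2) g], which a contraction
    semigroup decreases. *)
Lemma psi_mono s t : 0 <= s -> s <= t -> psi s <= psi t.
Proof.
move=> s0 st; have t0 : 0 <= t by exact: le_trans st.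
have half u : 0 <= u -> psi u = ip g g - nrm (T (u / 2) g) ^+ 2.
  move=> u0; have u2 : 0 <= u / 2 by rewrite divr_ge0.
  by rewrite {1}(splitr u) psi_split// nrm2.
rewrite (half _ s0) (half _ t0); apply: lerB; first exact: lexx.
apply: lerXn2r; rewrite ?nnegrE; [exact: nrm_ge0|exact: nrm_ge0|].
have -> : t / 2 = (t - s) / 2 + s / 2 by lra.
have ts : 0 <= (t - s) / 2 by rewrite divr_ge0// subr_ge0.
rewrite (kernel_op_add htr)//; [|by rewrite divr_ge0|exact: bdd_local].
by apply: (nrm_kernel_op hinv) => //; exact: bT.
Qed.

(** Midpoint concavity is the nonnegativity of the squared norm of [T a g - T b g]. *)
Lemma psi_concave a b : 0 <= a -> 0 <= b -> psi (a + a) + psi (b + b) <= 2 * psi (a + b).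
Proof.
move=> a0 b0; rewrite (psi_split a0 a0) (psi_split b0 b0) (psi_split a0 b0).
have ba := bT a lg; have bb := bT b lg.
have := ip_ge0 pi (fun x => T a g x - T b g x).
rewrite (ipBl pi ba bb (bddB ba bb)) (ipBr pi ba bb ba) (ipBr pi ba bb bb).
rewrite (ipC pi (T b g) (T a g)).
move: (ip g g) (ip (T a g) (T a g)) (ip (T b g) (T b g)) (ip (T a g) (T b g)).
by move=> w x y z; lra.
Qed.

(** The next increment of a concave sequence is at most the mean of the earlier ones. *)
Lemma concave_seq (w : nat -> R) : w 0%N = 0 ->
  (forall k, w k + w k.+2 <= 2 * w k.+1) ->
  forall k, k%:R * (w k.+1 - w k) <= w k.
Proof.
move=> w0 wc; elim=> [|k IH]; first by rewrite w0 !mul0r.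
rewrite -natr1 !mulrDl !mul1r.
have c := wc k; have k0 : (0 : R) <= k%:R by rewrite ler0n.
have : k%:R * (w k.+2 - w k.+1) <= k%:R * (w k.+1 - w k) by rewrite ler_wpM2l//; lra.
by lra.
Qed.

Lemma psi_lattice_concave (h : R) : 0 <= h ->
  forall j, psi (j%:R * h) + psi (j.+2%:R * h) <= 2 * psi (j.+1%:R * h).
Proof.
move=> h0 j.
have j0 : 0 <= j%:R * h / 2 by rewrite divr_ge0// mulr_ge0.
have -> : j%:R * h = j%:R * h / 2 + j%:R * h / 2 by lra.
have -> : j.+2%:R * h = (j%:R * h / 2 + h) + (j%:R * h / 2 + h).
  by rewrite -addn2 natrD; lra.
have -> : j.+1%:R * h = j%:R * h / 2 + (j%:R * h / 2 + h) by rewrite -natr1; lra.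
by apply: psi_concave => //; rewrite addr_ge0.
Qed.

Lemma psi_lattice (h : R) k : 0 <= h ->
   k%:R * (psi (k.+1%:R * h) - psi (k%:R * h)) <= psi (k%:R * h).
Proof.
move=> h0; apply: (@concave_seq (fun k => psi (k%:R * h))).
  by rewrite mul0r psi0.
exact: psi_lattice_concave.
Qed.

Lemma psi_ge0 t : 0 <= t -> 0 <= psi t.
Proof. by move=> t0; rewrite -psi0 psi_mono. Qed.

Lemma concave_seq_ratio (w : nat -> R) N k : w 0%N = 0 ->
  (forall k, w k + w k.+2 <= 2 * w k.+1) -> (N.+1 <= k)%N ->
  N.+1%:R * w k <= k%:R * w N.+1.
Proof.
move=> w0 wc /subnK <-; elim: (k - N.+1)%N => [|m IH]; first by rewrite add0n.
set K := (m + N.+1)%N in IH *; rewrite addSn -/K.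
have := concave_seq w0 wc K; rewrite mulrBr lerBlDr => h.
have K0 : (0 : R) < K%:R by rewrite ltr0n /K addnS.
have n0 : (0 : R) <= N.+1%:R by rewrite ler0n.
rewrite -(ler_pM2l K0) mulrCA; apply: (le_trans (ler_wpM2l n0 h)).
have -> : N.+1%:R * (w K + K%:R * w K) = (1 + K%:R) * (N.+1%:R * w K) by ring.
have -> : K%:R * (K.+1%:R * w N.+1) = (1 + K%:R) * (K%:R * w N.+1).
  by rewrite -natr1; ring.
by rewrite ler_pM2l// addr_gt0.
Qed.

(** Concavity is used on lattices only: by monotonicity of [psi], [t] is rounded up to a lattice
    through [s], so fine that rounding costs at most [eps]. *)
Lemma psi_ratio s t : 0 < s -> s <= t -> psi t <= t / s * psi s.
Proof.
move=> s0 st; have t0 : 0 < t by exact: lt_le_trans st.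
apply/ler_addgt0Pr => eps eps0.
have c0 : 0 < psi s / eps + 1 by rewrite ltr_wpDl// divr_ge0 ?psi_ge0// ltW.
pose N := Num.truncn (psi s / eps).
have /andP[_ N1] := truncn_itv (divr_ge0 (psi_ge0 (ltW s0)) (ltW eps0)).
have NR : (0 : R) < N.+1%:R by rewrite ltr0n.
pose h := s / N.+1%:R; have h0 : 0 < h by rewrite divr_gt0.
have sE : N.+1%:R * h = s by rewrite /h mulrC divfK// gt_eqF.
have /andP[k1 k2] := truncn_itv (divr_ge0 (ltW t0) (ltW h0)).
set k := Num.truncn (t / h) in k1 k2.
have tk : psi t <= psi (k.+1%:R * h).
  by apply: psi_mono; rewrite ?ltW// -ltr_pdivrMr.
apply: (le_trans tk).
have Nk : (N.+1 <= k.+1)%N.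
  rewrite -ltnS -(ltr_nat R); apply: le_lt_trans (_ : t / h < _); last first.
    by apply: lt_trans k2 _; rewrite ltr_nat.
  by rewrite ler_pdivlMr// sE.
have := @concave_seq_ratio (fun k => psi (k%:R * h)) N k.+1.
rewrite mul0r psi0 sE => /(_ erefl (psi_lattice_concave (ltW h0)) Nk).
rewrite -ler_pdivlMl// => /le_trans; apply.
have kt : k.+1%:R <= t / h + 1 by rewrite -natr1 lerD2r.
have := ler_wpM2r (psi_ge0 (ltW s0)) kt.
rewrite -(ler_pM2l (_ : 0 < N.+1%:R^-1)) ?invr_gt0// => /le_trans; apply.
have -> : N.+1%:R^-1 * ((t / h + 1) * psi s) = t / s * psi s + psi s / N.+1%:R.
  by rewrite /h; field; rewrite gt_eqF ?gt_eqF.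
rewrite lerD2l ler_pdivrMr// mulrC -ler_pdivrMr//.
exact: ltW.
Qed.

Lemma psi_gap C t : 0 < C -> 0 < t ->
  (forall f, local_fun f -> Ex (fun y => f y ^+ 2) - Ex f ^+ 2 <=
      C * - Ex (fun y => f y * L f y)) ->
  t * (ip g g - Ex g ^+ 2) <= (C + t) * psi t.
Proof.
move=> C0 t0 hC.
have t2 : 0 <= t / 2 by rewrite divr_ge0// ltW.
(* [D] is the slope of [psi] at [t], so [t * D <= psi t] by concavity. The Poincare inequality at
   [T (t / 2) g] bounds the variance of [g] minus [psi t] by [C * D]; it remains to eliminate
   [D]. *)
pose D := - ip (T (t / 2) g) (T (t / 2) (L g)).
suff tD : t * D <= psi t.
  have := poincare_orbit htr hinv hgen (ltW C0) lg t2 hC; rewrite -/D.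
  have -> : ip (T (t / 2) g) (T (t / 2) g) = ip g g - psi t.
    by rewrite [in psi t](splitr t) psi_split//; ring.
  move=> h; have : t * (ip g g - psi t - Ex g ^+ 2) <= t * (C * D) by rewrite ler_pM2l.
  have : C * (t * D) <= C * psi t by rewrite ler_pM2l.
  by rewrite !mulrBr mulrDl; lra.
apply/ler_addgt0Pr => eps eps0.
pose c := t * nrm g + 1.
have c0 : 0 < c by rewrite ltr_wpDl// mulr_ge0 ?nrm_ge0// ltW.
pose e := eps / c.
have e0 : 0 < e by rewrite divr_gt0.
have [N N0 [eg _]] := fine_step lg lg e0 t0.
set d := t / N%:R in eg.
have NR : (0 : R) < N%:R by rewrite ltr0n.
have d0 : 0 < d by rewrite divr_gt0.
have tE : N%:R * d = t by rewrite /d mulrC divfK// gt_eqF.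
(* The increment of [psi] over [[t, t + d]] is at most [psi t / N], and it equals [d * D] up to the
   error of the difference quotient. *)
have := psi_lattice N (ltW d0).
rewrite -natr1 mulrDl mul1r tE.
have -> : psi (t + d) = psi t - d * (ip (T (t / 2) g) (T (t / 2) (L g)) +
    ip (T (t / 2) g) (T (t / 2) (gen_err p Q d g))).
  have -> : t + d = t / 2 + (t / 2 + d) by lra.
  rewrite psi_split//; last by rewrite addr_ge0// ltW.
  rewrite (orbit_step p htr lg t2 d0).
  have b1 := bT (t / 2) lg; have b2 := bT (t / 2) (lL lg); have b3 := bTe (t / 2) d lg.
  rewrite [in psi t](splitr t) psi_split//.
  have -> : (fun x => T (t / 2) g x + d * (T (t / 2) (L g) x + T (t / 2) (gen_err p Q d g) x)) =
    (fun x => T (t / 2) g x - (- d) * (T (t / 2) (L g) x - (-1) * T (t / 2) (gen_err p Q d g) x)).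
    by apply/funext => x; ring.
  have b4 : bdd (fun x => T (t / 2) (L g) x - (-1) * T (t / 2) (gen_err p Q d g) x).
    by apply: bddB => //; exact: bddZ.
  rewrite (ipBr pi b1 (bddZ _ b4) b1) (ipZr pi _ b4 b1).
  rewrite (ipBr pi b2 (bddZ _ b3) b1) (ipZr pi _ b3 b1).
  move: (ip g g) (ip (T (t / 2) g) (T (t / 2) g)) (ip (T (t / 2) g) (T (t / 2) (L g))).
  by move: (ip _ _) => w x y z; ring.
have := ip_CS pi (bT (t / 2) lg) (bTe (t / 2) d lg).
rewrite -[ip _ (T _ (L g))]opprK -/D; set z := ip _ _ => zle.
rewrite (_ : N%:R * _ = t * (D - z)); last by rewrite -tE; ring.
move=> h.
have : `|z| <= nrm g * e.
  apply: le_trans zle _; rewrite ler_pM ?nrm_ge0//.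
    by apply: (nrm_kernel_op hinv) => //; exact: bdd_local.
  by rewrite (le_trans _ eg)//; apply: (nrm_kernel_op hinv) => //; exact: bdd_gen_err.
move=> ze.
have tz : t * z <= t * (nrm g * e).
  by rewrite ler_pM2l// (le_trans (ler_norm _)).
have : t * (nrm g * e) <= eps.
  by rewrite /e !mulrA ler_pdivrMr// [leLHS]mulrC ler_pM2l// /c lerDl.
by move: h; rewrite mulrBr; lra.
Qed.

End Decay.
End SemigroupDecay.

(** * Density of local functions *)

Section Density.
Variables (R : realType) (pi : probability config R).
Implicit Types f g : config -> R.
Local Notation Ex := (mean pi).

Let pi1 : pi setT = 1%E. Proof. exact: probability_setT. Qed.

Lemma local_fun2 (op : R -> R -> R) f g : local_fun f -> local_fun g ->
  local_fun (fun x => op (f x) (g x)).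
Proof.
move=> [s fs] [t gt]; exists (s ++ t) => x y xy; congr (op _ _).
  by apply: fs => i iS; apply: xy; rewrite mem_cat iS.
by apply: gt => i it; apply: xy; rewrite mem_cat it orbT.
Qed.

Lemma local_fun1 (op : R -> R) f : local_fun f -> local_fun (fun x => op (f x)).
Proof. by move=> [s fs]; exists s => x y xy; rewrite (fs x y xy). Qed.

Lemma bdd_norm f : bdd f -> bdd (fun x => `|f x|).
Proof.
move=> [mf [M fM]]; split; first exact: measurableT_comp.
by exists M => x; rewrite normr_id.
Qed.

(** Approximation in L1 suits the monotone class argument; clipping then upgrades it to L2. *)
Definition approximable g := bdd g /\
  forall eps, 0 < eps -> exists2 f, local_fun f & Ex (fun x => `|g x - f x|) <= eps.

Lemma approximable_local f : local_fun f -> approximable f.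
Proof.
move=> lf; split; first exact: bdd_local.
move=> eps e0; exists f => //; rewrite (@eq_mean _ _ _ _ _ (fun=> 0)) ?mean_cst ?ltW//.
by move=> x; rewrite subrr normr0.
Qed.

Lemma approximable_trans g : bdd g ->
  (forall eps, 0 < eps -> exists2 h, approximable h & Ex (fun x => `|g x - h x|) <= eps) ->
  approximable g.
Proof.
move=> bg gh; split => // eps e0; have e2 : 0 < eps / 2 by rewrite divr_gt0.
have [h [bh ah] hg] := gh _ e2; have [f lf fh] := ah _ e2; exists f => //.
have bf := bdd_local lf.
apply: (@le_trans _ _ (Ex (fun x => `|g x - h x| + `|h x - f x|))); last first.
  rewrite meanD//; [by rewrite [leRHS]splitr lerD|exact/bdd_norm/bddB|exact/bdd_norm/bddB].
apply: ler_mean => //; [exact/bdd_norm/bddB| |].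
  by apply: bddD; exact/bdd_norm/bddB.
by move=> x; rewrite (le_trans _ (ler_normD _ _))// addrA subrK.
Qed.

Lemma approximableB g h : approximable g -> approximable h ->
  approximable (fun x => g x - h x).
Proof.
move=> [bg ag] [bh ah]; split; first exact: bddB.
move=> eps e0; have e2 : 0 < eps / 2 by rewrite divr_gt0.
have [f lf fg] := ag _ e2; have [k lk kh] := ah _ e2.
have bf := bdd_local lf; have bk := bdd_local lk.
exists (fun x => f x - k x); first exact: (local_fun2 (fun a b => a - b)).
apply: (@le_trans _ _ (Ex (fun x => `|g x - f x| + `|h x - k x|))); last first.
  rewrite meanD//; [by rewrite [leRHS]splitr lerD|exact/bdd_norm/bddB|exact/bdd_norm/bddB].
apply: ler_mean => //; [by apply: bdd_norm; apply: bddB; exact: bddB| |].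
  by apply: bddD; exact/bdd_norm/bddB.
move=> x; rewrite (le_trans _ (ler_normB _ _))// le_eqVlt; apply/orP; left.
by apply/eqP; congr (`|_|); ring.
Qed.

Lemma approximableZ a g : approximable g -> approximable (fun x => a * g x).
Proof.
move=> [bg ag]; split; first exact: bddZ.
move=> eps e0; have c0 : 0 < eps / (`|a| + 1) by rewrite divr_gt0// ltr_wpDl.
have [f lf fg] := ag _ c0; have bf := bdd_local lf.
exists (fun x => a * f x); first exact: (local_fun1 (fun b => a * b)).
rewrite (@eq_mean _ _ _ _ _ (fun x => `|a| * `|g x - f x|)); last first.
  by move=> x; rewrite -normrM mulrBr.
rewrite meanZ//; last exact/bdd_norm/bddB.
apply: (@le_trans _ _ ((`|a| + 1) * Ex (fun x => `|g x - f x|))).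
  by rewrite ler_wpM2r ?lerDl// mean_ge0.
by rewrite -ler_pdivlMl ?ltr_wpDl// mulrC.
Qed.

Lemma approximableD g h : approximable g -> approximable h ->
  approximable (fun x => g x + h x).
Proof.
move=> ag ah; have -> : (fun x => g x + h x) = (fun x => g x - (-1) * h x).
  by apply/funext => x; ring.
by apply: approximableB => //; exact: approximableZ.
Qed.

Lemma bdd_indic (A : set config) : measurable A -> bdd (\1_A : config -> R).
Proof.
move=> mA; split; first exact: measurable_indic.
by exists 1 => x; rewrite indicE; case: (x \in A); rewrite ?normr1 ?normr0.
Qed.

Lemma mean_indic (A : set config) : measurable A -> Ex (\1_A) = fine (pi A).
Proof. by move=> mA; rewrite /mean /Rintegral integral_indic// setIT. Qed.

(** Dynkin's argument: measurable sets with local indicator form a generating pi-system, and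
    approximability survives proper differences and increasing unions. *)
Lemma approximable_indic (A : set config) : measurable A -> approximable (\1_A).
Proof.
move=> mA.
pose G := [set B : set config | measurable B /\ local_fun (\1_B : config -> R)].
pose H := [set B : set config | measurable B /\ approximable (\1_B)].
have GI : setI_closed G.
  move=> B C [mB lB] [mC lC]; split; first exact: measurableI.
  by rewrite indicI; exact: (local_fun2 (fun a b => a * b)).
have GH : G `<=` H by move=> B [mB lB]; split => //; exact: approximable_local.
have lH : lambda_system setT H.
  split => //.
  - split; first exact: measurableT.
    by rewrite indicT; apply: approximable_local; exists [::].
  - move=> B C CB [mB aB] [mC aC]; split; first exact: measurableD.
    have -> : \1_(B `\` C) = (fun x => \1_B x - \1_C x : R).
      apply/funext => x; rewrite !indicE in_setD; case: (boolP (x \in C)) => xC.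
        by rewrite /= andbF (mem_set (CB _ (set_mem xC))) subrr.
      by rewrite andbT subr0.
    exact: approximableB.
  - move=> F ndF HF; have mF n : measurable (F n) by exact: (HF n).1.
    have mU : measurable (\bigcup_n F n) by exact: bigcupT_measurable.
    split => //; apply: approximable_trans; first exact: bdd_indic.
    move=> eps e0.
    have : (fine (pi (F n)))%:E @[n --> \oo] --> (fine (pi (\bigcup_n F n)))%:E.
      rewrite fineK ?fin_num_measure//.
      have -> : (fun n => (fine (pi (F n)))%:E) = pi \o F.
        by apply/funext => n; rewrite fineK// fin_num_measure.
      exact: nondecreasing_cvg_mu.
    move=> /fine_cvg /cvgrPdist_le /(_ _ e0) [n _ hn].
    exists (\1_(F n)); first exact: (HF n).2.
    have sub : F n `<=` \bigcup_n F n by move=> x Fx; exists n.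
    rewrite (@eq_mean _ _ _ _ _ (fun x => \1_(\bigcup_n F n) x - \1_(F n) x)); last first.
      move=> x; rewrite ger0_norm// !indicE subr_ge0.
      case: (boolP (x \in F n)) => [xF|_]; last by rewrite ler0n.
      by rewrite (mem_set (sub _ (set_mem xF))).
    rewrite meanB//; [|exact: bdd_indic|exact: bdd_indic].
    rewrite !mean_indic//; apply: le_trans (hn n (leqnn n)).
    exact: ler_norm.
suff : H A by case.
apply: (lambda_system_subset GI lH GH) => //.
apply: smallest_sub mA; first exact: smallest_sigma_algebra.
move=> _ [i [b ->]]; apply: sub_sigma_algebra; split; first exact: measurable_coord.
exists [:: i] => x y xy; have xyi := xy i (mem_head _ _).
by rewrite !indicE; congr (nat_of_bool _)%:R; apply/idP/idP; rewrite !inE /= xyi.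
Qed.

Import HBSimple.

Lemma approximable_sfun (g : {sfun config >-> R}) : approximable g.
Proof.
have main (s : seq R) : approximable (fun x => \sum_(y <- s) y * \1_(g @^-1` [set y]) x).
  elim: s => [|y s IH].
    by apply: approximable_local; exists [::] => x y _; rewrite !big_nil.
  have -> : (fun x => \sum_(z <- y :: s) z * \1_(g @^-1` [set z]) x) =
     (fun x => y * \1_(g @^-1` [set y]) x + \sum_(z <- s) z * \1_(g @^-1` [set z]) x).
    by apply/funext => x; rewrite big_cons.
  by apply: approximableD => //; apply: approximableZ; exact: approximable_indic.
have -> : (g : config -> R) =
    (fun x => \sum_(y <- finmap.enum_fset (fset_set (range g))) y * \1_(g @^-1` [set y]) x).
  by apply/funext => x; rewrite [LHS]fimfunE fsbig_finite.
exact: main.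
Qed.

Lemma approximable_bdd g : bdd g -> approximable g.
Proof.
move=> bg; apply: approximable_trans => // eps e0.
have pioo : (pi setT < +oo)%E by rewrite pi1 ltry.
have [h [_ _ hg]] := approximation_sfun_integrable measurableT (bdd_integrable pioo bg).
have bh n : bdd (h n) by exact: (approximable_sfun (h n)).1.
have E : (fun n => \int[pi]_z `|(EFin \o g) z - (h n z)%:E|)%E =
    (fun n => (Ex (fun z => `|g z - h n z|))%:E).
  apply/funext => n; rewrite mean_EFin//; exact/bdd_norm/bddB.
move: hg; rewrite E => /fine_cvg /cvgr0Pnorm_le /(_ _ e0) [n _ hn].
exists (h n); first exact: approximable_sfun.
exact: le_trans (ler_norm _) (hn n (leqnn n)).
Qed.

Definition clip (M a : R) := Num.max (- M) (Num.min M a).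

Lemma clip_le M a : 0 <= M -> `|clip M a| <= M.
Proof.
move=> M0; rewrite ler_norml /clip le_max lexx ge_max ge_min lexx andbT /=.
by rewrite (le_trans _ M0)// oppr_le0.
Qed.

Lemma clip_id M a : `|a| <= M -> clip M a = a.
Proof. by rewrite ler_norml /clip => /andP[Ma aM]; rewrite (min_idPr aM) (max_idPr Ma). Qed.

Lemma clip_lip M a b : 0 <= M -> `|clip M a - clip M b| <= `|a - b|.
Proof.
move=> M0; rewrite /clip.
have MM : Num.max (- M) M = M by apply/max_idPr; lra.
have n1 := ler_norm (a - b); have := ler_norm (b - a); rewrite distrC => n2.
have n0 := normr_ge0 (a - b).
by case: (leP M a) => h1; case: (leP M b) => h2; rewrite ?MM;
  (try case: (leP (- M) a) => h3); (try case: (leP (- M) b) => h4);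
  rewrite ler_norml; apply/andP; split; lra.
Qed.

Lemma clip_abs M a : 0 <= M -> `|clip M a| <= `|a|.
Proof.
move=> M0; have := clip_lip a 0 M0; rewrite subr0 (clip_id (a := 0)) ?normr0//.
by rewrite subr0.
Qed.

(** Clipping at a bound [M] of [g] fixes [g] and is 1-Lipschitz, so the L1 error does not grow, and
    the squared error is at most 2 M times the absolute one. *)
Lemma local_dense_bdd g eps : bdd g -> 0 < eps ->
  exists2 f, local_fun f & Ex (fun x => (g x - f x) ^+ 2) <= eps.
Proof.
move=> bg e0; have [mg [M0 gM0]] := bg.
pose M := `|M0| + 1.
have M_gt0 : 0 < M by rewrite /M ltr_wpDl.
have gM x : `|g x| <= M.
  by rewrite (le_trans (gM0 x))// (le_trans (ler_norm _))// lerDl.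
have c0 : 0 < eps / (2 * M) by rewrite divr_gt0// mulr_gt0.
have [_ /(_ _ c0)[f lf fg]] := approximable_bdd bg.
have bf := bdd_local lf.
exists (fun x => clip M (f x)); first exact: (local_fun1 (clip M)).
have bcf : bdd (fun x => clip M (f x)) by apply: bdd_local; exact: (local_fun1 (clip M)).
apply: (@le_trans _ _ (Ex (fun x => 2 * M * `|g x - f x|))); last first.
  rewrite (meanZ pi1 _ (bdd_norm (bddB bg bf))).
  by rewrite -ler_pdivlMl ?mulr_gt0// mulrC.
apply: ler_mean; [exact: pi1|exact/bddX/bddB|exact/bddZ/bdd_norm/bddB|] => x.
rewrite -real_normK ?num_real// expr2; apply: ler_pM => //.
  rewrite (le_trans (ler_normB _ _))// mulr_natl mulr2n lerD//.
  by apply: clip_le; exact: ltW.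
by rewrite -{1}(clip_id (gM x)); apply: clip_lip; exact: ltW.
Qed.

Lemma local_dense g eps : measurable_fun setT g ->
  (\int[pi]_x (g x ^+ 2)%:E < +oo)%E -> 0 < eps ->
  exists2 f, local_fun f & (\int[pi]_x ((g x - f x) ^+ 2)%:E <= eps%:E)%E.
Proof.
move=> mg g2 e0.
have mg2 : measurable_fun setT (fun x => (g x ^+ 2)%:E).
  by apply/measurable_EFinP; exact: measurable_funX.
have ig2 : pi.-integrable setT (fun x => (g x ^+ 2)%:E).
  apply/integrableP; split => //.
  by under eq_integral do rewrite gee0_abs ?lee_fin ?sqr_ge0//.
have mclip n : measurable_fun setT (fun x => clip n%:R (g x)).
  by apply: measurable_maxr => //; apply: measurable_minr.
pose D n x := ((g x - clip n%:R (g x)) ^+ 2)%:E.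
have mD n : measurable_fun setT (D n).
  by apply/measurable_EFinP; apply: measurable_funX; exact: measurable_funB.
have D0 x : D ^~ x @ \oo --> 0%E.
  apply: cvg_near_cst; exists (Num.truncn `|g x|).+1 => // n /= nx; rewrite /D.
  rewrite clip_id ?subrr ?expr0n//.
  have /andP[_ /ltW h] := truncn_itv (normr_ge0 (g x)).
  by apply: (le_trans h); rewrite ler_nat.
have Dle n x : (`|D n x| <= (4 * g x ^+ 2)%:E)%E.
  rewrite /D gee0_abs ?lee_fin ?sqr_ge0//.
  have -> : 4 * g x ^+ 2 = (2 * `|g x|) ^+ 2.
    by rewrite exprMn real_normK ?num_real//; ring.
  rewrite -real_normK ?num_real// ler_pXn2r ?nnegrE ?mulr_ge0//.
  rewrite (le_trans (ler_normB _ _))// mulr_natl mulr2n lerD2l.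
  by apply: clip_abs; rewrite ler0n.
have i4 : pi.-integrable setT (fun x => (4 * g x ^+ 2)%:E).
  have -> : (fun x => (4 * g x ^+ 2)%:E) = (fun x => 4%:E * (g x ^+ 2)%:E)%E.
    by apply/funext => x; rewrite EFinM.
  exact: integrableZl.
have [_ _ /=] := @dominated_convergence _ _ _ pi setT measurableT D (fun=> 0%E) _
  mD (measurable_cst _) (aeW _ (fun x _ => D0 x)) i4 (aeW _ (fun x n _ => Dle n x)).
rewrite integral0 => cD.
(* Two errors of [eps / 4], each doubled by [ler_sqrD2]. *)
have e4 : 0 < eps / 4 by rewrite divr_gt0.
have [n nE] : exists n, (\int[pi]_x D n x <= (eps / 4)%:E)%E.
  have := cD => /fine_cvgP[[N1 _ h1]] /cvgr0Pnorm_le /(_ _ e4) [N2 _ h2].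
  have hn1 := h1 _ (leq_maxl N1 N2); have hn2 := h2 _ (leq_maxr N1 N2).
  exists (maxn N1 N2); rewrite /= in hn1 hn2.
  by rewrite -(fineK hn1) lee_fin (le_trans (ler_norm _)).
have bclip : bdd (fun x => clip n%:R (g x)).
  by split => //; exists n%:R => x; apply: clip_le; rewrite ler0n.
have [f lf hf] := local_dense_bdd bclip e4; exists f => //.
have bf := bdd_local lf.
have bcf := bddX 2 (bddB bclip bf).
have mcf : measurable_fun setT (fun x => ((clip n%:R (g x) - f x) ^+ 2)%:E).
  by apply/measurable_EFinP; exact: bcf.1.
have mgf : measurable_fun setT (fun x => ((g x - f x) ^+ 2)%:E).
  by apply/measurable_EFinP/measurable_funX/measurable_funB => //; exact: bf.1.
apply: (@le_trans _ _ (\int[pi]_x (2%:E * D n x + 2%:E * ((clip n%:R (g x) - f x) ^+ 2)%:E))%E).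
  apply: ge0_le_integral => //.
  - by move=> x _; rewrite lee_fin sqr_ge0.
  - by apply: emeasurable_funD; apply: measurable_funeM.
  - move=> x _; rewrite -!EFinM -EFinD lee_fin.
    by apply: le_trans (ler_sqrD2 _ _); rewrite addrA subrK.
rewrite ge0_integralD//; first last.
- exact: measurable_funeM.
- by move=> x _; rewrite -EFinM lee_fin mulr_ge0// sqr_ge0.
- exact: measurable_funeM.
- by move=> x _; rewrite -EFinM lee_fin mulr_ge0// sqr_ge0.
rewrite !ge0_integralZl//; first last.
- by move=> x _; rewrite lee_fin sqr_ge0.
- by move=> x _; rewrite lee_fin sqr_ge0.
rewrite -(mean_EFin pi1 bcf).
apply: (@le_trans _ _ (2%:E * (eps / 4)%:E + 2%:E * (eps / 4)%:E)%E).
  by apply: leeD; (apply: lee_wpmul2l; first by rewrite lee_fin); [exact: nE|rewrite lee_fin].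
by rewrite -!EFinM -EFinD lee_fin; lra.
Qed.

End Density.

(** * Relaxation time of the process *)

Section Process.
Variables (R : realType) (d : measure_display) (Omega : measurableType d).
Variables (P : probability Omega R) (p : R) (X : R -> {RV P >-> config}).
Variable Q : R -> R.-pker config ~> config.
Hypothesis p01 : 0 < p < 1.
Local Notation pi := (distribution P (X 0)).
Hypothesis hpi : product_bernoulli p pi.
Hypothesis htr : transition_function Q.
Hypothesis hmk : markov_with Q X.
Hypothesis hst : forall (t : R) B, 0 <= t -> measurable B ->
  distribution P (X t) B = pi B.
Hypothesis hgen : forall g h : config -> R,
  semigroup_generator Q pi g h <-> east_generator p pi g h.

Local Notation L := (east_pregenerator p).
Implicit Types (f g h : config -> R) (t th : R).

Let P1 : P setT = 1%E. Proof. exact: probability_setT. Qed.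
Let pi1 : pi setT = 1%E. Proof. exact: probability_setT. Qed.

Lemma stationary_ge0_integral t (h : config -> \bar R) : 0 <= t ->
  measurable_fun setT h -> (forall x, 0 <= h x)%E ->
  (\int[P]_w h (X t w) = \int[pi]_x h x)%E.
Proof.
move=> t0 mh h0; rewrite -(ge0_integral_distribution (X t))//.
by apply: eq_measure_integral => B mB _; exact: hst.
Qed.

Lemma past0 (C : set config) : measurable C -> past X 0 (X 0 @^-1` C).
Proof. by move=> mC; apply: sub_sigma_algebra; exists 0, C; split => //; rewrite lexx. Qed.

(** The Markov property at time 0 on the sure event, combined with stationarity. *)
Lemma invariant_kernel t B : 0 <= t -> measurable B -> (pi B = \int[pi]_x Q t x B)%E.
Proof.
move=> t0 mB.
have mQ : measurable_fun setT (fun x => Q t x B) by exact: measurable_kernel.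
rewrite -(@stationary_ge0_integral 0)// -(hst t0 mB).
have := hmk (lexx 0) t0 (past0 (measurableT)) mB.
by rewrite preimage_setT setTI add0r.
Qed.

Lemma bdd_comp t f : bdd f -> bdd (fun w => f (X t w)).
Proof.
move=> [mf [M fM]]; split; last by exists M => w.
exact: measurableT_comp.
Qed.

Lemma mean_stationary t f : 0 <= t -> bdd f -> mean P (fun w => f (X t w)) = mean pi f.
Proof.
move=> t0 bf; have [mf [M fM]] := bf.
have f0 x : 0 <= f x + M.
  by have := fM x; rewrite ler_norml => /andP[]; rewrite -subr_ge0 opprK.
have bfM : bdd (fun x => f x + M) by apply: bddD => //; exact: bdd_cst.
suff : mean P (fun w => f (X t w) + M) = mean pi (fun x => f x + M).
  have bX := bdd_comp t bf.
  rewrite !meanD//; [|exact: bdd_cst|exact: bdd_cst].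
  by rewrite !mean_cst// => /addIr.
apply: EFin_inj; rewrite !mean_EFin//; last exact: (bdd_comp t bfM).
rewrite -(stationary_ge0_integral t0)//.
by apply/measurable_EFinP; exact: bfM.1.
Qed.

Lemma local_cyl s e : local_fun (cyl R s e).
Proof.
exists s => x y xy; rewrite /cyl; congr (nat_of_bool _)%:R; apply: eq_in_all => i iS.
by rewrite xy.
Qed.

Lemma mean_joint_cyl t s e s' e' : 0 <= t ->
  mean P (fun w => cyl R s e (X 0 w) * cyl R s' e' (X t w)) =
  ip pi (cyl R s e) (kernel_op (Q t) (cyl R s' e')).
Proof.
move=> t0.
pose C := [set x : config | forall i, i \in s -> x i = e i].
pose B := [set x : config | forall i, i \in s' -> x i = e' i].
have mC : measurable C by exact: measurable_cylset.
have mB : measurable B by exact: measurable_cylset.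
have mF : measurable (X 0 @^-1` C) by rewrite -[_ @^-1` _]setTI; exact: measurable_funP.
have mG : measurable (X t @^-1` B) by rewrite -[_ @^-1` _]setTI; exact: measurable_funP.
have bQ : bdd (kernel_op (Q t) (\1_B)) by apply: bdd_kernel_op; exact: bdd_indic.
rewrite !cylE -/C -/B /ip.
rewrite -(@mean_stationary 0); [|exact: lexx|exact/bddM/bQ/bdd_indic].
have -> : (fun w => \1_C (X 0 w) * \1_B (X t w)) = \1_(X 0 @^-1` C `&` X t @^-1` B) :> (Omega -> R).
  by rewrite indicI; apply/funext => w.
rewrite /mean /Rintegral integral_indic//; last exact: measurableI.
rewrite setIT; congr fine.
have := hmk (lexx 0) t0 (past0 mC) mB; rewrite add0r => hm.
rewrite [LHS]hm.
rewrite [LHS]integral_mkcond; apply: eq_integral => w _.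
rewrite /patch indicE; have -> : (w \in X 0 @^-1` C) = (X 0 w \in C).
  by apply/idP/idP; rewrite !inE.
case: ifP => _; rewrite ?mul0r// mul1r kernel_opE /mean /Rintegral.
rewrite integral_indic// setIT fineK//.
rewrite ge0_fin_numE//; apply: (@le_lt_trans _ _ 1%E); last exact: ltry.
by rewrite -(prob_kernel (s := Q t) (X 0 w)) le_measure// ?inE//; exact: measurableT.
Qed.

(** Both sides are bilinear, so two inductions reduce to cylinders, where this is the Markov
    property at time 0. *)
Lemma mean_joint t f g : 0 <= t -> local_fun f -> local_fun g ->
  mean P (fun w => f (X 0 w) * g (X t w)) = ip pi f (kernel_op (Q t) g).
Proof.
move=> t0.
have bb h h' : local_fun h -> local_fun h' -> bdd (fun w => h (X 0 w) * h' (X t w)).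
  by move=> lh lh'; apply: bddM; apply: bdd_comp; exact: bdd_local.
have bi h h' : local_fun h -> local_fun h' -> bdd (fun x => h x * kernel_op (Q t) h' x).
  by move=> lh lh'; apply: bddM; [|apply: bdd_kernel_op]; exact: bdd_local.
have lZ a h : local_fun h -> local_fun (fun x => a * h x) by exact: local_fun1.
have lD h h' : local_fun h -> local_fun h' -> local_fun (fun x => h x + h' x).
  exact: (local_fun2 +%R).
have base s e : forall g, local_fun g -> local_fun g /\
   mean P (fun w => cyl R s e (X 0 w) * g (X t w)) = ip pi (cyl R s e) (kernel_op (Q t) g).
  have lc := local_cyl s e.
  apply: local_ind => [s' e' _|a h [lh IH]|h h' [lh IH] [lh' IH']].
  - by split; [exact: local_cyl|exact: mean_joint_cyl].
  - split; first exact: lZ.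
    rewrite kernel_opZ; last exact: bdd_local.
    rewrite ipZr; [|exact/bdd_kernel_op/bdd_local|exact: bdd_local].
    by rewrite -IH -meanZ//; [apply: eq_mean => w; ring|exact: bb].
  - split; first exact: lD.
    rewrite kernel_opD; [|exact: bdd_local|exact: bdd_local].
    rewrite /ip (@eq_mean _ _ _ _ (fun x => cyl R s e x * _) (fun x =>
      cyl R s e x * kernel_op (Q t) h x + cyl R s e x * kernel_op (Q t) h' x)); last first.
      by move=> x; rewrite mulrDr.
    rewrite meanD//; [|exact: bi|exact: bi].
    rewrite -[mean pi _]IH -[X in _ = _ + X]IH' -meanD//; [|exact: bb|exact: bb].
    by apply: eq_mean => w; rewrite mulrDr.
suff H : forall f, local_fun f -> local_fun f /\ forall g, local_fun g ->
   mean P (fun w => f (X 0 w) * g (X t w)) = ip pi f (kernel_op (Q t) g).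
  by move=> /H[_ h]; exact: h.
apply: local_ind => [s e _|a h [lh IH]|h h' [lh IH] [lh' IH']].
- by split; [exact: local_cyl|move=> h lh; exact: (base s e h lh).2].
- split; [exact: lZ|move=> k lk].
  rewrite ipZl; [|exact: bdd_local|exact/bdd_kernel_op/bdd_local].
  by rewrite -IH// -meanZ//; [apply: eq_mean => w; ring|exact: bb].
- split; [exact: lD|move=> k lk].
  rewrite /ip (@eq_mean _ _ _ _ (fun x => _ * kernel_op (Q t) k x) (fun x =>
      h x * kernel_op (Q t) k x + h' x * kernel_op (Q t) k x)); last first.
    by move=> x; rewrite mulrDl.
  rewrite meanD//; [|exact: bi|exact: bi].
  rewrite -[mean pi _](IH k lk) -[X in _ = _ + X](IH' k lk) -meanD//; [|exact: bb|exact: bb].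
  by apply: eq_mean => w; rewrite mulrDl.
Qed.

Definition incr g t : \bar R := (\int[P]_w ((g (X t w) - g (X 0 w)) ^+ 2)%:E)%E.

Lemma incr_local g t : 0 <= t -> local_fun g ->
  incr g t = (2 * psi pi Q g t)%:E.
Proof.
move=> t0 lg; have bg := bdd_local lg.
have bt := bdd_comp t bg; have b0 := bdd_comp 0 bg.
rewrite /incr -mean_EFin//; last exact/bddX/bddB.
congr EFin; rewrite (@eq_mean _ _ _ _ _ (fun w =>
   (g (X t w) ^+ 2 - 2 * (g (X 0 w) * g (X t w))) + g (X 0 w) ^+ 2)); last first.
  by move=> w; ring.
have bx := bddM b0 bt.
rewrite meanD//; [|by apply: bddB; [exact: bddX|exact: bddZ]|exact: bddX].
rewrite meanB//; [|exact: bddX|exact: bddZ].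
rewrite meanZ// mean_joint// (mean_stationary t0 (bddX 2 bg)) (mean_stationary (lexx 0) (bddX 2 bg)).
by rewrite /psi ipE; ring.
Qed.

Lemma sqrD_young (th a b : R) : 0 < th ->
  (a + b) ^+ 2 <= (1 + th) * a ^+ 2 + (1 + th^-1) * b ^+ 2.
Proof.
move=> th0; rewrite -subr_ge0.
have -> : (1 + th) * a ^+ 2 + (1 + th^-1) * b ^+ 2 - (a + b) ^+ 2 =
   (th * a - b) ^+ 2 / th by field; rewrite gt_eqF.
by rewrite divr_ge0 ?sqr_ge0// ltW.
Qed.

Lemma integral_sqrD d' (T : measurableType d') (mu : {measure set T -> \bar R})
    (a b : T -> R) th : 0 < th -> measurable_fun setT a -> measurable_fun setT b ->
  (\int[mu]_x ((a x + b x) ^+ 2)%:E <=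
   (1 + th)%:E * \int[mu]_x (a x ^+ 2)%:E + (1 + th^-1)%:E * \int[mu]_x (b x ^+ 2)%:E)%E.
Proof.
move=> th0 ma mb.
have m2 (c : T -> R) : measurable_fun setT c -> measurable_fun setT (fun x => (c x ^+ 2)%:E).
  by move=> mc; apply/measurable_EFinP; exact: measurable_funX.
have c1 : 0 <= 1 + th by rewrite addr_ge0// ltW.
have c2 : 0 <= 1 + th^-1 by rewrite addr_ge0// invr_ge0 ltW.
have s0 (c : T -> R) x : (0 <= (c x ^+ 2)%:E)%E by rewrite lee_fin sqr_ge0.
have sz k (c : T -> R) x : 0 <= k -> (0 <= k%:E * (c x ^+ 2)%:E)%E.
  by move=> k0; rewrite mule_ge0// lee_fin.
rewrite -!ge0_integralZl ?lee_fin//; try exact: m2.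
rewrite -ge0_integralD//; try (by move=> x _; exact: sz); try (by apply: measurable_funeM; exact: m2).
apply: ge0_le_integral => //.
- by move=> x _; exact: (s0 (fun y => a y + b y)).
- by apply: (m2 (fun y => a y + b y)); exact: measurable_funD.
- by apply: emeasurable_funD; apply: measurable_funeM; exact: m2.
- by move=> x _; rewrite -!EFinM -EFinD lee_fin sqrD_young.
Qed.

Definition sqdist g f : \bar R := (\int[pi]_x ((g x - f x) ^+ 2)%:E)%E.

Lemma measurable_coordX g t : measurable_fun setT g -> measurable_fun setT (fun w => g (X t w)).
Proof. by move=> mg; apply: measurableT_comp. Qed.

(** The free weight [th] lets the factor of the main term tend to 1, so that constants survive the
    passage from local to general functions. The 4 comes from two identically distributed terms. *)
Lemma incr_perturb th g f t : 0 < th -> 0 <= t ->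
  measurable_fun setT g -> measurable_fun setT f ->
  (incr g t <= (1 + th)%:E * incr f t + (1 + th^-1)%:E * (4%:E * sqdist g f))%E.
Proof.
move=> th0 t0 mg mf.
pose a w := f (X t w) - f (X 0 w).
pose e x := g x - f x.
pose b w := e (X t w) - e (X 0 w).
have me : measurable_fun setT e by exact: measurable_funB.
have mX h s := @measurable_coordX h s.
have ma : measurable_fun setT a by apply: measurable_funB; exact: mX.
have mb : measurable_fun setT b by apply: measurable_funB; exact: mX.
have -> : incr g t = (\int[P]_w ((a w + b w) ^+ 2)%:E)%E.
  by apply: eq_integral => w _; congr (_ ^+ 2)%:E; rewrite /a /b /e; ring.
apply: (le_trans (integral_sqrD _ th0 ma mb)).
apply: leeD => //; apply: lee_wpmul2l; first by rewrite lee_fin addr_ge0// invr_ge0 ltW.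
have := @integral_sqrD _ _ P (fun w => e (X t w)) (fun w => - e (X 0 w)) 1 ltr01
  (mX _ _ me) (measurableT_comp (@oppr_measurable _ _) (mX _ _ me)).
move=> /le_trans; apply.
have sq s : 0 <= s -> (\int[P]_w (e (X s w) ^+ 2)%:E = sqdist g f)%E.
  move=> s0; rewrite (@stationary_ge0_integral s (fun x => (e x ^+ 2)%:E))//.
    by apply/measurable_EFinP; exact: measurable_funX.
  by move=> x; rewrite lee_fin sqr_ge0.
under [X in (_ + _ * X)%E]eq_integral do rewrite sqrrN.
rewrite !sq// invr1 -ge0_muleDl ?lee_fin// -EFinD.
by rewrite (_ : 1 + 1 + (1 + 1) = 4 :> R)//; ring.
Qed.

End Process.

(** * Bounds on the Rayleigh quotients of the process *)

Section RelaxationTime.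
Variables (R : realType) (d : measure_display) (Omega : measurableType d).
Variables (P : probability Omega R) (p : R) (X : R -> {RV P >-> config}).
Variable Q : R -> R.-pker config ~> config.
Hypothesis p01 : 0 < p < 1.
Local Notation pi := (distribution P (X 0)).
Hypothesis hpi : product_bernoulli p pi.
Hypothesis htr : transition_function Q.
Hypothesis hmk : markov_with Q X.
Hypothesis hst : forall (t : R) B, 0 <= t -> measurable B ->
  distribution P (X t) B = pi B.
Hypothesis hgen : forall g h : config -> R,
  semigroup_generator Q pi g h <-> east_generator p pi g h.

Local Notation L := (east_pregenerator p).
Implicit Types (f g h : config -> R) (s t u r e a b C eps th : R).

Let P1 : P setT = 1%E. Proof. exact: probability_setT. Qed.
Let pi1 : pi setT = 1%E. Proof. exact: probability_setT. Qed.


Local Notation incr := (incr X).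
Local Notation sqdist := (sqdist X).
Local Notation psi := (psi pi Q).

Let hinv := invariant_kernel hmk hst.

Lemma sqdistC g f : sqdist g f = sqdist f g.
Proof. by apply: eq_integral => x _; congr EFin; ring. Qed.

(** [K] may blow up as [th] tends to 0, so [th] is fixed first and [eps] chosen afterwards. *)
Lemma ler_young_limit (A B : R) (K : R -> R) :
  (forall th eps, 0 < th -> 0 < eps -> A <= (1 + th) ^+ 2 * B + K th * eps) ->
  A <= B.
Proof.
move=> h; apply/ler_addgt0Pr => eta eta0.
pose b := `|B| + 1; have b0 : 0 < b by rewrite ltr_wpDl.
(* As [th <= 1], the excess [th * (2 + th) * b] is at most [3 * th * b <= eta / 2]. *)
pose th := Num.min 1 (eta / (6 * b)).
have th0 : 0 < th by rewrite lt_min ltr01 /= divr_gt0// mulr_gt0.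
have th1 : th <= 1 by rewrite ge_min lexx.
have thb : th * (6 * b) <= eta.
  by rewrite -ler_pdivlMr ?mulr_gt0// ge_min lexx orbT.
pose k := `|K th| + 1; have k0 : 0 < k by rewrite ltr_wpDl.
have e0 : 0 < eta / (2 * k) by rewrite divr_gt0// mulr_gt0.
apply: (le_trans (h th _ th0 e0)).
have h1 : K th * (eta / (2 * k)) <= eta / 2.
  have -> : eta / 2 = k * (eta / (2 * k)) by field; rewrite gt_eqF.
  by rewrite ler_wpM2r ?(ltW e0)// (le_trans (ler_norm _))// lerDl.
have h2 : (1 + th) ^+ 2 * B <= B + eta / 2.
  have -> : (1 + th) ^+ 2 * B = B + th * (2 + th) * B by ring.
  rewrite lerD2l; apply: (@le_trans _ _ (th * 3 * b)); last by lra.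
  have Bb : B <= b by rewrite (le_trans (ler_norm _))// lerDl.
  apply: (@le_trans _ _ (th * (2 + th) * b)).
    by rewrite ler_wpM2l// mulr_ge0 ?(ltW th0)// addr_ge0// ltW.
  rewrite ler_pM2r// ler_pM2l//; lra.
lra.
Qed.

Section General.
Variable g : config -> R.
Hypothesis gL : g \in Lfun pi 2%:E.

Let mg : measurable_fun setT g.
Proof. by move: gL; rewrite inE => /andP[]; rewrite inE. Qed.

Let g2 : (\int[pi]_x (g x ^+ 2)%:E < +oo)%E.
Proof.
have /integrableP[_] := Lfun2_integrable_sqr gL.
by under eq_integral do rewrite /= ger0_norm ?sqr_ge0//.
Qed.

Lemma approx_L2 eps : 0 < eps -> exists2 f, local_fun f & (sqdist g f <= eps%:E)%E.
Proof. exact: local_dense. Qed.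

Let incr_ge0 h t : (0 <= incr h t)%E.
Proof. by apply: integral_ge0 => w _; rewrite lee_fin sqr_ge0. Qed.

Lemma incr_fin t : 0 <= t -> incr g t \is a fin_num.
Proof.
move=> t0; have [f lf hf] := approx_L2 ltr01.
have mf := (bdd_local lf).1.
rewrite ge0_fin_numE//; apply: le_lt_trans (incr_perturb hst ltr01 t0 mg mf) _.
rewrite (incr_local hmk hst t0 lf) lte_add_pinfty//.
  by rewrite -EFinM ltry.
rewrite lte_mul_pinfty// ?lee_fin// lte_mul_pinfty//.
by apply: le_lt_trans hf _; rewrite ltry.
Qed.

Definition msq t : R := fine (incr g t).

Lemma msq_perturb f th eps t : local_fun f -> (sqdist g f <= eps%:E)%E -> 0 < th -> 0 <= t ->
  msq t <= (1 + th) * (2 * psi f t) + (1 + th^-1) * (4 * eps) /\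
  2 * psi f t <= (1 + th) * msq t + (1 + th^-1) * (4 * eps).
Proof.
move=> lf hf th0 t0; have mf := (bdd_local lf).1.
have c0 : (0 <= (1 + th^-1)%:E)%E by rewrite lee_fin addr_ge0// invr_ge0 ltW.
have k : ((1 + th^-1)%:E * (4%:E * sqdist g f) <= ((1 + th^-1) * (4 * eps))%:E)%E.
  by rewrite !EFinM; apply: lee_wpmul2l => //; apply: lee_wpmul2l => //; rewrite lee_fin.
split; rewrite -lee_fin.
  rewrite fineK ?incr_fin//; apply: le_trans (incr_perturb hst th0 t0 mg mf) _.
  by rewrite (incr_local hmk hst t0 lf) [leRHS]EFinD [X in (_ <= X + _)%E]EFinM leeD2l.
rewrite -(incr_local hmk hst t0 lf); apply: le_trans (incr_perturb hst th0 t0 mf mg) _.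
by rewrite sqdistC [leRHS]EFinD [X in (_ <= X + _)%E]EFinM fineK ?incr_fin// leeD2l.
Qed.

Lemma msq_ratio s t : 0 < s -> s <= t -> msq t <= t / s * msq s.
Proof.
move=> s0 st; have t0 : 0 < t by exact: lt_le_trans st.
have r0 : 0 < t / s by rewrite divr_gt0.
apply: (@ler_young_limit _ _ (fun th => ((1 + th) * (t / s) + 1) * (1 + th^-1) * 4)).
move=> th eps th0 eps0; have [f lf hf] := approx_L2 eps0.
have [h1 _] := msq_perturb lf hf th0 (ltW t0).
have [_ h2] := msq_perturb lf hf th0 (ltW s0).
have h3 := psi_ratio p01 hpi htr hinv hgen lf s0 st.
have c1 : 0 <= 1 + th by rewrite addr_ge0// ltW.
apply: (le_trans h1).
set K := (1 + th^-1) * (4 * eps) in h1 h2 *.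
have h4 : (1 + th) * (2 * psi f t) <= (1 + th) * (t / s * (2 * psi f s)).
  rewrite ler_wpM2l//; lra.
have h5 : (1 + th) * (t / s * (2 * psi f s)) <= (1 + th) * (t / s * ((1 + th) * msq s + K)).
  by rewrite ler_wpM2l// ler_pM2l.
have -> : ((1 + th) * (t / s) + 1) * (1 + th^-1) * 4 * eps = (1 + th) * (t / s) * K + K.
  by rewrite /K; ring.
have -> : (1 + th) ^+ 2 * (t / s * msq s) + ((1 + th) * (t / s) * K + K) =
   (1 + th) * (t / s * ((1 + th) * msq s + K)) + K by ring.
by rewrite lerD2r (le_trans h4).
Qed.

Definition vr : R := fine ('V_P[g \o X 0])%E.

Lemma Lfun_coord0 : (g \o X 0) \in Lfun P 2%:E.
Proof.
rewrite inE; apply/andP; split; rewrite inE /=; first exact: measurableT_comp.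
move: gL; rewrite inE => /andP[_]; rewrite inE /= /finite_norm unlock.
rewrite ge0_integral_distribution//; last by move=> y; exact: poweR_ge0.
apply/measurable_EFinP/(@measurableT_comp _ _ _ _ _ _ (fun x : R => x `^ 2)) => //.
exact/measurableT_comp.
Qed.

(** Any centring will do; the mean of a local approximation of [g] is inserted later. *)
Lemma variance_le a : ('V_P[g \o X 0] <= \int[pi]_x ((g x - a) ^+ 2)%:E)%E.
Proof.
have gX := Lfun_coord0.
have Y2 : ((g \o X 0) \- cst a) \in Lfun P 2%:E.
  by rewrite rpredB ?lee1n//= => _; rewrite Lfun_cst.
rewrite -(varianceB_cst_r a Lfun_coord0) varianceE//.
have -> : (\int[pi]_x ((g x - a) ^+ 2)%:E = 'E_P[((g \o X 0) \- cst a) ^+ 2])%E.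
  rewrite unlock ge0_integral_distribution//.
    by apply/measurable_EFinP/measurable_funX/measurable_funB.
  by move=> x; rewrite lee_fin sqr_ge0.
rewrite leeBlDr; last first.
  rewrite fin_numX// expectation_fin_num//; apply: Lfun_subset12 => //.
  exact: fin_num_measure.
by rewrite leeDl// sqre_ge0.
Qed.

Lemma vr_fin : 'V_P[g \o X 0] = vr%:E.
Proof. by rewrite fineK// variance_fin_num ?Lfun_coord0. Qed.

Lemma vr_ge0 : 0 <= vr.
Proof. by rewrite fine_ge0// variance_ge0. Qed.

Section Gap.
Variable C : R.
Hypothesis C0 : 0 < C.
Hypothesis hC : forall f, local_fun f -> mean pi (fun y => f y ^+ 2) - mean pi f ^+ 2 <=
      C * - mean pi (fun y => f y * L f y).

Lemma msq_gap t : 0 < t -> 2 * t * vr <= (C + t) * msq t.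
Proof.
move=> t0; have Ct : 0 < C + t by rewrite addr_gt0.
apply: (@ler_young_limit _ _
  (fun th => (1 + th) * (C + t) * ((1 + th^-1) * 4) + 2 * t * (1 + th^-1))).
move=> th eps th0 eps0; have [f lf hf] := approx_L2 eps0.
have bf := bdd_local lf; have mf := bf.1.
have [_ h2] := msq_perturb lf hf th0 (ltW t0).
have h3 := psi_gap p01 hpi htr hinv hgen lf C0 t0 hC.
have c1 : 0 <= 1 + th by rewrite addr_ge0// ltW.
pose m := mean pi f.
have bm := bdd_cst config m.
have h4 : vr <= (1 + th) * (ip pi f f - m ^+ 2) + (1 + th^-1) * eps.
  rewrite -lee_fin -vr_fin; apply: le_trans (variance_le m) _.
  have mfm : measurable_fun setT (fun x => f x - m) by exact: (bddB bf bm).1.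
  have mgf : measurable_fun setT (fun x => g x - f x) by exact: measurable_funB.
  have := integral_sqrD pi th0 mfm mgf.
  have E : (fun x => ((f x - m + (g x - f x)) ^+ 2)%:E) = (fun x => ((g x - m) ^+ 2)%:E).
    by apply/funext => x; congr EFin; ring.
  rewrite E => /le_trans; apply.
  rewrite [leRHS]EFinD; apply: leeD.
    rewrite -(mean_EFin pi1 (bddX 2 (bddB bf bm))) -EFinM lee_fin.
    rewrite (@eq_mean _ _ _ _ _ (fun x => (f x ^+ 2 - 2 * m * f x) + m ^+ 2)); last first.
      by move=> x; ring.
    have b2 := bddX 2 bf; have bmf := bddZ (2 * m) bf.
    rewrite meanD//; [|exact: bddB|exact: bdd_cst].
    rewrite meanB// meanZ// mean_cst// -/m ipE le_eqVlt; apply/orP; left; apply/eqP; ring.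
  rewrite EFinM; apply: lee_wpmul2l => //.
  by rewrite lee_fin addr_ge0// invr_ge0 ltW.
set K := (1 + th^-1) * (4 * eps) in h2.
have h5 : 2 * t * vr <= 2 * t * ((1 + th) * (ip pi f f - m ^+ 2) + (1 + th^-1) * eps).
  by rewrite ler_wpM2l// mulr_ge0// ltW.
have h6 : (1 + th) * (2 * (t * (ip pi f f - m ^+ 2))) <= (1 + th) * ((C + t) * (2 * psi f t)).
  by rewrite ler_wpM2l// [leRHS]mulrCA ler_pM2l.
have h7 : (1 + th) * ((C + t) * (2 * psi f t)) <= (1 + th) * ((C + t) * ((1 + th) * msq t + K)).
  by rewrite ler_wpM2l// ler_pM2l.
have -> : (1 + th) ^+ 2 * ((C + t) * msq t) +
  ((1 + th) * (C + t) * ((1 + th^-1) * 4) + 2 * t * (1 + th^-1)) * eps =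
  (1 + th) * ((C + t) * ((1 + th) * msq t + K)) + 2 * t * ((1 + th^-1) * eps).
  by rewrite /K; ring.
have E5 : 2 * t * ((1 + th) * (ip pi f f - m ^+ 2) + (1 + th^-1) * eps) =
  (1 + th) * (2 * (t * (ip pi f f - m ^+ 2))) + 2 * t * ((1 + th^-1) * eps) by ring.
rewrite E5 in h5; apply: (le_trans h5); rewrite lerD2r.
exact: le_trans h6 h7.
Qed.

(** The difference quotient is nonincreasing in [t], so its limit at 0 exists and is a supremum,
    which [msq_gap] bounds below at each [t]. *)
Lemma rayleigh_le : ('V_P[g \o X 0%R] / dirichlet_form X g <= C%:E)%E.
Proof.
pose F t := ((t^-1)%:E * 'E_P[fun w => ((g (X t w) - g (X 0 w)) ^+ 2)%R])%E.
have FE t : 0 <= t -> F t = (t^-1 * msq t)%:E.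
  by move=> t0; rewrite EFinM fineK ?incr_fin// /F unlock.
have anti : {in Interval (BRight 0) (BLeft 1) &, nonincreasing_fun F}.
  move=> s t; rewrite !in_itv /= => /andP[s0 _] /andP[t0 _] st.
  rewrite (FE _ (ltW s0)) (FE _ (ltW t0)) lee_fin ler_pdivrMl//.
  by apply: le_trans (msq_ratio s0 st) _; rewrite mulrA.
have lt01 : (BRight (0 : R) < BLeft 1)%O by rewrite bnd_simp.
have cvF := @nonincreasing_at_right_cvge _ F 0 (BLeft 1) lt01 anti.
set l := ereal_sup _ in cvF.
have -> : dirichlet_form X g = ((2^-1)%:E * l)%E.
  by rewrite /dirichlet_form; congr (_ * _)%E; apply: cvg_lim.
have lge t : 0 < t -> t < 1 -> ((2 * vr / (C + t))%:E <= l)%E.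
  move=> t0 t1; apply: (@le_trans _ _ (F t)).
    rewrite (FE _ (ltW t0)) lee_fin ler_pdivrMr ?addr_gt0// -mulrA ler_pdivlMl//.
    by rewrite [leRHS]mulrC mulrA [t * 2]mulrC; exact: msq_gap.
  by apply: ereal_sup_ubound; exists t => //=; rewrite in_itv /= t0 t1.
have l0 : (0 <= l)%E.
  have h2 : (0 : R) < 2^-1 by rewrite invr_gt0.
  apply: le_trans (lge _ h2 _); last by rewrite invf_lt1// ltr1n.
  by rewrite lee_fin divr_ge0 ?mulr_ge0 ?vr_ge0// addr_ge0// ltW.
rewrite vr_fin; move: lge l0 {cvF}; case: l => [r| |] lge l0.
- have rC : 2 * vr <= r * C.
    apply/ler_addgt0Pr => eps eps0.
    have r1 : 0 < r + 1 by rewrite ltr_wpDl.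
    pose t := Num.min (eps / (r + 1)) 2^-1.
    have t0 : 0 < t.
      by rewrite lt_min; apply/andP; split; [exact: divr_gt0|rewrite invr_gt0].
    have t1 : t < 1 by rewrite gt_min invf_lt1// ltr1n orbT.
    have := lge t t0 t1; rewrite lee_fin ler_pdivrMr ?addr_gt0// => /le_trans; apply.
    rewrite mulrDr lerD2l; apply: (@le_trans _ _ ((r + 1) * t)).
      by rewrite ler_wpM2r ?lerDl// ltW.
    by rewrite mulrC -ler_pdivlMr// ge_min lexx.
  (* A vanishing Dirichlet form forces zero variance, and the quotient is then [0 * +oo = 0]. *)
  rewrite -EFinM; have [r0|r0] := eqVneq r 0.
    have v0 : vr = 0 by apply/eqP; rewrite eq_le vr_ge0 andbT; move: rC; rewrite r0 mul0r; lra.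
    by rewrite v0 mul0e lee_fin ltW.
  have rp : 0 < r by rewrite lt_neqAle eq_sym r0.
  rewrite inver mulf_eq0 invr_eq0 pnatr_eq0 /= (negbTE r0) -EFinM lee_fin.
  by rewrite ler_pdivrMr ?mulr_gt0 ?invr_gt0//; lra.
- by rewrite gt0_muley ?lte_fin ?invr_gt0// invey mule0 lee_fin ltW.
- by [].
Qed.

End Gap.
End General.

Lemma relaxation_time_le C : 0 < C ->
  (forall f, local_fun f -> mean pi (fun y => f y ^+ 2) - mean pi f ^+ 2 <=
      C * - mean pi (fun y => f y * L f y)) ->
  (relaxation_time X <= C%:E)%E.
Proof.
move=> C0 hC; apply: ge_ereal_sup => _ [g [gL _] <-].
exact: rayleigh_le.
Qed.

(** For local [g] the limit in the Dirichlet form is computed directly, since [gen_err] tends to 0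
    in L2. *)
Lemma relaxation_time_ge g v D : local_fun g -> 0 < v -> 0 < D ->
  v <= mean pi (fun y => g y ^+ 2) - mean pi g ^+ 2 ->
  - mean pi (fun y => g y * L g y) <= D -> ((v / D)%:E <= relaxation_time X)%E.
Proof.
move=> lg v0 D0 hv hD.
have bg := bdd_local lg; have gL := bdd_Lfun pi bg.
have bLg : bdd (L g) by exact/bdd_local/local_pregen.
pose E := - ip pi g (L g).
have E0 : 0 <= E by exact: pregen_le0.
have dE : dirichlet_form X g = E%:E.
  rewrite /dirichlet_form (_ : lim _ = (2 * E)%:E); first by rewrite -EFinM; congr EFin; field.
  apply: cvg_lim => //.
  apply: (@cvg_trans _ ((fun t => (2 * (E - ip pi g (gen_err p Q t g)))%:E) @ 0^'+)).
    apply: near_eq_cvg; near=> t.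
    have t0 : 0 < t by near: t; exact: nbhs_right_gt.
    have := incr_local hmk hst (ltW t0) lg; rewrite /incr unlock => ->.
    rewrite -EFinM; congr EFin; rewrite /psi.
    have be := bdd_gen_err p Q t lg.
    set e := gen_err p Q t g in be *.
    have be1 : bdd (fun x => (-1) * e x) by exact: bddZ.
    have b1 : bdd (fun x => L g x - (-1) * e x) by exact: bddB.
    have b2 : bdd (fun x => (- t) * (L g x - (-1) * e x)) by exact: bddZ.
    have -> : kernel_op (Q t) g = fun x => g x - (- t) * (L g x - (-1) * e x).
      by apply/funext => x; rewrite /e /gen_err; field; rewrite gt_eqF.
    rewrite (ipBr pi bg b2 bg) (ipZr pi _ b1 bg) (ipBr pi bLg be1 bg) (ipZr pi _ be bg).
    by rewrite /E; field; rewrite gt_eqF.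
  apply: cvg_EFin; first by apply: nearW.
  apply/cvgrPdist_lt => eps eps0.
  pose c := 2 * nrm pi g + 1.
  have c0 : 0 < c by rewrite ltr_wpDl// mulr_ge0// nrm_ge0.
  have ec : 0 < eps / c by rewrite divr_gt0.
  have [d0 d0p hd] := gen_err_small hgen lg ec.
  near=> t; have t0 : 0 < t by near: t; exact: nbhs_right_gt.
  have td : t < d0 by near: t; exact: nbhs_right_lt.
  have ht : nrm pi (gen_err p Q t g) < eps / c by apply: hd; rewrite t0.
  rewrite /= (_ : 2 * E - 2 * (E - _) = 2 * ip pi g (gen_err p Q t g)); last by ring.
  rewrite normrM ger0_norm//.
  have := ip_CS pi bg (bdd_gen_err p Q t lg); set z := `|_| => zle.
  apply: (@le_lt_trans _ _ (2 * nrm pi g * nrm pi (gen_err p Q t g))); first by rewrite -mulrA ler_pM2l.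
  apply: (@le_lt_trans _ _ (2 * nrm pi g * (eps / c))).
    by rewrite ler_wpM2l ?mulr_ge0 ?nrm_ge0// ltW.
  by rewrite mulrA ltr_pdivrMr// mulrC ltr_pM2l// /c ltrDl.
have bgX := bdd_comp X 0 bg.
have VE : 'V_P[g \o X 0] = (mean pi (fun y => g y ^+ 2) - mean pi g ^+ 2)%:E.
  rewrite varianceE; last exact: Lfun_coord0.
  rewrite unlock EFinB EFin_expe.
  congr (_ - _ ^+ 2)%E.
    rewrite -(mean_stationary hst (lexx 0) (bddX 2 bg)) mean_EFin//.
    exact: (bdd_comp X 0 (bddX 2 bg)).
  by rewrite -(mean_stationary hst (lexx 0) bg) mean_EFin.
apply: (@le_trans _ _ ('V_P[g \o X 0] / dirichlet_form X g)%E).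
  (* If the form vanishes, the quotient is +oo. *)
  rewrite VE dE inver; case: eqP => [_|/eqP En0].
    by rewrite gt0_muley ?leey// lte_fin (lt_le_trans v0).
  have Ep : 0 < E by rewrite lt_neqAle eq_sym En0.
  rewrite -EFinM lee_fin; apply: ler_pM => //; rewrite ?invr_ge0 ?(ltW v0) ?(ltW D0)//.
  by rewrite lef_pV2 ?posrE.
(* An almost surely constant [g] would have zero variance, against [0 < v]. *)
apply: ereal_sup_ubound; exists g => //; split => // -[c gc].
have mc : {ae pi, forall x, setT x -> (g x)%:E = c%:E}.
  by apply: filterS gc => x -> _.
have e1 : mean pi g = c.
  rewrite /mean /Rintegral (@ae_eq_integral _ _ _ pi setT (fun=> c%:E) (EFin \o g))//.
  - by rewrite integral_cst// [X in (_ * X)%E]pi1 mule1.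
  - by apply/measurable_EFinP; exact: bg.1.
have e2 : mean pi (fun y => g y ^+ 2) = c ^+ 2.
  rewrite /mean /Rintegral (@ae_eq_integral _ _ _ pi setT
    (fun=> (c ^+ 2)%:E) (EFin \o (fun y => g y ^+ 2)))//.
  - by rewrite integral_cst// [X in (_ * X)%E]pi1 mule1.
  - by apply/measurable_EFinP; exact: (bddX 2 bg).1.
  - by apply: filterS gc => x /= -> _.
by move: hv; rewrite e1 e2 subrr leNgt v0.
Unshelve. all: by end_near.
Qed.

End RelaxationTime.

(** * Asymptotics *)

Section Asymptotics.
Variable R : realType.

Lemma ln2_bounds : 2^-1 <= ln 2 :> R /\ ln 2 <= 1 :> R.
Proof.
split; last by have := @le_ln1Dx R 1; rewrite -natr1 addrC; apply; lra.
have := @le_ln1Dx R (- 2^-1); rewrite (_ : 1 + - 2^-1 = 2^-1 :> R); last by lra.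
by rewrite lnV ?posrE//; lra.
Qed.

Lemma ln_inv_large (p Y : R) : 0 < p -> p < expR (- Y) -> Y < ln p^-1.
Proof.
move=> p0 pY; rewrite lnV ?posrE// ltrNr -(expRK (- Y)).
by rewrite ltr_ln ?posrE// expR_gt0.
Qed.

(** Take [l] just above 3 / p, so that (1 - p)^l <= exp(-3) <= 1/8. Since [l <= 4 / p], the least
    power of 2 not below [2 l] is at most 16 / p, whence [4 * ln 2]. *)
Lemma scale_upper (p : R) : 0 < p -> p < 1 ->
  exists n l : nat, [/\ (1 - p) ^+ l <= 8^-1, (l + l <= 2 ^ n)%N &
    n%:R * ln 2 <= 4 * ln 2 + ln p^-1].
Proof.
move=> p0 p1; have p30 : 0 <= 3 / p by rewrite divr_ge0// ltW.
pose l := (Num.truncn (3 / p)).+1.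
have /andP[l1 l2] := truncn_itv p30.
exists (up_log 2 (l + l)), l; split.
- have h : 1 - p <= expR (- p) by exact: expR_ge1Dx.
  apply: (@le_trans _ _ (expR (- p) ^+ l)).
    by rewrite lerXn2r// nnegrE ?expR_ge0// subr_ge0 ltW.
  rewrite -expRM_natl mulrN expRN lef_pV2 ?posrE ?expR_gt0//.
  have pl : 3 <= l%:R * p by rewrite -ler_pdivrMr// ltW.
  have e2 : 2 <= expR 1 :> R by have := @expR_ge1Dx R 1; lra.
  apply: (@le_trans _ _ (expR (3%:R * 1))); last by rewrite ler_expR mulr1.
  rewrite expRM_natl; apply: (@le_trans _ _ (2 ^+ 3)); first by lra.
  by rewrite lerXn2r// ?nnegrE ?expR_ge0.
- exact: up_logP.
- set n := up_log 2 (l + l).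
  have ll : (1 < l + l)%N by rewrite /l; lia.
  have /andP[n1 n2] := up_log_bounds (isT : (1 < 2)%N) ll.
  rewrite -/n in n1 n2.
  have n0 : (0 < n)%N by rewrite up_log_gt0 ll.
  have h2n : (2 ^+ n : R) <= 16 / p.
    have : (2 ^ n.-1 <= l + l)%N by exact: ltnW.
    rewrite -(ler_nat R) natrX natrD => h.
    have lp : (l%:R : R) <= 4 / p.
      apply: (@le_trans _ _ (3 / p + 1)); first by rewrite /l -natr1 lerD2r.
      have -> : 4 / p = 3 / p + p^-1 by field; rewrite gt_eqF.
      by rewrite lerD2l invf_ge1// ltW.
    rewrite -(prednK n0) exprS.
    have -> : 16 / p = 2 * (4 / p + 4 / p) by field; rewrite gt_eqF.
    by rewrite ler_pM2l// (le_trans h)// lerD.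
  have -> : n%:R * ln 2 = ln (2 ^+ n) :> R by rewrite lnXn// mulr_natl.
  have -> : 4 * ln 2 + ln p^-1 = ln (16 / p) :> R.
    rewrite lnM ?posrE ?invr_gt0//; congr (_ + _).
    by rewrite (_ : 16 = 2 ^+ 4); [rewrite lnXn// mulr_natl|lra].
  by rewrite ler_ln ?posrE ?exprn_gt0// divr_gt0.
Qed.

(** With y = ln (1/p) > 1, the terms beside y^2 / ln 2 are at most 3 ln 2 + 4 ln 3 + 4 y + y ln 3 /
    ln 2 <= 3 + 8 + 4 y + 4 y <= 19 y. *)
Lemma ln_upper (p eps : R) (n : nat) : 0 < p -> 0 < eps -> 1 + 19 / eps < ln p^-1 ->
  n%:R * ln 2 <= 4 * ln 2 + ln p^-1 ->
  ln (8 * (3 / p) ^+ n) <= ((ln 2)^-1 + eps) * ln p^-1 ^+ 2.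
Proof.
move=> p0 eps0; set y := ln p^-1 => yl hn.
have [c1 c2] := ln2_bounds; set c := ln 2 in hn c1 c2 *.
have c0 : 0 < c by apply: lt_le_trans c1; rewrite invr_gt0.
have y1 : 1 < y by apply: le_lt_trans yl; rewrite lerDl divr_ge0// ltW.
have ye : 19 <= eps * y.
  rewrite mulrC -ler_pdivrMr//; apply: le_trans (ltW yl); by rewrite lerDr.
have l8 : ln 8 = 3 * c.
  by rewrite (_ : 8 = 2 ^+ 3 :> R); [rewrite lnXn// mulr_natl|lra].
have l3 : ln 3 <= 2 :> R by have := @le_ln1Dx R 2; rewrite (_ : 1 + 2 = 3 :> R); [apply|]; lra.
have l30 : 0 <= ln 3 :> R by rewrite ln_ge0//; lra.
have p30 : 0 < 3 / p by rewrite divr_gt0.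
rewrite lnM ?posrE ?exprn_gt0// l8 lnXn// lnM ?posrE ?invr_gt0// -/y.
rewrite -[(_ + y) *+ n]mulr_natl.
have ny : n%:R <= 4 + c^-1 * y.
  rewrite -(ler_pM2r c0) mulrDl (mulrC c^-1) mulrVK ?unitfE ?gt_eqF//.
set a := ln 3 in l3 l30 *.
have ci : c^-1 <= 2 by rewrite -[2]invrK lef_pV2 ?posrE// invr_gt0.
have ay : 0 <= a + y by lra.
have h1 : n%:R * (a + y) <= (4 + c^-1 * y) * (a + y) by rewrite ler_wpM2r.
have h2 : c^-1 * y * a <= 2 * y * 2.
  apply: ler_pM => //; first by rewrite mulr_ge0 ?invr_ge0 ?(ltW c0)//; lra.
  by rewrite ler_pM2r//; lra.
have h3 : 19 * y <= eps * y * y by rewrite ler_pM2r//; lra.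
have -> : (c^-1 + eps) * y ^+ 2 = c^-1 * y * y + eps * y * y by ring.
have : (4 + c^-1 * y) * (a + y) = 4 * a + 4 * y + c^-1 * y * a + c^-1 * y * y by ring.
lra.
Qed.

(** The crude n! <= n^n suffices, as n ln n is negligible against n^2. *)
Lemma peel_bound_le n : (peel_bound n <= n ^ n * 2 ^ 'C(n, 2))%N.
Proof.
rewrite /peel_bound big_split /= -expn_sum; apply: leq_mul.
  apply: (@leq_trans (\prod_(k < n) n)); last by rewrite prod_nat_const card_ord.
  by apply: leq_prod => k _; exact: ltn_ord.
rewrite leq_exp2l// -bin2_sum big_mkord (reindex_inj rev_ord_inj) /=.
apply: leq_sum => k _; have := ltn_ord k; lia.
Qed.

Lemma scale_lower (p : R) : 0 < p -> p < 1 ->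
  exists n : nat, n%:R * ln 2 <= ln p^-1 /\ ln p^-1 < (n%:R + 1) * ln 2.
Proof.
move=> p0 p1; have [c1 _] := ln2_bounds.
have c0 : 0 < ln 2 :> R by apply: lt_le_trans c1; rewrite invr_gt0.
have y0 : 0 <= ln p^-1 :> R by rewrite ln_ge0// invf_ge1// ltW.
have /andP[h1 h2] := truncn_itv (divr_ge0 y0 (ltW c0)).
exists (Num.truncn (ln p^-1 / ln 2)); split; first by rewrite -ler_pdivlMr.
by rewrite -ltr_pdivrMr// natr1.
Qed.

Lemma ln_lower (p eps : R) (n : nat) (v := (1 - p) ^+ (2 ^ n) * p)
    (D := (2 ^ n)%:R * p * ((peel_bound n)%:R * p ^+ n)) :
  0 < p -> p < 2^-1 -> 0 < eps -> 2 < ln p^-1 ->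
  7 + 4 * `|ln (eps / 8)| <= eps * ln p^-1 ->
  n%:R * ln 2 <= ln p^-1 -> ln p^-1 < (n%:R + 1) * ln 2 ->
  [/\ 0 < v, 0 < D & ((2 * ln 2)^-1 - eps) * ln p^-1 ^+ 2 <= ln (v / D)].
Proof.
move=> p0 p2 eps0; set y := ln p^-1 => y1 ye hn1 hn2.
have [c1 c2] := ln2_bounds; set c := ln 2 in hn1 hn2 c1 c2 *.
have c0 : 0 < c by apply: lt_le_trans c1; rewrite invr_gt0.
have p1 : 0 < 1 - p by lra.
have v0 : 0 < v by rewrite mulr_gt0// exprn_gt0.
have n0 : (0 < n)%N.
  by case: (n) hn2 => //; rewrite add0r mul1r => h; exfalso; lra.
have NR : (0 : R) < n%:R by rewrite ltr0n.
have B0 : (0 < peel_bound n)%N.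
  by apply: prodn_gt0 => k; rewrite muln_gt0 expn_gt0.
have BR : (0 : R) < (peel_bound n)%:R by rewrite ltr0n.
have two0 : (0 : R) < (2 ^ n)%:R by rewrite ltr0n expn_gt0.
have D0 : 0 < D by rewrite !mulr_gt0// exprn_gt0.
split => //.
have lp : ln p = - y by rewrite /y lnV ?posrE// opprK.
have l2n : ln (2 ^ n)%:R = n%:R * c :> R by rewrite natrX lnXn// mulr_natl.
(* This keeps (1 - p)^(2^n) away from 0 and absorbs the number of sites in [D]. *)
have p2n : (2 ^ n)%:R * p <= 1.
  rewrite -ler_pdivlMr// div1r -ler_ln ?posrE ?invr_gt0// l2n //.
have lv : - 2 - y <= ln v.
  rewrite /v lnM ?posrE ?exprn_gt0// lp lerD2r lnXn// -[leRHS]mulr_natl.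
  have l1p : - (2 * p) <= ln (1 - p).
    rewrite lerNl -lnV ?posrE//.
    have -> : (1 - p)^-1 = 1 + p / (1 - p) by field; rewrite gt_eqF.
    have pp : p / (1 - p) <= 2 * p by rewrite ler_pdivrMr//; nra.
    apply: le_trans pp; apply: le_ln1Dx.
    by apply: (@lt_le_trans _ _ 0) => //; rewrite divr_ge0// ltW.
  apply: (@le_trans _ _ ((2 ^ n)%:R * - (2 * p))); last by rewrite ler_pM2l.
  by lra.
have lB : ln (peel_bound n)%:R <= n%:R * ln n%:R + n%:R * n%:R / 2 * c :> R.
  have h : (peel_bound n)%:R <= (n ^ n * 2 ^ 'C(n, 2))%:R :> R by rewrite ler_nat peel_bound_le.
  apply: (@le_trans _ _ (ln (n ^ n * 2 ^ 'C(n, 2))%:R)).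
    by rewrite ler_ln ?posrE// (lt_le_trans BR).
  rewrite natrM !natrX lnM ?posrE ?exprn_gt0// !lnXn//.
  rewrite -[ln n%:R *+ n]mulr_natl -[ln 2 *+ _]mulr_natl lerD2l ler_pM2r//.
  rewrite ler_pdivlMr// -natrM -[_ * 2]natrM ler_nat muln2 -[X in (X <= _)%N]mul2n.
  have := bin2 n; have := half_leq (leqnn (n * n.-1)).
  have : ((n * n.-1)./2.*2 <= n * n.-1)%N by rewrite -{2}(odd_double_half (n * n.-1)) leq_addl.
  by move=> h1 _ ->; rewrite mul2n (leq_trans h1)// leq_mul// leq_pred.
have lD : ln D <= n%:R * ln n%:R + n%:R * n%:R / 2 * c - n%:R * y.
  rewrite /D lnM ?posrE ?mulr_gt0 ?exprn_gt0//.
  rewrite [ln (_ * p ^+ n)]lnM ?posrE ?exprn_gt0// lnXn// lp -[(- y) *+ n]mulr_natl.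
  have : ln ((2 ^ n)%:R * p) <= 0 by exact: ln_le0.
  by move: lB; lra.
have e80 : 0 < eps / 8 by rewrite divr_gt0.
set K := `|ln (eps / 8)| in ye.
(* [eps / 8] is chosen so that, with [n <= 2 y], the term in n^2 costs half of [eps * y ^ 2]. *)
have ln_n : ln n%:R <= eps / 8 * n%:R + K.
  have := ln_sublinear (mulr_gt0 e80 NR); rewrite lnM ?posrE//.
  have : - K <= ln (eps / 8) by rewrite /K lerNl ler_normr lexx orbT.
  by lra.
rewrite ln_div ?posrE//.
have n2y : n%:R <= 2 * y.
  have : n%:R * 2^-1 <= n%:R * c by rewrite ler_pM2l.
  lra.
have K0 : 0 <= K by rewrite normr_ge0.
have t1 : n%:R * ln n%:R <= n%:R * (eps / 8 * n%:R + K) by rewrite ler_pM2l.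
have nn : n%:R * n%:R <= 2 * y * (2 * y) by rewrite ler_pM.
have t2 : eps / 8 * (n%:R * n%:R) <= eps / 8 * (2 * y * (2 * y)) by rewrite ler_pM2l.
have t3 : n%:R * K <= 2 * y * K by rewrite ler_wpM2r.
have t4 : (7 + 4 * K) * y <= eps * y * y by rewrite ler_pM2r//; lra.
(* [n] nearly maximises [n y - n^2 c / 2], whose maximum is y^2 / (2 c); the square lost is at most
   [c ^ 2], and [c <= 1]. *)
have sq : n%:R * y - n%:R * n%:R / 2 * c >= (2 * c)^-1 * y ^+ 2 - 2^-1.
  have E : n%:R * y - n%:R * n%:R / 2 * c = (2 * c)^-1 * y ^+ 2 - (y - n%:R * c) ^+ 2 / (2 * c).
    by field; rewrite gt_eqF.
  rewrite E lerD2l lerN2 ler_pdivrMr ?mulr_gt0//.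
  have d1 : y - n%:R * c <= c by move: hn2; lra.
  have d0 : 0 <= y - n%:R * c by lra.
  have : (y - n%:R * c) ^+ 2 <= c ^+ 2 by rewrite ler_pXn2r// nnegrE ltW.
  have : c ^+ 2 <= c by rewrite expr2 ler_piMl// ltW.
  lra.
have -> : ((2 * c)^-1 - eps) * y ^+ 2 = (2 * c)^-1 * y ^+ 2 - eps * y * y by ring.
have -> : eps * y * y = eps / 2 * y * y + eps / 8 * (2 * y * (2 * y)) by field.
have E2 : n%:R * (eps / 8 * n%:R + K) = eps / 8 * (n%:R * n%:R) + n%:R * K by ring.
rewrite E2 in t1.
(* What remains is 5/2 + y + 2 K y, at most (7 + 4 K) y / 2, which the other half of [eps * y ^ 2]
   covers. *)
lra.
Qed.

End Asymptotics.


Unset Implicit Arguments.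

Theorem theorem1 (R : realType) :
  (forall eps : R, 0 < eps -> \forall p \near 0^'+,
     forall (d : measure_display) (Omega : measurableType d)
            (P : probability Omega R) (X : R -> {RV P >-> config}),
     stationary_east_process p X ->
     (lne (relaxation_time X) <=
        (((ln 2)^-1 + eps) * ln (p^-1) ^+ 2)%:E)%E) /\
  (forall eps : R, 0 < eps -> \forall p \near 0^'+,
     forall (d : measure_display) (Omega : measurableType d)
            (P : probability Omega R) (X : R -> {RV P >-> config}),
     stationary_east_process p X ->
     ((((2 * ln 2)^-1 - eps) * ln (p^-1) ^+ 2)%:E <=
        lne (relaxation_time X))%E).
Proof.
split=> eps eps0.
- near=> p => d Omega P X [Q [htr hmk hpi hst hgen]].
  have p0 : 0 < p by near: p; exact: nbhs_right_gt.
  have p1 : p < 1 by near: p; exact: nbhs_right_lt.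
  have pY : p < expR (- (1 + 19 / eps)).
    by near: p; apply: nbhs_right_lt; exact: expR_gt0.
  have p01 : 0 < p < 1 by rewrite p0 p1.
  have [n [l [hl ln hn]]] := scale_upper p0 p1.
  set C := 8 * (3 / p) ^+ n.
  have C0 : 0 < C by rewrite mulr_gt0// exprn_gt0// divr_gt0.
  have tC : (relaxation_time X <= C%:E)%E.
    apply: (relaxation_time_le p01 hpi htr hmk hst hgen C0) => f lf.
    exact: (poincare_pregen p01 hpi hl ln lf).
  (* [lne] is -oo on nonpositive arguments, where the bound is trivial. *)
  have [t0|t0] := leP (relaxation_time X) 0%E.
    by rewrite le0_lneNy// leNye.
  apply: (@le_trans _ _ (lne C%:E)).
    by rewrite lee_lne// in_itv /= ?leey ?andbT ?lee_fin ?(ltW C0)// ltW.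
  rewrite lne_EFin// lee_fin; apply: ln_upper => //.
  exact: ln_inv_large.
- near=> p => d Omega P X [Q [htr hmk hpi hst hgen]].
  have p0 : 0 < p by near: p; exact: nbhs_right_gt.
  have p2 : p < 2^-1 by near: p; apply: nbhs_right_lt; rewrite invr_gt0.
  have pY : p < expR (- 2) by near: p; apply: nbhs_right_lt; exact: expR_gt0.
  have pZ : p < expR (- ((7 + 4 * `|ln (eps / 8)|) / eps)).
    by near: p; apply: nbhs_right_lt; exact: expR_gt0.
  have p1 : p < 1 by lra.
  have p01 : 0 < p < 1 by rewrite p0 p1.
  have [n [hn1 hn2]] := scale_lower p0 p1.
  have y2 := ln_inv_large p0 pY.
  have ye : 7 + 4 * `|ln (eps / 8)| <= eps * ln p^-1.
    by rewrite [leRHS]mulrC -ler_pdivrMr//; apply: ltW; exact: ln_inv_large.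
  pose v := (1 - p) ^+ (2 ^ n) * p.
  pose D := (2 ^ n)%:R * p * ((peel_bound n)%:R * p ^+ n).
  have [v0 D0 hvD] : [/\ 0 < v, 0 < D &
      ((2 * ln 2)^-1 - eps) * ln p^-1 ^+ 2 <= ln (v / D)] by exact: ln_lower.
  have ltest : local_fun (test_fun R n) by exists (segment 1 (2 ^ n)); exact: test_fun_depends.
  have tge : ((v / D)%:E <= relaxation_time X)%E.
    apply: (relaxation_time_ge p01 hpi hmk hst hgen ltest v0 D0).
      exact: (var_test_mean p01 hpi).
    exact: (energy_test_mean p01 hpi).
  have vD0 : 0 < v / D by rewrite divr_gt0.
  have t0 : (0 <= relaxation_time X)%E by apply: le_trans tge; rewrite lee_fin ltW.
  apply: (@le_trans _ _ (lne (v / D)%:E)); first by rewrite lne_EFin// lee_fin.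
  by rewrite lee_lne// in_itv /= ?leey ?andbT ?lee_fin ?(ltW vD0).
Unshelve. all: by end_near.
Qed.
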